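(* Let $\mathbb{X}$ be a complex Banach space. For every $f\in BUC(\mathbb{R}^+,\mathbb{X})$, $$\sigma(f)=\overline{e^{i\cdot sp(f)}},$$ where $e^{i\cdot sp(f)}=\{e^{i\xi}:\xi\in sp(f)\}$ and the bar denotes closure in the topology of the complex plane.
   Context: $\mathbb{R}^+=[0,\infty)$. $BUC(\mathbb{R}^+,\mathbb{X})$ is the Banach space of bounded uniformly continuous functions $\mathbb{R}^+\to\mathbb{X}$ with the sup-norm; $C_0(\mathbb{R}^+,\mathbb{X})$ is its closed subspace of functions tending to $0$ at infinity; $\mathbb{Y}=BUC(\mathbb{R}^+,\mathbb{X})/C_0(\mathbb{R}^+,\mathbb{X})$ with the quotient norm, and $\tilde f$ is the class of $f$. The translation semigroup $[S(t)f](s)=f(s+t)$, $t\ge0$, on $BUC(\mathbb{R}^+,\mathbb{X})$ leaves $C_0(\mathbb{R}^+,\mathbb{X})$ invariant and induces on $\mathbb{Y}$ operators $\tilde S(t)$, which extend to a $C_0$-group of isometries $(\tilde S(t))_{t\in\mathbb{R}}$. Let $\mathcal{D}=d/dt$ in $BUC(\mathbb{R}^+,\mathbb{X})$ with domain $\{f: f'\text{ exists and } f'\in BUC(\mathbb{R}^+,\mathbb{X})\}$. Let $\tilde{\mathcal D}$ be the operator in $\mathbb{Y}$ with domain $\{\tilde f:\ \exists u\in\tilde f,\ u\in D(\mathcal D)\}$ and $\tilde{\mathcal D}\tilde f=\widetilde{\mathcal D u}$ for such $u$ (this is well defined). For $\operatorname{Re}\lambda\ne0$ put $\hat f(\lambda)=(\lambda-\tilde{\mathcal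 D})^{-1}\tilde f$. Then $sp(f)$ is the set of $\xi_0\in\mathbb{R}$ such that $\hat f$ has no analytic extension to any neighborhood of $i\xi_0$. The circular spectrum $\sigma(f)$ is the set of $\lambda_0$ in the unit circle of $\mathbb{C}$ such that the function $\lambda\mapsto R(\lambda,\tilde S(1))\tilde f=(\lambda-\tilde S(1))^{-1}\tilde f$ (defined for $|\lambda|\neq1$) has no analytic extension to any neighborhood of $\lambda_0$. *)

(* Defs.v *)
From Stdlib Require Import Reals Lra Psatz.
From Stdlib Require Import FunctionalExtensionality PropExtensionality.
From Stdlib Require Import ClassicalEpsilon.
From Coquelicot Require Import Coquelicot.

Set Implicit Arguments.
Unset Strict Implicit.
Unset Printing Implicit Defensive.

Open Scope R_scope.

Lemma Lub_real_spec (E : R -> Prop) (M : R) :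
  (exists r, E r) -> (forall r, E r -> r <= M) ->
  (forall r, E r -> r <= real (Lub_Rbar E)) /\
  (forall b, (forall r, E r -> r <= b) -> real (Lub_Rbar E) <= b).
Proof.
intros [r0 H0] HM.
destruct (Lub_Rbar_correct E) as [Hub Hl].
assert (H1 := Hub r0 H0).
assert (H2 : Rbar_le (Lub_Rbar E) M) by (apply Hl; exact HM).
destruct (Lub_Rbar E) as [l| |]; simpl in *; try tauto.
split; [exact Hub|]. intros b Hb. exact (Hl (Finite b) Hb).
Qed.

Lemma Glb_real_spec (E : R -> Prop) (m : R) :
  (exists r, E r) -> (forall r, E r -> m <= r) ->
  (forall r, E r -> real (Glb_Rbar E) <= r) /\
  (forall b, (forall r, E r -> b <= r) -> b <= real (Glb_Rbar E)).
Proof.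
intros [r0 H0] Hm.
destruct (Glb_Rbar_correct E) as [Hlb Hg].
assert (H1 := Hlb r0 H0).
assert (H2 : Rbar_le m (Glb_Rbar E)) by (apply Hg; exact Hm).
destruct (Glb_Rbar E) as [l| |]; simpl in *; try tauto.
split; [exact Hlb|]. intros b Hb. exact (Hg (Finite b) Hb).
Qed.

Lemma minus_plus_plus (G : AbelianGroup) (a b c d : G) :
  minus (plus a b) (plus c d) = plus (minus a c) (minus b d).
Proof.
unfold minus. rewrite (opp_plus (G := G)), <- !(plus_assoc (G := G)). f_equal.
rewrite !(plus_assoc (G := G)). f_equal. apply plus_comm.
Qed.

Lemma minus_minus (G : AbelianGroup) (a b : G) : minus b (minus b a) = a.
Proof.
rewrite <- (opp_minus (G := G) a b). unfold minus.
rewrite (opp_opp (G := G)), (plus_comm (G := G) a), (plus_assoc (G := G)).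
rewrite (plus_opp_r (G := G)). apply plus_zero_l.
Qed.

Lemma minus_minus_zero (G : AbelianGroup) (a b : G) :
  minus (minus a b) (minus a zero) = opp b.
Proof.
rewrite (minus_zero_r (G := G)). unfold minus.
rewrite (plus_comm (G := G) a), <- (plus_assoc (G := G)), (plus_opp_r (G := G)).
apply plus_zero_r.
Qed.

Section NormStructure.

Variables (K : AbsRing) (V : ModuleSpace K) (nrm : V -> R).
Hypothesis nrm_triangle : forall x y, nrm (plus x y) <= nrm x + nrm y.
Hypothesis nrm_scal : forall (l : K) x, nrm (scal l x) <= abs l * nrm x.
Hypothesis nrm_eq0 : forall x, nrm x = 0 -> x = zero.

Let nrm0 : nrm zero = 0.
Proof.
assert (H1 := nrm_scal zero zero).
rewrite (scal_zero_r (V := V)), (@abs_zero K) in H1.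
assert (H2 := nrm_triangle zero zero). rewrite (plus_zero_r (G := V)) in H2. lra.
Qed.

Let nrm_opp x : nrm (opp x) <= nrm x.
Proof.
rewrite <- scal_opp_one.
eapply Rle_trans; [apply nrm_scal|]. rewrite abs_opp_one. lra.
Qed.

Definition norm_uniform_mixin : UniformSpace.mixin_of V.
Proof.
refine (@UniformSpace.Mixin V zero (fun x e y => nrm (minus y x) < e) _ _ _).
- intros x e. rewrite (minus_eq_zero (G := V)).
  eapply Rle_lt_trans; [apply Req_le, nrm0|apply cond_pos].
- intros x y e H. rewrite <- (opp_minus (G := V)).
  eapply Rle_lt_trans; [apply nrm_opp|exact H].
- intros x y z e1 e2 H1 H2. rewrite (minus_trans (G := V) y).
  eapply Rle_lt_trans; [apply nrm_triangle|]. lra.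
Defined.

Definition norm_aux : NormedModuleAux K :=
  NormedModuleAux.Pack K V
    (NormedModuleAux.Class K V (ModuleSpace.class K V) norm_uniform_mixin) V.

Definition norm_mixin : NormedModule.mixin_of K norm_aux.
Proof.
refine (@NormedModule.Mixin K norm_aux nrm 1 _ _ _ _ _).
- exact nrm_triangle.
- exact nrm_scal.
- intros x y e H. exact H.
- intros x y e H. rewrite Rmult_1_l. exact H.
- exact nrm_eq0.
Defined.

End NormStructure.

Record closed_subspace (K : AbsRing) (V : NormedModule K) := ClosedSubspace {
  subspace_mem :> V -> Prop;
  subspace_zero : subspace_mem zero;
  subspace_plus : forall x y,
    subspace_mem x -> subspace_mem y -> subspace_mem (plus x y);
  subspace_scal : forall (l : K) x,
    subspace_mem x -> subspace_mem (scal l x);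
  subspace_closed : closed subspace_mem
}.

Section Quotient.

Variables (K : AbsRing) (V : NormedModule K) (W : closed_subspace V).

Record quotient := Quotient {
  coset :> V -> Prop;
  cosetP : exists v, forall u, coset u <-> W (minus u v)
}.

Definition quot_class (v : V) : quotient :=
  @Quotient (fun u => W (minus u v))
    (ex_intro _ v (fun u => iff_refl _)).

Definition quot_repr (A : quotient) : V :=
  proj1_sig (constructive_indefinite_description _ (cosetP A)).

Lemma quotient_ext (A B : quotient) : (forall u, A u <-> B u) -> A = B.
Proof.
destruct A as [a pa], B as [b pb]; simpl; intros H.
assert (E : a = b).
{ apply functional_extensionality; intros u.
  apply propositional_extensionality, H. }
subst b. f_equal. apply proof_irrelevance.
Qed.

Lemma subspace_opp x : W x -> W (opp x).
Proof. intros H. rewrite <- (scal_opp_one (V := V)). apply subspace_scal, H. Qed.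

Lemma quot_classP (u v : V) : quot_class u = quot_class v <-> W (minus u v).
Proof.
split.
- intros H. change (quot_class v u). rewrite <- H. simpl.
  rewrite (minus_eq_zero (G := V)). apply subspace_zero.
- intros H. apply quotient_ext; intros w; simpl; split; intros Hw.
  + rewrite (minus_trans (G := V) u). apply subspace_plus; assumption.
  + rewrite (minus_trans (G := V) v). apply subspace_plus; [assumption|].
    rewrite <- (opp_minus (G := V)). apply subspace_opp, H.
Qed.

Lemma quot_reprK (A : quotient) : quot_class (quot_repr A) = A.
Proof.
apply quotient_ext; intros u; simpl.
unfold quot_repr; destruct constructive_indefinite_description as [v Hv]; simpl.
symmetry; apply Hv.
Qed.

Lemma quot_class_mem (v : V) (A : quotient) : A v <-> A = quot_class v.
Proof.
rewrite <- (quot_reprK A). rewrite quot_classP. simpl.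
split; intros H; rewrite <- (opp_minus (G := V)); apply subspace_opp, H.
Qed.

Lemma quot_class_eq (u v : V) : quot_class u = quot_class v -> W (minus u v).
Proof. apply quot_classP. Qed.

Definition quot_zero : quotient := quot_class zero.
Definition quot_plus (A B : quotient) : quotient :=
  quot_class (plus (quot_repr A) (quot_repr B)).
Definition quot_opp (A : quotient) : quotient := quot_class (opp (quot_repr A)).
Definition quot_scal (l : K) (A : quotient) : quotient :=
  quot_class (scal l (quot_repr A)).

Lemma quot_plus_class u v :
  quot_plus (quot_class u) (quot_class v) = quot_class (plus u v).
Proof.
apply quot_classP.
assert (Hu := quot_class_eq (quot_reprK (quot_class u))).
assert (Hv := quot_class_eq (quot_reprK (quot_class v))).
rewrite (minus_plus_plus (G := V)). apply subspace_plus; assumption.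
Qed.

Lemma quot_scal_class l u :
  quot_scal l (quot_class u) = quot_class (scal l u).
Proof.
apply quot_classP. rewrite <- (scal_minus_distr_l (V := V)).
apply subspace_scal, quot_class_eq, quot_reprK.
Qed.

Lemma quot_opp_class u : quot_opp (quot_class u) = quot_class (opp u).
Proof.
apply quot_classP.
assert (Hu := quot_class_eq (quot_reprK (quot_class u))).
unfold minus. rewrite <- (opp_plus (G := V)). apply subspace_opp, Hu.
Qed.

Definition quot_AbelianMonoid_mixin : AbelianMonoid.mixin_of quotient.
Proof.
refine (@AbelianMonoid.Mixin quotient quot_plus quot_zero _ _ _).
- intros A B. unfold quot_plus. now rewrite (plus_comm (G := V)).
- intros A B C.
  rewrite <- (quot_reprK A), <- (quot_reprK B), <- (quot_reprK C).
  rewrite !quot_plus_class. now rewrite (plus_assoc (G := V)).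
- intros A. rewrite <- (quot_reprK A). unfold quot_zero.
  rewrite quot_plus_class. now rewrite (plus_zero_r (G := V)).
Defined.

Canonical quot_AbelianMonoid :=
  AbelianMonoid.Pack quotient quot_AbelianMonoid_mixin quotient.

Definition quot_AbelianGroup_mixin : AbelianGroup.mixin_of quot_AbelianMonoid.
Proof.
refine (@AbelianGroup.Mixin quot_AbelianMonoid quot_opp _).
intros A. change (quot_plus A (quot_opp A) = quot_zero).
rewrite <- (quot_reprK A), quot_opp_class, quot_plus_class.
now rewrite (plus_opp_r (G := V)).
Defined.

Canonical quot_AbelianGroup :=
  AbelianGroup.Pack quotient
    (AbelianGroup.Class quotient quot_AbelianMonoid_mixin
       quot_AbelianGroup_mixin) quotient.

Definition quot_ModuleSpace_mixin : ModuleSpace.mixin_of K quot_AbelianGroup.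
Proof.
refine (@ModuleSpace.Mixin K quot_AbelianGroup quot_scal _ _ _ _).
- intros x y A. rewrite <- (quot_reprK A), !quot_scal_class.
  now rewrite (scal_assoc (V := V)).
- intros A. rewrite <- (quot_reprK A), quot_scal_class.
  now rewrite (scal_one (V := V)).
- intros x A B.
  change (quot_scal x (quot_plus A B) = quot_plus (quot_scal x A) (quot_scal x B)).
  rewrite <- (quot_reprK A), <- (quot_reprK B).
  rewrite quot_plus_class, !quot_scal_class, quot_plus_class.
  now rewrite (scal_distr_l (V := V)).
- intros x y A.
  change (quot_scal (plus x y) A = quot_plus (quot_scal x A) (quot_scal y A)).
  rewrite <- (quot_reprK A), !quot_scal_class, quot_plus_class.
  now rewrite (scal_distr_r (V := V)).
Defined.

Canonical quot_ModuleSpace :=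
  ModuleSpace.Pack K quotient
    (ModuleSpace.Class K quotient (AbelianGroup.class quot_AbelianGroup)
       quot_ModuleSpace_mixin) quotient.

Definition quot_norm (A : quotient) : R :=
  real (Glb_Rbar (fun r => exists u, A u /\ r = norm u)).

Lemma quot_norm_spec (A : quotient) :
  (forall u, A u -> quot_norm A <= norm u) /\
  (forall b, (forall u, A u -> b <= norm u) -> b <= quot_norm A).
Proof.
destruct (@Glb_real_spec (fun r => exists u, A u /\ r = norm u) 0) as [H1 H2].
- exists (norm (quot_repr A)), (quot_repr A). split; [|reflexivity].
  apply quot_class_mem. symmetry; apply quot_reprK.
- intros r [u [_ ->]]. apply norm_ge_0.
- split.
  + intros u Hu. apply H1. now exists u.
  + intros b Hb. apply H2. intros r [u [Hu ->]]. now apply Hb.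
Qed.

Lemma quot_norm_ge0 A : 0 <= quot_norm A.
Proof. apply quot_norm_spec. intros u _. apply norm_ge_0. Qed.

Lemma quot_norm_approx (A : quotient) (eps : posreal) :
  exists u, A u /\ norm u < quot_norm A + eps.
Proof.
apply NNPP. intros H.
assert (H1 : quot_norm A + eps <= quot_norm A).
{ apply quot_norm_spec. intros u Hu. apply Rnot_lt_le. intros Hlt.
  apply H. now exists u. }
assert (H2 := cond_pos eps). lra.
Qed.

Lemma quot_norm_triangle (A B : quotient) :
  quot_norm (plus A B) <= quot_norm A + quot_norm B.
Proof.
apply le_epsilon. intros e He.
destruct (quot_norm_approx A (pos_div_2 (mkposreal e He))) as [u [Hu Nu]].
destruct (quot_norm_approx B (pos_div_2 (mkposreal e He))) as [v [Hv Nv]].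
simpl in *.
apply Rle_trans with (norm (plus u v)).
- apply quot_norm_spec. apply quot_class_mem.
  apply quot_class_mem in Hu. apply quot_class_mem in Hv. rewrite Hu, Hv.
  apply quot_plus_class.
- eapply Rle_trans; [apply norm_triangle|]. lra.
Qed.

Lemma quot_norm_scal (l : K) (A : quotient) :
  quot_norm (scal l A) <= abs l * quot_norm A.
Proof.
assert (Hl := abs_ge_0 l).
apply le_epsilon. intros e He.
assert (Hp : 0 < e / (abs l + 1)) by (apply Rdiv_lt_0_compat; lra).
destruct (quot_norm_approx A (mkposreal _ Hp)) as [u [Hu Nu]].
simpl in Nu.
apply Rle_trans with (norm (scal l u)).
- apply quot_norm_spec. apply quot_class_mem.
  apply quot_class_mem in Hu. rewrite Hu. apply quot_scal_class.
- eapply Rle_trans; [apply (@norm_scal K V)|].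
  apply Rle_trans with (abs l * (quot_norm A + e / (abs l + 1))).
  + apply Rmult_le_compat_l; lra.
  + assert (E : abs l * (e / (abs l + 1)) <= e).
    { apply Rmult_le_reg_r with (abs l + 1); [lra|]. field_simplify; nra. }
    lra.
Qed.

Lemma quot_norm_eq0 (A : quotient) : quot_norm A = 0 -> A = zero.
Proof.
intros H0. rewrite <- (quot_reprK A). apply quot_classP.
set (f := quot_repr A).
apply (@subspace_closed K V W). intros [e He].
destruct (quot_norm_approx A e) as [u [Hu Nu]].
rewrite H0, Rplus_0_l in Nu.
assert (Huf : W (minus u f)).
{ apply quot_classP. unfold f. rewrite quot_reprK.
  symmetry. now apply quot_class_mem. }
apply (He (minus f u)).
- apply norm_compat1. rewrite (minus_minus_zero (G := V)), (norm_opp (V := V)).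
  exact Nu.
- rewrite <- (opp_minus (G := V)). apply subspace_opp, Huf.
Qed.

Canonical quot_UniformSpace :=
  UniformSpace.Pack quotient
    (norm_uniform_mixin quot_norm_triangle quot_norm_scal) quotient.

Canonical quot_NormedModuleAux :=
  NormedModuleAux.Pack K quotient
    (NormedModuleAux.Class K quotient (ModuleSpace.class K quot_ModuleSpace)
       (norm_uniform_mixin quot_norm_triangle quot_norm_scal)) quotient.

Canonical quot_NormedModule :=
  NormedModule.Pack K quotient
    (NormedModule.Class K quotient (NormedModuleAux.class K quot_NormedModuleAux)
       (norm_mixin quot_norm_triangle quot_norm_scal quot_norm_eq0)) quotient.

Definition quot_map (T : V -> V) (A : quotient) : quotient :=
  quot_class (T (quot_repr A)).

Lemma quot_map_class (T : V -> V) :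
  (forall u v, T (minus u v) = minus (T u) (T v)) ->
  (forall u, W u -> W (T u)) ->
  forall u, quot_map T (quot_class u) = quot_class (T u).
Proof.
intros HT HW u. apply quot_classP. rewrite <- HT.
apply HW, quot_class_eq, quot_reprK.
Qed.

End Quotient.

Section BUCSpace.

Variable X : NormedModule C_AbsRing.

Record BUC := mkBUC {
  buc_fun :> nonnegreal -> X;
  buc_bounded : exists M : R, forall t, norm (buc_fun t) <= M;
  buc_unif_cont : forall eps : posreal, exists delta : posreal,
    forall s t : nonnegreal, Rabs (s - t) < delta ->
      norm (minus (buc_fun s) (buc_fun t)) < eps
}.

Lemma BUC_ext (f g : BUC) : (forall t, f t = g t) -> f = g.
Proof.
destruct f as [f f1 f2], g as [g g1 g2]; simpl; intros H.
assert (E : f = g) by (apply functional_extensionality, H).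
subst g. f_equal; apply proof_irrelevance.
Qed.

Definition BUC_zero : BUC.
Proof.
refine (@mkBUC (fun _ => zero) _ _).
- exists 0. intros _. rewrite (norm_zero (V := X)). lra.
- intros eps. exists eps. intros s t _. rewrite (minus_eq_zero (G := X)).
  eapply Rle_lt_trans; [apply Req_le, (@norm_zero C_AbsRing X)|apply cond_pos].
Defined.

Definition BUC_plus (f g : BUC) : BUC.
Proof.
refine (@mkBUC (fun t => plus (f t) (g t)) _ _).
- destruct (buc_bounded f) as [M HM], (buc_bounded g) as [N HN].
  exists (M + N). intros t. eapply Rle_trans; [apply norm_triangle|].
  specialize (HM t); specialize (HN t); lra.
- intros eps.
  destruct (buc_unif_cont f (pos_div_2 eps)) as [d Hd].
  destruct (buc_unif_cont g (pos_div_2 eps)) as [d' Hd'].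
  exists (mkposreal (Rmin d d') (Rmin_stable_in_posreal d d')).
  simpl. intros s t Hst.
  rewrite (minus_plus_plus (G := X)). eapply Rle_lt_trans; [apply norm_triangle|].
  assert (H1 := Hd s t (Rlt_le_trans _ _ _ Hst (Rmin_l _ _))).
  assert (H2 := Hd' s t (Rlt_le_trans _ _ _ Hst (Rmin_r _ _))).
  simpl in *. lra.
Defined.

Definition BUC_scal (l : C) (f : BUC) : BUC.
Proof.
refine (@mkBUC (fun t => scal (l : C_AbsRing) (f t)) _ _).
- destruct (buc_bounded f) as [M HM]. exists (Cmod l * M). intros t.
  eapply Rle_trans; [apply (@norm_scal C_AbsRing X)|].
  apply Rmult_le_compat_l; [apply Cmod_ge_0|apply HM].
- intros eps. assert (Hl := Cmod_ge_0 l).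
  assert (Hp : 0 < eps / (Cmod l + 1)).
  { apply Rdiv_lt_0_compat; [apply cond_pos|lra]. }
  destruct (buc_unif_cont f (mkposreal _ Hp)) as [d Hd].
  exists d. intros s t Hst. rewrite <- (scal_minus_distr_l (V := X)).
  eapply Rle_lt_trans; [apply (@norm_scal C_AbsRing X)|].
  assert (H := Hd s t Hst). simpl in H.
  assert (H0 := norm_ge_0 (minus (f s) (f t))).
  change (@abs C_AbsRing l) with (Cmod l).
  apply (Rmult_lt_compat_r (Cmod l + 1)) in H; [|lra].
  replace (eps / (Cmod l + 1) * (Cmod l + 1)) with (pos eps) in H by (field; lra).
  eapply Rle_lt_trans; [|exact H].
  rewrite Rmult_comm. apply Rmult_le_compat_l; [exact H0|lra].
Defined.

Definition BUC_opp (f : BUC) : BUC := BUC_scal (opp (one : C_AbsRing)) f.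

Definition BUC_AbelianMonoid_mixin : AbelianMonoid.mixin_of BUC.
Proof.
refine (@AbelianMonoid.Mixin BUC BUC_plus BUC_zero _ _ _).
- intros f g. apply BUC_ext; intros t; simpl. apply plus_comm.
- intros f g h. apply BUC_ext; intros t; simpl. apply plus_assoc.
- intros f. apply BUC_ext; intros t; simpl. apply plus_zero_r.
Defined.

Canonical BUC_AbelianMonoid :=
  AbelianMonoid.Pack BUC BUC_AbelianMonoid_mixin BUC.

Definition BUC_AbelianGroup_mixin : AbelianGroup.mixin_of BUC_AbelianMonoid.
Proof.
refine (@AbelianGroup.Mixin BUC_AbelianMonoid BUC_opp _).
intros f. apply BUC_ext; intros t; simpl.
rewrite (@scal_opp_one C_AbsRing X). apply (@plus_opp_r X).
Defined.

Canonical BUC_AbelianGroup :=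
  AbelianGroup.Pack BUC
    (AbelianGroup.Class BUC BUC_AbelianMonoid_mixin BUC_AbelianGroup_mixin) BUC.

Definition BUC_ModuleSpace_mixin : ModuleSpace.mixin_of C_AbsRing BUC_AbelianGroup.
Proof.
refine (@ModuleSpace.Mixin C_AbsRing BUC_AbelianGroup BUC_scal _ _ _ _).
- intros x y f. apply BUC_ext; intros t. apply (@scal_assoc C_AbsRing X).
- intros f. apply BUC_ext; intros t. apply (@scal_one C_AbsRing X).
- intros x f g. apply BUC_ext; intros t. apply (@scal_distr_l C_AbsRing X).
- intros x y f. apply BUC_ext; intros t. apply (@scal_distr_r C_AbsRing X).
Defined.

Canonical BUC_ModuleSpace :=
  ModuleSpace.Pack C_AbsRing BUC
    (ModuleSpace.Class C_AbsRing BUC (AbelianGroup.class BUC_AbelianGroup)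
       BUC_ModuleSpace_mixin) BUC.

Definition BUC_norm (f : BUC) : R :=
  real (Lub_Rbar (fun r => exists t, r = norm (f t))).

Lemma BUC_norm_spec (f : BUC) :
  (forall t, norm (f t) <= BUC_norm f) /\
  (forall b, (forall t, norm (f t) <= b) -> BUC_norm f <= b).
Proof.
destruct (buc_bounded f) as [M HM].
destruct (@Lub_real_spec (fun r => exists t, r = norm (f t)) M) as [H1 H2].
- exists (norm (f (mknonnegreal 0 (Rle_refl 0)))). now eexists.
- intros r [t ->]. apply HM.
- split.
  + intros t. apply H1. now exists t.
  + intros b Hb. apply H2. intros r [t ->]. apply Hb.
Qed.

Lemma BUC_norm_triangle (f g : BUC) :
  BUC_norm (plus f g) <= BUC_norm f + BUC_norm g.
Proof.
apply BUC_norm_spec. intros t. eapply Rle_trans; [apply norm_triangle|].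
apply Rplus_le_compat; apply BUC_norm_spec.
Qed.

Lemma BUC_norm_scal (l : C_AbsRing) (f : BUC) :
  BUC_norm (scal l f) <= abs l * BUC_norm f.
Proof.
apply BUC_norm_spec. intros t.
eapply Rle_trans; [apply (@norm_scal C_AbsRing X)|].
apply Rmult_le_compat_l; [apply abs_ge_0|apply BUC_norm_spec].
Qed.

Lemma BUC_norm_eq0 (f : BUC) : BUC_norm f = 0 -> f = zero.
Proof.
intros H0. apply BUC_ext; intros t. apply norm_eq_zero.
apply Rle_antisym; [|apply norm_ge_0]. rewrite <- H0. apply BUC_norm_spec.
Qed.

Canonical BUC_UniformSpace :=
  UniformSpace.Pack BUC
    (norm_uniform_mixin BUC_norm_triangle BUC_norm_scal) BUC.

Canonical BUC_NormedModuleAux :=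
  NormedModuleAux.Pack C_AbsRing BUC
    (NormedModuleAux.Class C_AbsRing BUC (ModuleSpace.class C_AbsRing BUC_ModuleSpace)
       (norm_uniform_mixin BUC_norm_triangle BUC_norm_scal)) BUC.

Canonical BUC_NormedModule :=
  NormedModule.Pack C_AbsRing BUC
    (NormedModule.Class C_AbsRing BUC (NormedModuleAux.class C_AbsRing BUC_NormedModuleAux)
       (norm_mixin BUC_norm_triangle BUC_norm_scal BUC_norm_eq0)) BUC.

Definition vanishes_at_infinity (f : BUC) : Prop :=
  forall eps : posreal, exists T : R,
    forall t : nonnegreal, T <= t -> norm (f t) < eps.

Definition C0 : closed_subspace BUC_NormedModule.
Proof.
refine (@ClosedSubspace C_AbsRing BUC_NormedModule vanishes_at_infinity _ _ _ _).
- intros eps. exists 0. intros t _. simpl. rewrite (norm_zero (V := X)). apply cond_pos.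
- intros f g Hf Hg eps.
  destruct (Hf (pos_div_2 eps)) as [T HT], (Hg (pos_div_2 eps)) as [T' HT'].
  exists (Rmax T T'). intros t Ht. simpl.
  eapply Rle_lt_trans; [apply norm_triangle|].
  assert (H1 := HT t (Rle_trans _ _ _ (Rmax_l _ _) Ht)).
  assert (H2 := HT' t (Rle_trans _ _ _ (Rmax_r _ _) Ht)).
  simpl in *. lra.
- intros l f Hf eps. assert (Hl := Cmod_ge_0 l).
  assert (Hp : 0 < eps / (Cmod l + 1)).
  { apply Rdiv_lt_0_compat; [apply cond_pos|lra]. }
  destruct (Hf (mkposreal _ Hp)) as [T HT]. exists T. intros t Ht.
  eapply Rle_lt_trans; [apply (@norm_scal C_AbsRing X)|].
  assert (H := HT t Ht). simpl in H. assert (H0 := norm_ge_0 (f t)).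
  change (@abs C_AbsRing l) with (Cmod l).
  apply (Rmult_lt_compat_r (Cmod l + 1)) in H; [|lra].
  replace (eps / (Cmod l + 1) * (Cmod l + 1)) with (pos eps) in H by (field; lra).
  eapply Rle_lt_trans; [|exact H].
  rewrite Rmult_comm. apply Rmult_le_compat_l; [exact H0|lra].
- intros f Hf eps. apply NNPP. intros Hne. apply Hf.
  exists (pos_div_2 eps). intros g Hg Hg0. apply Hne.
  destruct (Hg0 (pos_div_2 eps)) as [T HT]. exists T. intros t Ht.
  assert (H1 := HT t Ht).
  assert (H2 : norm (minus (g t) (f t)) < pos_div_2 eps).
  { eapply Rle_lt_trans; [|exact Hg].
    rewrite <- (proj1 (BUC_norm_spec _) t). simpl.
    rewrite (@scal_opp_one C_AbsRing X). apply Rle_refl. }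
  replace (f t) with (minus (g t) (minus (g t) (f t))).
  + eapply Rle_lt_trans; [apply norm_triangle|]. rewrite (norm_opp (V := X)).
    simpl in *. lra.
  + apply minus_minus.
Defined.

Definition Y : NormedModule C_AbsRing := quot_NormedModule C0.

Definition tilde (f : BUC) : Y := quot_class C0 f.

Definition nonneg_plus (s t : nonnegreal) : nonnegreal :=
  mknonnegreal (s + t) (Rplus_le_le_0_compat _ _ (cond_nonneg s) (cond_nonneg t)).

Definition shift (t : nonnegreal) (f : BUC) : BUC.
Proof.
refine (@mkBUC (fun s => f (nonneg_plus s t)) _ _).
- destruct (buc_bounded f) as [M HM]. exists M. intros s. apply HM.
- intros eps. destruct (buc_unif_cont f eps) as [d Hd]. exists d.
  intros r s Hrs. apply Hd. simpl.
  now replace (r + t - (s + t)) with (r - s) by ring.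
Defined.

Definition shift_tilde (t : nonnegreal) : Y -> Y := @quot_map _ _ C0 (shift t).

Lemma shift_tildeE t f : shift_tilde t (tilde f) = tilde (shift t f).
Proof.
apply (@quot_map_class _ _ C0).
- intros u v. apply BUC_ext; intros s. reflexivity.
- intros u Hu eps. destruct (Hu eps) as [T HT]. exists T. intros s Hs.
  apply HT. simpl. assert (H := cond_nonneg t). lra.
Qed.

(** [f] is differentiable on the half-line with derivative [g]; at [0] the
    derivative is one-sided, since [s] ranges over nonnegative reals. *)
Definition has_derivative (f g : BUC) : Prop :=
  forall (t : nonnegreal) (eps : posreal), exists delta : posreal,
    forall s : nonnegreal, s <> t :> R -> Rabs (s - t) < delta ->
      norm (minus (scal (RtoC (/ (s - t)) : C_AbsRing) (minus (f s) (f t))) (g t))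
        < eps.

(** Operators, possibly unbounded, are given by their graphs. *)
Definition D_tilde (a b : Y) : Prop :=
  exists u v : BUC, has_derivative u v /\ a = tilde u /\ b = tilde v.

End BUCSpace.

(** [resolvent T z y] is [(z - T)^{-1} y] for the operator with graph [T];
    it has no meaning unless [z - T] is a bijection from the domain of [T]. *)
Definition resolvent (V : ModuleSpace C_AbsRing) (T : V -> V -> Prop)
    (z : C) (y : V) : V :=
  epsilon (inhabits zero)
    (fun x => exists w, T x w /\ minus (scal (z : C_AbsRing) x) w = y).

(** Analyticity of vector-valued functions is complex differentiability at each
    point (of an open set), for the norm topology of [V]. *)
Definition analytic_on (V : NormedModule C_AbsRing) (U : C -> Prop) (h : C -> V) :=
  forall z : C, U z -> @ex_derive C_AbsRing V h z.

(** [F] is only meaningful on [dom]; the neighborhood [U] of [z0] is arbitrary. *)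
Definition extends_analytically_at (V : NormedModule C_AbsRing)
    (dom : C -> Prop) (F : C -> V) (z0 : C) : Prop :=
  exists (U : C -> Prop) (h : C -> V),
    open U /\ U z0 /\ analytic_on U h /\
    forall z, U z -> dom z -> h z = F z.

Section Spectra.

Variables (X : NormedModule C_AbsRing) (f : BUC X).

Definition hat (z : C) : Y X := resolvent (@D_tilde X) z (tilde f).

Definition sp (xi : R) : Prop :=
  ~ extends_analytically_at (fun z : C => Re z <> 0) hat (0, xi).

Definition circular_spectrum (z0 : C) : Prop :=
  Cmod z0 = 1 /\
  ~ extends_analytically_at (fun z : C => Cmod z <> 1)
      (fun z => resolvent
         (fun a b : Y X => b = shift_tilde (mknonnegreal 1 Rle_0_1) a)
         z (tilde f)) z0.

End Spectra.

Definition cis (x : R) : C := (cos x, sin x).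

Definition closure (T : UniformSpace) (A : T -> Prop) (x : T) : Prop :=
  forall eps : posreal, exists y, ball x eps y /\ A y.

(* Main.v *)
Require Import Defs.
From Stdlib Require Import Reals Lra Lia List.
From Stdlib Require Import Classical ClassicalEpsilon.
From Stdlib Require Import FunctionalExtensionality PropExtensionality.
From Coquelicot Require Import Coquelicot.

(** Write [S(t)] for the translation group on [Y] and
    [B(l) y = int_0^1 e^(l(1-s)) S(s) y ds]. Then [(e^l - S(1)) hat f(l) = B(l) f], so
    [hat f(l) = B(l) R(e^l, S(1)) f], and [B(l) h(e^l)] extends [hat f] near [i xi] as soon
    as [h] extends the resolvent of [S(1)] near [e^(i xi)].

    Conversely assume, after twisting the group, that [hat f] extends near all the points
    [2 pi i k], uniformly in [k]. Its boundary values solve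
    [(e^(ix) - S(1)) H_k(x) = int_0^1 e^(-2 pi i k s) e^(ix(1-s)) S(s) f ds] for small [x],
    and only their continuity matters. Linear combinations replace [e^(-2 pi i k s)] by
    [sin^(2N)(pi s)], which concentrates at [s = 1/2]. Multiplying by [e^(-i(n+1)x) S(n)],
    averaging over small [x] and summing over [n], the left side telescopes and vanishes in
    the limit by the Riemann-Lebesgue lemma; the right side then yields
    [sum_n m(n+1/2) S(n) f = 0], where [m], a fourth power of a sinc, is the multiplier of the
    averaging. Since [sum_n m(n+1/2) > 0] and [m] decays fast, dividing
    [sum_n m(n+1/2) (1 - S(n))] by [1 - S(1)] gives a bounded operator [T] that commutes with
    [S(1)] and satisfies [(1 - S(1)) T f = f]. The Neumann series of [T] then provides the
    resolvent of [S(1)] at [f] near [1]. *)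

(** Since $\xi$ and $\xi+2\pi k$ have the same image on the circle, a disk around $e^{i\xi_0}$ that
    misses $e^{i\,sp(f)}$ makes $\hat f$ regular on intervals of one common length around all
    $\xi_0+2\pi k$. The length is all that is common: the boundary values may grow with $k$, so no
    infinite Fourier series in $s$ can be summed. Hence the trigonometric polynomials: for each $N$
    only finitely many $k$ occur, and $N$ is fixed before the summation range tends to infinity. The
    inverse is only local: $1-S(1)$ may fail to be invertible, and $T$ is asked to invert it at $f$
    alone, which is what $R(\lambda,S(1))f$ requires. Sampling at $s=1/2$ makes the weights
    symmetric under $n\mapsto-n-1$, and $2-S(n)-S(-n-1)$ is divisible by $1-S(1)$ with a quotient
    made of $2n+1$ translates. So $\sum n\,m(n+1/2)$ has to converge while $m$ stays nonnegative:
    the square of a sinc decays too slowly, its cube changes sign, the fourth power meets both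
    demands. *)

Open Scope R_scope.

(** * Linear identities and restriction of scalars *)

Section VectorExpressions.

Variable V : NormedModule C_AbsRing.

Inductive vexpr :=
| VZero : vexpr
| VAtom : nat -> vexpr
| VPlus : vexpr -> vexpr -> vexpr
| VOpp : vexpr -> vexpr
| VScal : C -> vexpr -> vexpr.

Fixpoint veval (env : list V) (e : vexpr) : V :=
  match e with
  | VZero => zero
  | VAtom n => nth n env zero
  | VPlus a b => plus (veval env a) (veval env b)
  | VOpp a => opp (veval env a)
  | VScal c a => scal (c : C_AbsRing) (veval env a)
  end.

Fixpoint vcoef (e : vexpr) (n : nat) : C :=
  match e with
  | VZero => RtoC 0
  | VAtom m => if Nat.eqb m n then RtoC 1 else RtoC 0
  | VPlus a b => Cplus (vcoef a n) (vcoef b n)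
  | VOpp a => Copp (vcoef a n)
  | VScal c a => Cmult c (vcoef a n)
  end.

Fixpoint vcomb (k : nat) (f : nat -> C) (env : list V) : V :=
  match env with
  | nil => zero
  | v :: env' => plus (scal (f k : C_AbsRing) v) (vcomb (S k) f env')
  end.

Lemma vcomb_ext k f g env : (forall n, f n = g n) -> vcomb k f env = vcomb k g env.
Proof. intros H; revert k; induction env; intros k; simpl; [easy|]. now rewrite H, IHenv. Qed.

Lemma vcomb_zero k env : vcomb k (fun _ => RtoC 0) env = zero.
Proof.
revert k; induction env; intros k; simpl; [easy|].
rewrite IHenv, (plus_zero_r (G := V)). apply (scal_zero_l (V := V)).
Qed.

Lemma vcomb_plus k f g env :
  vcomb k (fun n => Cplus (f n) (g n)) env = plus (vcomb k f env) (vcomb k g env).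
Proof.
revert k; induction env; intros k; simpl.
- symmetry; apply (plus_zero_r (G := V)).
- rewrite IHenv. change (Cplus (f k) (g k)) with (plus (f k : C_AbsRing) (g k)).
  rewrite (scal_distr_r (V := V)).
  rewrite <- !(plus_assoc (G := V)). f_equal. rewrite !(plus_assoc (G := V)). f_equal.
  apply plus_comm.
Qed.

Lemma vcomb_scal k c f env :
  vcomb k (fun n => Cmult c (f n)) env = scal (c : C_AbsRing) (vcomb k f env).
Proof.
revert k; induction env; intros k; simpl.
- symmetry; apply (scal_zero_r (V := V)).
- rewrite IHenv, (scal_distr_l (V := V)). f_equal. symmetry; apply (scal_assoc (V := V)).
Qed.

Lemma vcomb_opp k f env : vcomb k (fun n => Copp (f n)) env = opp (vcomb k f env).
Proof.
rewrite <- (scal_opp_one (V := V)), <- vcomb_scal. apply vcomb_ext. intros n.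
change (Copp (f n) = Cmult (Copp (RtoC 1)) (f n)). ring.
Qed.

Lemma vcomb_small env : forall k m, (m < k)%nat ->
  vcomb k (fun n => if Nat.eqb m n then RtoC 1 else RtoC 0) env = zero.
Proof.
induction env; intros k m H; simpl; [easy|].
rewrite IHenv by lia. replace (Nat.eqb m k) with false by (symmetry; apply Nat.eqb_neq; lia).
rewrite (plus_zero_r (G := V)). apply (scal_zero_l (V := V)).
Qed.

Lemma vcomb_atom env : forall k m,
  vcomb k (fun n => if Nat.eqb (k + m) n then RtoC 1 else RtoC 0) env = nth m env zero.
Proof.
induction env; intros k m; simpl; [now destruct m|].
destruct m as [|m].
- replace (k + 0)%nat with k by lia. rewrite Nat.eqb_refl.
  rewrite vcomb_small by lia. rewrite (plus_zero_r (G := V)). apply (scal_one (V := V)).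
- replace (Nat.eqb (k + S m) k) with false by (symmetry; apply Nat.eqb_neq; lia).
  replace (k + S m)%nat with (S k + m)%nat by lia. rewrite IHenv.
  replace (scal (RtoC 0 : C_AbsRing) a) with (zero : V)
    by (symmetry; apply (scal_zero_l (V := V))).
  apply plus_zero_l.
Qed.

Lemma veval_comb env e : veval env e = vcomb 0 (vcoef e) env.
Proof.
induction e; simpl.
- symmetry; apply vcomb_zero.
- symmetry; apply (vcomb_atom env 0).
- now rewrite vcomb_plus, IHe1, IHe2.
- now rewrite vcomb_opp, IHe.
- now rewrite vcomb_scal, IHe.
Qed.

(** Compares coefficients only at the atoms present, by recursion on their number, so that
    simplification unfolds it into a finite conjunction of equations in $\mathbb{C}$. *)
Fixpoint vsame (k n : nat) (f g : nat -> C) : Prop :=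
  match n with
  | O => True
  | S n' => f k = g k /\ vsame (S k) n' f g
  end.

Lemma vcomb_same env f g : forall k, vsame k (length env) f g -> vcomb k f env = vcomb k g env.
Proof.
induction env; intros k; simpl; [easy|]. intros [H1 H2]. now rewrite H1, IHenv.
Qed.

Lemma veval_same env e1 e2 :
  vsame 0 (length env) (vcoef e1) (vcoef e2) -> veval env e1 = veval env e2.
Proof. intros H. rewrite !veval_comb. now apply vcomb_same. Qed.

End VectorExpressions.

Ltac vadd x l :=
  let rec go l0 :=
    match l0 with
    | nil => constr:(cons x l)
    | cons x _ => l
    | cons _ ?l1 => go l1
    end in go l.

Ltac vatoms l e :=
  match e with
  | @zero _ => l
  | @plus _ ?a ?b => let l1 := vatoms l a in vatoms l1 b
  | @minus _ ?a ?b => let l1 := vatoms l a in vatoms l1 b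
  | @opp _ ?a => vatoms l a
  | @scal _ _ _ ?a => vatoms l a
  | _ => vadd e l
  end.

Ltac vindex x l :=
  match l with
  | cons x _ => constr:(O)
  | cons _ ?l1 => let n := vindex x l1 in constr:(S n)
  end.

Ltac vreify l e :=
  match e with
  | @zero _ => constr:(VZero)
  | @plus _ ?a ?b =>
      let a' := vreify l a in let b' := vreify l b in constr:(VPlus a' b')
  | @minus _ ?a ?b =>
      let a' := vreify l a in let b' := vreify l b in constr:(VPlus a' (VOpp b'))
  | @opp _ ?a => let a' := vreify l a in constr:(VOpp a')
  | @scal _ _ ?c ?a => let a' := vreify l a in constr:(VScal c a')
  | _ => let n := vindex e l in constr:(VAtom n)
  end.

Ltac cring :=
  repeat match goal with
  | |- context [@mult ?K ?a ?b] => change (@mult K a b) with (Cmult a b)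
  | |- context [@plus ?K ?a ?b] => change (@plus K a b) with (Cplus a b)
  | |- context [@minus ?K ?a ?b] => change (@minus K a b) with (Cminus a b)
  | |- context [@opp ?K ?a] => change (@opp K a) with (Copp a)
  | |- context [@one ?K] => change (@one K) with (RtoC 1)
  | |- context [@zero ?K] => change (@zero K) with (RtoC 0)
  end;
  unfold Cminus, Cdiv; try ring;
  try (repeat first [rewrite RtoC_minus | rewrite RtoC_plus | rewrite RtoC_mult | rewrite RtoC_opp]; ring).

(* Decides linear identities in a complex vector space, leaving to [ring] the
   comparison of the coefficients of each atom. *)
Ltac vec V :=
  match goal with
  | |- ?a = ?b =>
      let l0 := constr:(@nil (NormedModule.sort C_AbsRing V)) in
      let l1 := vatoms l0 a in
      let l := vatoms l1 b in
      let a' := vreify l a in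
      let b' := vreify l b in
      change (veval V l a' = veval V l b'); apply veval_same; simpl;
      repeat split; cring
  end.

Ltac norm_as V e :=
  cbv beta;
  match goal with |- context [@norm C_AbsRing ?W ?x] => replace x with e; [|vec V] end.

Section Restriction.

Variable V : NormedModule C_AbsRing.

(** The Riemann integral over a real interval takes values in a normed module over [R]. Scalars are
    therefore restricted along [RtoC], with norm and uniform structure unchanged, so that integrals
    of functions into a complex space make sense. *)
Definition real_scal (r : R) (x : V) : V := scal (RtoC r : C_AbsRing) x.

Definition real_ModuleSpace_mixin :
  ModuleSpace.mixin_of R_Ring (NormedModule.AbelianGroup C_AbsRing V).
Proof.
refine (@ModuleSpace.Mixin R_Ring (NormedModule.AbelianGroup C_AbsRing V) real_scal _ _ _ _);
  unfold real_scal.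
- intros x y u. rewrite (scal_assoc (V := V)). f_equal.
  symmetry; apply RtoC_mult.
- intros u. apply (scal_one (V := V)).
- intros x u v. apply (scal_distr_l (V := V)).
- intros x y u. rewrite <- (scal_distr_r (V := V)). f_equal. apply RtoC_plus.
Defined.

Definition real_NormedModuleAux : NormedModuleAux R_AbsRing :=
  NormedModuleAux.Pack R_AbsRing V
    (NormedModuleAux.Class R_AbsRing V
       (ModuleSpace.Class R_Ring V
          (AbelianGroup.class (NormedModule.AbelianGroup C_AbsRing V))
          real_ModuleSpace_mixin)
       (UniformSpace.class (NormedModule.UniformSpace C_AbsRing V))) V.

Definition real_NormedModule_mixin : NormedModule.mixin_of R_AbsRing real_NormedModuleAux.
Proof.
refine (@NormedModule.Mixin R_AbsRing real_NormedModuleAux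
  (fun x : V => @norm C_AbsRing V x) (@norm_factor C_AbsRing V) _ _ _ _ _).
- exact (@norm_triangle C_AbsRing V).
- intros r x. rewrite <- (Cmod_R r : Cmod r = abs r). exact (@norm_scal C_AbsRing V (RtoC r) x).
- exact (@norm_compat1 C_AbsRing V).
- exact (@norm_compat2 C_AbsRing V).
- exact (@norm_eq_zero C_AbsRing V).
Defined.

Definition real_NormedModule : NormedModule R_AbsRing :=
  NormedModule.Pack R_AbsRing V
    (NormedModule.Class R_AbsRing V
       (NormedModuleAux.class R_AbsRing real_NormedModuleAux) real_NormedModule_mixin) V.

End Restriction.

Definition real_CompleteNormedModule (V : CompleteNormedModule C_AbsRing) :
  CompleteNormedModule R_AbsRing :=
  CompleteNormedModule.Pack R_AbsRing V
    (CompleteNormedModule.Class R_AbsRing V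
       (NormedModule.class R_AbsRing (real_NormedModule V))
       (CompleteSpace.class (CompleteNormedModule.CompleteSpace C_AbsRing V))) V.

(** * Continuity and differentiability *)

Section NormFacts.

Variable V : NormedModule C_AbsRing.

(** The axioms give only one inequality; applied to $1/c$ it gives the other. *)
Lemma norm_scalC (c : C) (x : V) : norm (scal (c : C_AbsRing) x) = Cmod c * norm x.
Proof.
apply Rle_antisym; [apply (@norm_scal C_AbsRing V)|].
destruct (classic (c = RtoC 0)) as [->|Hc].
- rewrite Cmod_0, Rmult_0_l. apply norm_ge_0.
- assert (Hp := proj1 (Cmod_gt_0 c) Hc).
  replace x with (scal (/ c : C_AbsRing)%C (scal (c : C_AbsRing) x)) at 1
    by (vec V; field; exact Hc).
  apply Rle_trans with (Cmod c * (Cmod (/ c) * norm (scal (c : C_AbsRing) x))).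
  + apply Rmult_le_compat_l; [apply Cmod_ge_0|]. apply (@norm_scal C_AbsRing V).
  + rewrite Cmod_inv by exact Hc. apply Req_le. field. lra.
Qed.

Lemma norm_minus_sym (x y : V) : norm (minus x y) = norm (minus y x).
Proof. rewrite <- (norm_opp (V := V)). f_equal. vec V. Qed.

Lemma norm_plus_le (x y : V) : norm (plus x y) <= norm x + norm y.
Proof. apply (@norm_triangle C_AbsRing V). Qed.

Lemma norm_minus_le (x y : V) : norm (minus x y) <= norm x + norm y.
Proof. rewrite <- (norm_opp (V := V) y). apply (@norm_triangle C_AbsRing V). Qed.

Lemma norm_minus_trans (x y z : V) : norm (minus x z) <= norm (minus x y) + norm (minus y z).
Proof. replace (minus x z) with (plus (minus x y) (minus y z)) by vec V. apply norm_triangle. Qed.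

Lemma norm_le_minus (x y : V) : norm x <= norm y + norm (minus x y).
Proof. replace x with (plus y (minus x y)) at 1 by vec V. apply norm_triangle. Qed.

Lemma minus_zero_eq (x y : V) : minus x y = zero -> x = y.
Proof. intros H. replace x with (plus y (minus x y)) by vec V. rewrite H. vec V. Qed.

Lemma norm_small_zero (x : V) : (forall eps, 0 < eps -> norm x <= eps) -> x = zero.
Proof.
intros H. apply (norm_eq_zero (V := V)). apply Rle_antisym; [|apply norm_ge_0].
apply le_epsilon. intros e He. rewrite Rplus_0_l. now apply H.
Qed.

Lemma vanishing_eq (x y : V) : (forall eps, 0 < eps -> norm (minus x y) <= eps) -> x = y.
Proof. intros H. now apply minus_zero_eq, norm_small_zero. Qed.

Lemma norm_zeroC : norm (zero : V) = 0.
Proof. apply (@norm_zero C_AbsRing V). Qed.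

End NormFacts.

Lemma Cmod_RtoC_minus (x y : R) : Cmod (Cminus (RtoC x) (RtoC y)) = Rabs (x - y).
Proof. rewrite <- RtoC_minus. apply Cmod_R. Qed.

(* The parameter ranges over a set [P] embedded in the complex plane by [io], so
   that real and complex differentiability are instances of the same notion. *)
Section Calculus.

Variables (P : Type) (io : P -> C) (V : NormedModule C_AbsRing).

Definition cont_at (u : P -> V) (x : P) : Prop :=
  forall eps, 0 < eps -> exists d, 0 < d /\
    forall y, Cmod (io y - io x) < d -> norm (minus (u y) (u x)) < eps.

Definition diff_at (u : P -> V) (x : P) (l : V) : Prop :=
  forall eps, 0 < eps -> exists d, 0 < d /\
    forall y, Cmod (io y - io x) < d ->
      norm (minus (minus (u y) (u x)) (scal (Cminus (io y) (io x) : C_AbsRing) l))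
        <= eps * Cmod (io y - io x).

Lemma diff_cont u x l : diff_at u x l -> cont_at u x.
Proof.
intros H eps He. destruct (H 1 Rlt_0_1) as [d [Hd H1]].
assert (Hl := norm_ge_0 l).
assert (Hp : 0 < eps / (2 + norm l)) by (apply Rdiv_lt_0_compat; lra).
exists (Rmin d (eps / (2 + norm l))). split; [now apply Rmin_glb_lt|].
intros y Hy. specialize (H1 y (Rlt_le_trans _ _ _ Hy (Rmin_l _ _))).
assert (H2 := Rlt_le_trans _ _ _ Hy (Rmin_r _ _)).
eapply Rle_lt_trans; [apply (norm_le_minus _ _ (scal (Cminus (io y) (io x) : C_AbsRing) l))|].
rewrite norm_scalC. assert (H3 := Cmod_ge_0 (io y - io x)).
apply (Rmult_lt_compat_r (2 + norm l)) in H2; [|lra].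
replace (eps / (2 + norm l) * (2 + norm l)) with eps in H2 by (field; lra).
lra.
Qed.

(** The derivatives computed by hand below (exponentials, integrals with an exponential kernel,
    Neumann series) all come with an explicit quadratic remainder. *)
Lemma diff_quad u x l K rho :
  0 < rho ->
  (forall y, Cmod (io y - io x) <= rho ->
    norm (minus (minus (u y) (u x)) (scal (Cminus (io y) (io x) : C_AbsRing) l))
      <= K * Cmod (io y - io x) * Cmod (io y - io x)) ->
  diff_at u x l.
Proof.
intros Hr H eps He. assert (HK := Rabs_pos K).
assert (Hp : 0 < eps / (1 + Rabs K)) by (apply Rdiv_lt_0_compat; lra).
exists (Rmin rho (eps / (1 + Rabs K))). split; [apply Rmin_glb_lt; lra|].
intros y Hy.
assert (H1 := Rlt_le_trans _ _ _ Hy (Rmin_l _ _)).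
assert (H2 := Rlt_le_trans _ _ _ Hy (Rmin_r _ _)).
eapply Rle_trans; [apply H; lra|].
assert (H0 := Cmod_ge_0 (io y - io x)). apply Rmult_le_compat_r; [easy|].
apply (Rmult_lt_compat_r (1 + Rabs K)) in H2; [|lra].
replace (eps / (1 + Rabs K) * (1 + Rabs K)) with eps in H2 by (field; lra).
assert (H3 := Rle_abs K). nra.
Qed.

Lemma cont_plus u v x : cont_at u x -> cont_at v x -> cont_at (fun y => plus (u y) (v y)) x.
Proof.
intros Hu Hv eps He.
destruct (Hu (eps / 2)) as [d [Hd H1]]; [lra|].
destruct (Hv (eps / 2)) as [d' [Hd' H2]]; [lra|].
exists (Rmin d d'). split; [now apply Rmin_glb_lt|]. intros y Hy.
specialize (H1 y (Rlt_le_trans _ _ _ Hy (Rmin_l _ _))).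
specialize (H2 y (Rlt_le_trans _ _ _ Hy (Rmin_r _ _))).
rewrite (minus_plus_plus (G := V)). eapply Rle_lt_trans; [apply norm_triangle|]. lra.
Qed.

Lemma cont_const (v : V) x : cont_at (fun _ => v) x.
Proof.
intros eps He. exists 1. split; [lra|]. intros y _.
rewrite (minus_eq_zero (G := V)), norm_zeroC. exact He.
Qed.

Lemma cont_ext u v x : (forall y, u y = v y) -> cont_at u x -> cont_at v x.
Proof.
intros E H eps He. destruct (H eps He) as [d [Hd H1]]. exists d. split; [easy|].
intros y Hy. rewrite <- !E. now apply H1.
Qed.

(* Product rule for a family of bounded operators that is differentiable in
   operator norm, with a quadratic remainder. *)
Lemma diff_op (W : NormedModule C_AbsRing) (B : P -> W -> V) (B' : W -> V)
    (w : P -> W) x l M K rho :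
  (forall y u v, B y (minus u v) = minus (B y u) (B y v)) ->
  (forall (c : C) u, B x (scal (c : C_AbsRing) u) = scal (c : C_AbsRing) (B x u)) ->
  (forall u v, B' (minus u v) = minus (B' u) (B' v)) ->
  (forall v, norm (B x v) <= M * norm v) -> (forall v, norm (B' v) <= M * norm v) ->
  0 < M -> 0 < K -> 0 < rho ->
  (forall y v, Cmod (io y - io x) <= rho ->
    norm (minus (minus (B y v) (B x v)) (scal (Cminus (io y) (io x) : C_AbsRing) (B' v)))
      <= K * Cmod (io y - io x) * Cmod (io y - io x) * norm v) ->
  (forall eps, 0 < eps -> exists d, 0 < d /\
    forall y, Cmod (io y - io x) < d ->
      norm (minus (minus (w y) (w x)) (scal (Cminus (io y) (io x) : C_AbsRing) l))
        <= eps * Cmod (io y - io x)) ->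
  diff_at (fun y => B y (w y)) x (plus (B' (w x)) (B x l)).
Proof.
intros HB Hs HB' HM HM' M0 K0 R0 HQ Hw eps He.
destruct (Hw (eps / (3 * M))) as [d1 [Hd1 H1]].
{ apply Rdiv_lt_0_compat; lra. }
destruct (Hw 1 Rlt_0_1) as [d2 [Hd2 H2]].
assert (Hl := norm_ge_0 l). assert (Hwx := norm_ge_0 (w x)).
(* [L] bounds the difference quotients of [w] near [x]. The thresholds then keep three errors below
   [eps / 3] times the increment: the quadratic remainder of [B] ([d4]), the remainder of [w] under
   [B x] ([d1]), and [B'] applied to the increment of [w] ([d3]). *)
set (L := norm l + 1).
assert (HL : 1 <= L) by (unfold L; lra).
set (d3 := eps / (3 * M * L)).
set (d4 := eps / (3 * K * (norm (w x) + L))).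
assert (Hd3 : 0 < d3).
{ apply Rdiv_lt_0_compat; [easy|]. apply Rmult_lt_0_compat; [|lra]. lra. }
assert (Hd4 : 0 < d4).
{ apply Rdiv_lt_0_compat; [easy|]. apply Rmult_lt_0_compat; lra. }
exists (Rmin (Rmin 1 rho) (Rmin (Rmin d1 d2) (Rmin d3 d4))).
split; [repeat apply Rmin_glb_lt; lra|].
intros y Hy. set (h := Cmod (io y - io x)) in *.
assert (Hh : 0 <= h) by apply Cmod_ge_0.
assert (Hh0 : h < Rmin 1 rho) by (eapply Rlt_le_trans; [exact Hy|apply Rmin_l]).
assert (Hh1 := Rlt_le_trans _ _ _ Hh0 (Rmin_l _ _)).
assert (Hhr := Rlt_le_trans _ _ _ Hh0 (Rmin_r _ _)).
assert (Hy' : h < Rmin (Rmin d1 d2) (Rmin d3 d4))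
  by (eapply Rlt_le_trans; [exact Hy|apply Rmin_r]).
assert (Hh12 := Rlt_le_trans _ _ _ Hy' (Rmin_l _ _)).
assert (Hh34 := Rlt_le_trans _ _ _ Hy' (Rmin_r _ _)).
assert (A1 := H1 y (Rlt_le_trans _ _ _ Hh12 (Rmin_l _ _))).
assert (A2 := H2 y (Rlt_le_trans _ _ _ Hh12 (Rmin_r _ _))).
assert (A3 := Rlt_le_trans _ _ _ Hh34 (Rmin_l _ _)).
assert (A4 := Rlt_le_trans _ _ _ Hh34 (Rmin_r _ _)).
fold h in A1, A2.
set (D := minus (w y) (w x)) in *.
set (c := Cminus (io y) (io x)) in *.
assert (HD : norm D <= L * h).
{ eapply Rle_trans; [apply (norm_le_minus _ _ (scal (c : C_AbsRing) l))|].
  rewrite norm_scalC. change (Cmod c) with h. unfold L. nra. }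
replace (minus (minus (B y (w y)) (B x (w x)))
      (scal (c : C_AbsRing) (plus (B' (w x)) (B x l))))
  with (plus (minus (minus (B y (w y)) (B x (w y))) (scal (c : C_AbsRing) (B' (w y))))
        (plus (B x (minus D (scal (c : C_AbsRing) l))) (scal (c : C_AbsRing) (B' D)))).
2:{ rewrite HB, Hs. unfold D. rewrite HB, HB'. vec V. }
assert (HQ' := HQ y (w y) (Rlt_le _ _ Hhr)). change (Cmod (io y - io x)) with h in HQ'; fold c in HQ'; change (Cmod c) with h in HQ'.
assert (B1 : norm (w y) <= norm (w x) + L).
{ eapply Rle_trans; [apply (norm_le_minus _ _ (w x))|]. fold D. nra. }
assert (B2 : K * h * h * norm (w y) <= eps / 3 * h).
{ apply Rle_trans with (K * h * h * (norm (w x) + L)).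
  - apply Rmult_le_compat_l; [|exact B1]. nra.
  - assert (E : K * h * (norm (w x) + L) <= eps / 3).
    { apply Rle_trans with (K * d4 * (norm (w x) + L)).
      - apply Rmult_le_compat_r; [lra|]. nra.
      - unfold d4. apply Req_le. field. lra. }
    nra. }
assert (B3 : norm (B x (minus D (scal (c : C_AbsRing) l))) <= eps / 3 * h).
{ eapply Rle_trans; [apply HM|]. apply Rle_trans with (M * (eps / (3 * M) * h)).
  - apply Rmult_le_compat_l; [lra|exact A1].
  - apply Req_le. field. lra. }
assert (B4 : norm (scal (c : C_AbsRing) (B' D)) <= eps / 3 * h).
{ rewrite norm_scalC. change (Cmod c) with h.
  assert (E : norm (B' D) <= eps / 3).
  { eapply Rle_trans; [apply HM'|]. apply Rle_trans with (M * (L * d3)).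
    - apply Rmult_le_compat_l; [lra|]. nra.
    - unfold d3. apply Req_le. field. split; lra. }
  nra. }
eapply Rle_trans; [apply norm_triangle|].
eapply Rle_trans; [apply Rplus_le_compat; [exact HQ'|apply norm_triangle]|].
lra.
Qed.

End Calculus.

Arguments cont_at {P} io {V} u x.
Arguments diff_at {P} io {V} u x l.

Notation cont u := (forall x, cont_at RtoC u x).

Lemma cont_comp_le (V : NormedModule C_AbsRing) (u : R -> V) (g : R -> R) (L : R) :
  (forall x y, Rabs (g y - g x) <= L * Rabs (y - x)) -> cont u -> cont (fun x => u (g x)).
Proof.
intros Hg Hu x eps He. destruct (Hu (g x) eps He) as [d [Hd H]].
assert (HL := Rabs_pos L).
assert (Hp : 0 < d / (1 + Rabs L)) by (apply Rdiv_lt_0_compat; lra).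
exists (d / (1 + Rabs L)). split; [easy|]. intros y Hy. apply H.
rewrite Cmod_RtoC_minus in *. eapply Rle_lt_trans; [apply Hg|].
apply (Rmult_lt_compat_r (1 + Rabs L)) in Hy; [|lra].
replace (d / (1 + Rabs L) * (1 + Rabs L)) with d in Hy by (field; lra).
assert (H0 := Rabs_pos (y - x)). assert (H1 := Rle_abs L). nra.
Qed.

Lemma cont_shift (V : NormedModule C_AbsRing) (u : R -> V) (a : R) :
  cont u -> cont (fun x => u (x + a)).
Proof.
apply (cont_comp_le _ u (fun x => x + a) 1). intros x y.
replace (y + a - (x + a)) with (y - x) by ring. lra.
Qed.

Lemma cont_lipschitz (V : NormedModule C_AbsRing) (u : R -> V) L :
  (forall x y, norm (minus (u y) (u x)) <= L * Rabs (y - x)) -> cont u.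
Proof.
intros H x eps He. assert (HL := Rabs_pos L).
assert (Hp : 0 < eps / (1 + Rabs L)) by (apply Rdiv_lt_0_compat; lra).
exists (eps / (1 + Rabs L)). split; [easy|]. intros y Hy.
rewrite Cmod_RtoC_minus in Hy. eapply Rle_lt_trans; [apply H|].
apply (Rmult_lt_compat_r (1 + Rabs L)) in Hy; [|lra].
replace (eps / (1 + Rabs L) * (1 + Rabs L)) with eps in Hy by (field; lra).
assert (H0 := Rabs_pos (y - x)). assert (H1 := Rle_abs L). nra.
Qed.

Section ScalarProduct.

Variable V : NormedModule C_AbsRing.

Lemma cont_scal (k : R -> C) (u : R -> V) :
  cont (k : R -> AbsRing_NormedModule C_AbsRing) -> cont u ->
  cont (fun x => scal (k x : C_AbsRing) (u x)).
Proof.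
intros Hk Hu x eps He.
assert (Hn := norm_ge_0 (u x)). assert (Hm := Cmod_ge_0 (k x)).
destruct (Hu x (Rmin 1 (eps / 2 / (Cmod (k x) + 1)))) as [d1 [Hd1 H1]].
{ apply Rmin_glb_lt; [lra|]. apply Rdiv_lt_0_compat; lra. }
destruct (Hk x (eps / 2 / (norm (u x) + 1))) as [d2 [Hd2 H2]].
{ apply Rdiv_lt_0_compat; lra. }
exists (Rmin d1 d2). split; [now apply Rmin_glb_lt|]. intros y Hy.
specialize (H1 y (Rlt_le_trans _ _ _ Hy (Rmin_l _ _))).
specialize (H2 y (Rlt_le_trans _ _ _ Hy (Rmin_r _ _))).
change (norm (minus (k y : AbsRing_NormedModule C_AbsRing) (k x)))
  with (Cmod (Cminus (k y) (k x))) in H2.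
norm_as V (plus (scal (Cminus (k y) (k x) : C_AbsRing) (u y))
          (scal (k x : C_AbsRing) (minus (u y) (u x)))).
eapply Rle_lt_trans; [apply norm_triangle|]. rewrite !norm_scalC.
assert (A1 := Rlt_le_trans _ _ _ H1 (Rmin_l _ _)).
assert (A2 := Rlt_le_trans _ _ _ H1 (Rmin_r _ _)).
assert (A3 : norm (u y) < norm (u x) + 1).
{ eapply Rle_lt_trans; [apply (norm_le_minus _ _ (u x))|]. lra. }
apply (Rmult_lt_compat_r (norm (u x) + 1)) in H2; [|lra].
replace (eps / 2 / (norm (u x) + 1) * (norm (u x) + 1)) with (eps / 2) in H2 by (field; lra).
apply (Rmult_lt_compat_r (Cmod (k x) + 1)) in A2; [|lra].
replace (eps / 2 / (Cmod (k x) + 1) * (Cmod (k x) + 1)) with (eps / 2) in A2 by (field; lra).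
assert (B1 := Cmod_ge_0 (Cminus (k y) (k x))). assert (B2 := norm_ge_0 (minus (u y) (u x))).
assert (Cmod (Cminus (k y) (k x)) * norm (u y)
  <= Cmod (Cminus (k y) (k x)) * (norm (u x) + 1)) by (apply Rmult_le_compat_l; lra).
nra.
Qed.

End ScalarProduct.

Section Conversions.

Variable V : CompleteNormedModule C_AbsRing.

Lemma cont_continuous (u : R -> V) x :
  cont_at RtoC u x -> @continuous R_UniformSpace (real_CompleteNormedModule V) u x.
Proof.
intros H. apply filterlim_locally. intros eps.
destruct (H eps (cond_pos eps)) as [d [Hd H1]]. exists (mkposreal d Hd). intros y Hy.
apply (@norm_compat1 C_AbsRing V). apply H1. rewrite Cmod_RtoC_minus. exact Hy.
Qed.

Lemma diff_is_derive (u : R -> V) x (l : V) :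
  diff_at RtoC u x l -> @is_derive R_AbsRing (real_CompleteNormedModule V) u x l.
Proof.
intros H. split; [apply is_linear_scal_l|]. intros z Hz.
rewrite <- (is_filter_lim_locally_unique _ _ Hz). intros eps.
destruct (H eps (cond_pos eps)) as [d [Hd H1]]. exists (mkposreal d Hd). intros y Hy.
assert (H2 := H1 y). rewrite Cmod_RtoC_minus, <- RtoC_minus in H2. exact (H2 Hy).
Qed.

Lemma is_derive_diff (u : R -> V) x (l : V) :
  @is_derive R_AbsRing (real_CompleteNormedModule V) u x l -> diff_at RtoC u x l.
Proof.
intros [_ H] eps He. specialize (H x (fun P HP => HP) (mkposreal eps He)).
destruct H as [d H1]. exists d. split; [apply cond_pos|]. intros y Hy.
specialize (H1 y). rewrite Cmod_RtoC_minus in *. rewrite <- RtoC_minus. exact (H1 Hy).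
Qed.

End Conversions.

Section ComplexConversions.

Variable V : NormedModule C_AbsRing.

Lemma diff_is_deriveC (u : C -> V) x (l : V) :
  diff_at (fun z => z) u x l -> @is_derive C_AbsRing V u x l.
Proof.
intros H. split; [apply is_linear_scal_l|]. intros z Hz.
rewrite <- (is_filter_lim_locally_unique _ _ Hz). intros eps.
destruct (H eps (cond_pos eps)) as [d [Hd H1]]. exists (mkposreal d Hd). intros y Hy.
exact (H1 y Hy).
Qed.

Lemma is_deriveC_diff (u : C -> V) x (l : V) :
  @is_derive C_AbsRing V u x l -> diff_at (fun z => z) u x l.
Proof.
intros [_ H] eps He. specialize (H x (fun P HP => HP) (mkposreal eps He)).
destruct H as [d H1]. exists d. split; [apply cond_pos|]. intros y Hy.
exact (H1 y Hy).
Qed.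

End ComplexConversions.

(** * Complex exponentials *)

Lemma mvt_bound (f df : R -> R) (a b M : R) :
  (forall x, is_derive f x (df x)) ->
  (forall x, Rmin a b <= x <= Rmax a b -> Rabs (df x) <= M) ->
  Rabs (f b - f a) <= M * Rabs (b - a).
Proof.
intros Hd HM.
destruct (MVT_gen f a b df) as [c [Hc E]].
- intros x _. apply Hd.
- intros x _. apply continuity_pt_filterlim, (@ex_derive_continuous R_AbsRing R_NormedModule).
  exists (df x). apply Hd.
- rewrite E, Rabs_mult. apply Rmult_le_compat_r; [apply Rabs_pos|]. now apply HM.
Qed.

Lemma sin_lip x y : Rabs (sin y - sin x) <= Rabs (y - x).
Proof.
rewrite <- (Rmult_1_l (Rabs (y - x))). apply (mvt_bound _ cos).
- intros t. auto_derive; [easy|ring].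
- intros t _. apply Rabs_le. split; apply COS_bound.
Qed.

Lemma cos_lip x y : Rabs (cos y - cos x) <= Rabs (y - x).
Proof.
rewrite <- (Rmult_1_l (Rabs (y - x))). apply (mvt_bound _ (fun t => - sin t)).
- intros t. auto_derive; [easy|ring].
- intros t _. rewrite Rabs_Ropp. apply Rabs_le. split; apply SIN_bound.
Qed.

Lemma between_abs x t : Rmin 0 x <= t <= Rmax 0 x -> Rabs t <= Rabs x.
Proof.
unfold Rmin, Rmax. destruct (Rle_dec 0 x); intros H.
- rewrite !Rabs_pos_eq; lra.
- rewrite !Rabs_left1; lra.
Qed.

Lemma exp_le_3_of x : x <= 1 -> exp x <= 3.
Proof.
intros H. apply Rle_trans with (exp 1); [|apply exp_le_3].
destruct (Req_dec x 1) as [->|Hn]; [lra|]. left. apply exp_increasing. lra.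
Qed.

Lemma exp_quad x : Rabs x <= 1 -> Rabs (exp x - 1 - x) <= 3 * x ^ 2.
Proof.
intros Hx.
assert (H1 : forall t, Rabs t <= Rabs x -> Rabs (exp t - 1) <= 3 * Rabs x).
{ intros t Ht. replace (exp t - 1) with (exp t - exp 0) by (rewrite exp_0; ring).
  apply Rle_trans with (3 * Rabs (t - 0)).
  - apply (mvt_bound _ exp).
    + intros s. auto_derive; [easy|ring].
    + intros s Hs. rewrite Rabs_pos_eq by (left; apply exp_pos).
      apply between_abs in Hs. apply exp_le_3_of. assert (H := Rle_abs s). lra.
  - rewrite Rminus_0_r. lra. }
replace (exp x - 1 - x) with ((exp x - x) - (exp 0 - 0)) by (rewrite exp_0; ring).
eapply Rle_trans.
- apply (mvt_bound (fun t => exp t - t) (fun t => exp t - 1) 0 x (3 * Rabs x)).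
  + intros t. auto_derive; [easy|ring].
  + intros t Ht. apply H1. now apply between_abs.
- rewrite Rminus_0_r, <- (pow2_abs x). right; ring.
Qed.

Lemma sin_quad x : Rabs x <= 1 -> Rabs (sin x - x) <= x ^ 2.
Proof.
intros Hx. replace (sin x - x) with ((sin x - x) - (sin 0 - 0)) by (rewrite sin_0; ring).
eapply Rle_trans.
- apply (mvt_bound (fun t => sin t - t) (fun t => cos t - 1) 0 x (Rabs x)).
  + intros t. auto_derive; [easy|ring].
  + intros t Ht. apply between_abs in Ht. rewrite <- cos_0.
    eapply Rle_trans; [apply cos_lip|]. now rewrite Rminus_0_r.
- rewrite Rminus_0_r, <- (pow2_abs x). right; ring.
Qed.

Lemma cos_quad x : Rabs x <= 1 -> Rabs (cos x - 1) <= x ^ 2.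
Proof.
intros Hx. rewrite <- cos_0.
eapply Rle_trans.
- apply (mvt_bound cos (fun t => - sin t) 0 x (Rabs x)).
  + intros t. auto_derive; [easy|ring].
  + intros t Ht. apply between_abs in Ht. rewrite Rabs_Ropp.
    replace (sin t) with (sin t - sin 0) by (rewrite sin_0; ring).
    eapply Rle_trans; [apply sin_lip|]. now rewrite Rminus_0_r.
- rewrite Rminus_0_r, <- (pow2_abs x). right; ring.
Qed.

Lemma C_eq (z w : C) : fst z = fst w -> snd z = snd w -> z = w.
Proof. destruct z, w; simpl; now intros -> ->. Qed.

Lemma Cmod_le_abs (z : C) : Cmod z <= Rabs (fst z) + Rabs (snd z).
Proof.
destruct z as [x y]. unfold Cmod; simpl fst; simpl snd.
assert (H1 := pow2_abs x). assert (H2 := pow2_abs y).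
assert (H3 := Rabs_pos x). assert (H4 := Rabs_pos y).
rewrite <- (sqrt_Rsqr (Rabs x + Rabs y)) by lra.
apply sqrt_le_1_alt. unfold Rsqr. nra.
Qed.

Lemma Cmod_fst (z : C) : Rabs (fst z) <= Cmod z.
Proof. eapply Rle_trans; [apply Rmax_l|apply Rmax_Cmod]. Qed.

Lemma Cmod_snd (z : C) : Rabs (snd z) <= Cmod z.
Proof. eapply Rle_trans; [apply Rmax_r|apply Rmax_Cmod]. Qed.

Lemma cis_plus x y : cis (x + y) = (cis x * cis y)%C.
Proof. apply C_eq; simpl; [rewrite cos_plus|rewrite sin_plus]; ring. Qed.

Lemma cis_0 : cis 0 = RtoC 1.
Proof. apply C_eq; simpl; [apply cos_0|apply sin_0]. Qed.

Lemma cis_opp x : (cis (- x) * cis x)%C = RtoC 1.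
Proof. rewrite <- cis_plus, Rplus_opp_l. apply cis_0. Qed.

Lemma Cmod_cis x : Cmod (cis x) = 1.
Proof.
unfold Cmod, cis; simpl. rewrite <- sqrt_1 at 3. f_equal.
assert (H := sin2_cos2 x). unfold Rsqr in H. lra.
Qed.

Lemma cis_lip x y : Cmod (cis y - cis x) <= 2 * Rabs (y - x).
Proof.
eapply Rle_trans; [apply Cmod_le_abs|]. simpl.
assert (H1 := cos_lip x y). assert (H2 := sin_lip x y). unfold Rminus in *. lra.
Qed.

Lemma cis_2PI : cis (2 * PI) = RtoC 1.
Proof. apply C_eq; simpl; [apply cos_2PI|apply sin_2PI]. Qed.

Lemma cis_2PI_nat n : cis (2 * PI * INR n) = RtoC 1.
Proof.
induction n.
- simpl. rewrite Rmult_0_r. apply cis_0.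
- rewrite S_INR. replace (2 * PI * (INR n + 1)) with (2 * PI * INR n + 2 * PI) by ring.
  rewrite cis_plus, IHn, cis_2PI. ring.
Qed.

Lemma cis_2PI_Z k : cis (2 * PI * IZR k) = RtoC 1.
Proof.
destruct k as [|p|p].
- rewrite Rmult_0_r. apply cis_0.
- change (IZR (Z.pos p)) with (IPR p). rewrite <- INR_IPR. apply cis_2PI_nat.
- change (IZR (Z.neg p)) with (- IPR p). rewrite <- INR_IPR.
  assert (H := cis_opp (2 * PI * INR (Pos.to_nat p))). rewrite cis_2PI_nat in H.
  rewrite <- H. replace (2 * PI * - INR (Pos.to_nat p)) with (- (2 * PI * INR (Pos.to_nat p))) by ring.
  ring.
Qed.

Lemma unit_cis (z : C) : Cmod z = 1 -> exists xi, z = cis xi.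
Proof.
intros H.
assert (E : fst z * fst z + snd z * snd z = 1).
{ assert (H1 := Cmod2_alt z). rewrite H in H1. unfold Re, Im in H1. lra. }
assert (B : -1 <= fst z <= 1) by nra.
assert (Ec := cos_acos (fst z) B).
assert (Es := sin2_cos2 (acos (fst z))). unfold Rsqr in Es. rewrite Ec in Es.
assert (Hs : (sin (acos (fst z)) - snd z) * (sin (acos (fst z)) + snd z) = 0) by nra.
apply Rmult_integral in Hs. destruct Hs as [Hs|Hs].
- exists (acos (fst z)). apply C_eq; simpl; lra.
- exists (- acos (fst z)). apply C_eq; simpl; [rewrite cos_neg|rewrite sin_neg]; lra.
Qed.

Definition cexp (z : C) : C := (RtoC (exp (fst z)) * cis (snd z))%C.

Lemma cexp_plus z w : cexp (z + w) = (cexp z * cexp w)%C.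
Proof. unfold cexp. simpl. rewrite exp_plus, RtoC_mult, cis_plus. ring. Qed.

Lemma Cmod_cexp z : Cmod (cexp z) = exp (fst z).
Proof.
unfold cexp. rewrite Cmod_mult, Cmod_cis, Cmod_R, Rabs_pos_eq; [ring|left; apply exp_pos].
Qed.

Lemma cexp_imag x : cexp (0, x) = cis x.
Proof. unfold cexp. simpl. rewrite exp_0. ring. Qed.

Lemma cexp_0 : cexp (RtoC 0) = RtoC 1.
Proof. unfold cexp. simpl. rewrite exp_0, cis_0. ring. Qed.

(** The constant collects $3+3$ from the real part and $3+4$ from the imaginary part, with $e^x\le3$
    and $|e^x-1|\le4|x|$ for $|x|\le1$. *)
Lemma cexp_quad (w : C) : Cmod w <= 1 -> Cmod (cexp w - 1 - w) <= 13 * Cmod w * Cmod w.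
Proof.
intros H. destruct w as [x y].
assert (Hx := Cmod_fst (x, y)). assert (Hy := Cmod_snd (x, y)). simpl in Hx, Hy.
set (m := Cmod (x, y)) in *.
assert (Ex := exp_quad x ltac:(lra)). assert (Sy := sin_quad y ltac:(lra)).
assert (Cy := cos_quad y ltac:(lra)).
assert (Px := pow2_abs x). assert (Py := pow2_abs y).
assert (X0 := Rabs_pos x). assert (Y0 := Rabs_pos y).
assert (x ^ 2 <= m * m) by nra. assert (y ^ 2 <= m * m) by nra.
assert (E1 : Rabs (exp x) <= 3).
{ rewrite Rabs_pos_eq by (left; apply exp_pos).
  apply exp_le_3_of. assert (Hle := Rle_abs x). lra. }
assert (E2 : Rabs (exp x - 1) <= 4 * Rabs x).
{ replace (exp x - 1) with ((exp x - 1 - x) + x) by ring.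
  eapply Rle_trans; [apply Rabs_triang|]. nra. }
eapply Rle_trans; [apply Cmod_le_abs|]. simpl.
replace (exp x * cos y - 0 * sin y + - (1) + - x)
  with (exp x * (cos y - 1) + (exp x - 1 - x)) by ring.
replace (exp x * sin y + 0 * cos y + - 0 + - y)
  with (exp x * (sin y - y) + (exp x - 1) * y) by ring.
assert (B1 := Rabs_triang (exp x * (cos y - 1)) (exp x - 1 - x)).
assert (B2 := Rabs_triang (exp x * (sin y - y)) ((exp x - 1) * y)).
rewrite Rabs_mult in B1. rewrite (Rabs_mult (exp x)), (Rabs_mult (exp x - 1)) in B2.
assert (Rabs (exp x) * Rabs (cos y - 1) <= 3 * (m * m)).
{ apply Rmult_le_compat; try apply Rabs_pos; lra. }
assert (Rabs (exp x) * Rabs (sin y - y) <= 3 * (m * m)).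
{ apply Rmult_le_compat; try apply Rabs_pos; lra. }
assert (Rabs (exp x - 1) * Rabs y <= 4 * (m * m)).
{ apply Rle_trans with (4 * Rabs x * Rabs y); [apply Rmult_le_compat_r; lra|].
  assert (Rabs x * Rabs y <= m * m) by (apply Rmult_le_compat; lra). lra. }
lra.
Qed.

(** * Vector-valued integrals *)

Section Integral.

Variable V : CompleteNormedModule C_AbsRing.

Definition VInt (u : R -> V) (a b : R) : V :=
  @RInt (real_CompleteNormedModule V) u a b.

Lemma VInt_correct (u : R -> V) a b :
  cont u -> @is_RInt (real_CompleteNormedModule V) u a b (VInt u a b).
Proof.
intros H. apply (@RInt_correct (real_CompleteNormedModule V)).
apply (@ex_RInt_continuous (real_CompleteNormedModule V)).
intros z _. now apply cont_continuous.
Qed.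

Lemma VInt_unique (u : R -> V) a b l :
  @is_RInt (real_CompleteNormedModule V) u a b l -> VInt u a b = l.
Proof. apply (@is_RInt_unique (real_CompleteNormedModule V)). Qed.

Lemma VInt_ext (u v : R -> V) a b :
  a <= b -> (forall x, a <= x <= b -> u x = v x) -> VInt u a b = VInt v a b.
Proof.
intros Hab H. apply (@RInt_ext (real_CompleteNormedModule V)).
rewrite Rmin_left, Rmax_right by easy. intros x Hx. apply H. lra.
Qed.

Lemma VInt_le (u : R -> V) (g : R -> R) a b :
  a <= b -> cont u -> (forall x, continuous g x) ->
  (forall x, a <= x <= b -> norm (u x) <= g x) -> norm (VInt u a b) <= RInt g a b.
Proof.
intros Hab Hu Hg H.
apply (@norm_RInt_le (real_CompleteNormedModule V) u g a b (VInt u a b) (RInt g a b) Hab H).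
- now apply VInt_correct.
- apply (@RInt_correct R_CompleteNormedModule).
  apply (@ex_RInt_continuous R_CompleteNormedModule). intros z _. apply Hg.
Qed.

Lemma VInt_bound (u : R -> V) a b M :
  a <= b -> cont u -> (forall x, a <= x <= b -> norm (u x) <= M) ->
  norm (VInt u a b) <= (b - a) * M.
Proof.
intros Hab Hu H.
apply (@norm_RInt_le_const (real_CompleteNormedModule V) u a b (VInt u a b) M Hab H).
now apply VInt_correct.
Qed.

Lemma VInt_chasles (u : R -> V) a b c :
  cont u -> plus (VInt u a b) (VInt u b c) = VInt u a c.
Proof.
intros Hu. symmetry. apply VInt_unique.
apply (@is_RInt_Chasles (real_CompleteNormedModule V)) with b; now apply VInt_correct.
Qed.

Lemma VInt_shift (u : R -> V) a b v :
  cont u -> VInt (fun x => u (x + v)) a b = VInt u (a + v) (b + v).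
Proof.
intros Hu. apply VInt_unique.
assert (H := VInt_correct u (a + v) (b + v) Hu).
replace (VInt u (a + v) (b + v)) with (VInt u (1 * a + v) (1 * b + v)) in H |- *
  by (f_equal; ring).
replace (a + v) with (1 * a + v) in H by ring. replace (b + v) with (1 * b + v) in H by ring.
apply (@is_RInt_comp_lin (real_CompleteNormedModule V)) in H.
refine (@is_RInt_ext (real_CompleteNormedModule V) _ _ _ _ _ _ H).
intros x _. rewrite Rmult_1_l. apply (@scal_one R_Ring (real_CompleteNormedModule V)).
Qed.

Lemma VInt_ftc (u du : R -> V) a b :
  a <= b -> (forall x, a <= x <= b -> diff_at RtoC u x (du x)) -> cont du ->
  VInt du a b = minus (u b) (u a).
Proof.
intros Hab Hd Hc. apply VInt_unique.
apply (@is_RInt_derive (real_CompleteNormedModule V));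
  rewrite Rmin_left, Rmax_right by easy; intros x Hx.
- now apply diff_is_derive, Hd.
- now apply cont_continuous.
Qed.

Lemma diff_VInt (u : R -> V) a x : cont u -> diff_at RtoC (fun b => VInt u a b) x (u x).
Proof.
intros Hu. apply is_derive_diff.
apply (@is_derive_RInt (real_CompleteNormedModule V)) with a.
- exists (mkposreal 1 Rlt_0_1). intros y _. now apply VInt_correct.
- now apply cont_continuous.
Qed.

End Integral.

Section IntegralOperations.

Variables V W : CompleteNormedModule C_AbsRing.

(** Linearity passes through Riemann sums and boundedness through their limit. Group operators, the
    quotient map and evaluation at a point are all moved across integrals in this way. *)
Lemma VInt_linear (L : V -> W) (u : R -> V) a b :
  is_linear L -> cont u -> VInt W (fun x => L (u x)) a b = L (VInt V u a b).
Proof.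
intros HL Hu. apply VInt_unique.
set (VR := real_CompleteNormedModule V). set (WR := real_CompleteNormedModule W).
assert (HR : @is_linear R_AbsRing VR WR L).
{ split.
  - exact (linear_plus L HL).
  - intros k x. exact (linear_scal L HL (RtoC k) x).
  - exact (linear_norm L HL). }
assert (Hsum : forall ptd, @Riemann_sum WR (fun x => L (u x)) ptd = L (@Riemann_sum VR u ptd)).
{ intros ptd. apply (SF_cons_ind (T := R)) with (s := ptd).
  - intros x0. unfold Riemann_sum; simpl. symmetry.
    apply (@linear_zero R_AbsRing VR WR L HR).
  - intros h s IH. rewrite !Riemann_sum_cons, IH.
    symmetry. etransitivity; [apply (linear_plus L HL)|]. f_equal.
    apply (@linear_scal R_AbsRing VR WR L HR). }
apply filterlim_ext with
  (fun ptd => L (@scal R_AbsRing VR (sign (b - a)) (@Riemann_sum VR u ptd))).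
- intros ptd. rewrite Hsum. apply (@linear_scal R_AbsRing VR WR L HR).
- apply filterlim_comp with (locally (VInt V u a b : VR)).
  + apply (VInt_correct V u a b Hu).
  + exact (@linear_cont R_AbsRing VR WR L _ HR).
Qed.

Lemma VInt_minus (u v : R -> V) a b :
  cont u -> cont v -> VInt V (fun x => minus (u x) (v x)) a b = minus (VInt V u a b) (VInt V v a b).
Proof.
intros Hu Hv. apply VInt_unique.
apply (@is_RInt_minus (real_CompleteNormedModule V)); now apply VInt_correct.
Qed.

Lemma VInt_plus (u v : R -> V) a b :
  cont u -> cont v -> VInt V (fun x => plus (u x) (v x)) a b = plus (VInt V u a b) (VInt V v a b).
Proof.
intros Hu Hv. apply VInt_unique.
apply (@is_RInt_plus (real_CompleteNormedModule V)); now apply VInt_correct.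
Qed.

Lemma is_linear_scalC (c : C) : is_linear (fun x : V => scal (c : C_AbsRing) x).
Proof.
split.
- intros x y. vec V.
- intros k x. vec V.
- exists (1 + Cmod c). assert (H := Cmod_ge_0 c). split; [lra|].
  intros x. rewrite norm_scalC. assert (H0 := norm_ge_0 x). nra.
Qed.

End IntegralOperations.

Lemma VInt_scal (V : CompleteNormedModule C_AbsRing) (c : C) (u : R -> V) a b :
  cont u -> VInt V (fun x => scal (c : C_AbsRing) (u x)) a b = scal (c : C_AbsRing) (VInt V u a b).
Proof. apply (VInt_linear V V (fun x => scal (c : C_AbsRing) x)), is_linear_scalC. Qed.

Lemma cont_minus (V : NormedModule C_AbsRing) (u v : R -> V) :
  cont u -> cont v -> cont (fun x => minus (u x) (v x)).
Proof.
intros Hu Hv x. apply cont_ext with (fun x => plus (u x) (scal (opp one : C_AbsRing) (v x))).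
- intros y. vec V.
- apply cont_plus; [apply Hu|]. apply cont_scal; [|exact Hv]. intros y. apply cont_const.
Qed.

(** * Completeness *)

Lemma choice (A B : Type) (P : A -> B -> Prop) :
  (forall x, exists y, P x y) -> exists g : A -> B, forall x, P x (g x).
Proof.
intros H. exists (fun x => proj1_sig (constructive_indefinite_description _ (H x))).
intros x. apply proj2_sig.
Qed.

Definition seq_lim (V : NormedModule C_AbsRing) (u : nat -> V) (l : V) : Prop :=
  forall eps, 0 < eps -> exists N, forall n, (N <= n)%nat -> norm (minus (u n) l) < eps.

Arguments seq_lim {V} u l.

(** Completeness is tested on these sequences only. They suffice, because a Cauchy filter yields one
    by picking centres of balls of radius $2^{-n}$, and they are easy to lift from a quotient,
    because the lifted increments remain summable. *)
Definition geometric (V : NormedModule C_AbsRing) (K : R) (u : nat -> V) : Prop :=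
  forall n, norm (minus (u (S n)) (u n)) <= K * (1 / 2) ^ n.

Arguments geometric {V} K u.

Definition seq_complete (V : NormedModule C_AbsRing) : Prop :=
  forall (K : R) (u : nat -> V), geometric K u -> exists l, seq_lim u l.

Lemma half_pow_pos n : 0 < (1 / 2) ^ n.
Proof. apply pow_lt. lra. Qed.

Lemma half_pow_small K eps : 0 < eps -> exists N, forall n, (N <= n)%nat -> K * (1 / 2) ^ n < eps.
Proof.
intros He. assert (HK := Rabs_pos K).
assert (Hp : 0 < eps / (1 + Rabs K)) by (apply Rdiv_lt_0_compat; lra).
destruct (pow_lt_1_zero (1 / 2) ltac:(rewrite Rabs_pos_eq; lra) _ Hp) as [N HN].
exists N. intros n Hn. specialize (HN n Hn).
rewrite Rabs_pos_eq in HN by (left; apply half_pow_pos).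
apply (Rmult_lt_compat_r (1 + Rabs K)) in HN; [|lra].
replace (eps / (1 + Rabs K) * (1 + Rabs K)) with eps in HN by (field; lra).
assert (H1 := Rle_abs K). assert (H2 := half_pow_pos n). nra.
Qed.

Section Sequences.

Variable V : NormedModule C_AbsRing.

Lemma seq_lim_unique (u : nat -> V) l l' : seq_lim u l -> seq_lim u l' -> l = l'.
Proof.
intros H H'. apply vanishing_eq. intros eps He.
destruct (H (eps / 2)) as [N HN]; [lra|]. destruct (H' (eps / 2)) as [N' HN']; [lra|].
specialize (HN (max N N') ltac:(lia)). specialize (HN' (max N N') ltac:(lia)).
rewrite norm_minus_sym in HN.
eapply Rle_trans; [apply (norm_minus_trans _ _ (u (max N N')))|]. lra.
Qed.

Lemma seq_lim_bound (u : nat -> V) l y M N :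
  seq_lim u l -> (forall n, (N <= n)%nat -> norm (minus (u n) y) <= M) -> norm (minus l y) <= M.
Proof.
intros H HM. apply le_epsilon. intros e He.
destruct (H e He) as [N' HN]. specialize (HN (max N N') ltac:(lia)).
specialize (HM (max N N') ltac:(lia)). rewrite norm_minus_sym in HN.
eapply Rle_trans; [apply (norm_minus_trans _ _ (u (max N N')))|]. lra.
Qed.

Lemma geometric_dist K (u : nat -> V) n m :
  geometric K u -> norm (minus (u (n + m)%nat) (u n)) <= 2 * K * (1 / 2) ^ n.
Proof.
intros H.
assert (HK : 0 <= K).
{ specialize (H 0%nat). simpl in H. assert (H0 := norm_ge_0 (minus (u 1%nat) (u 0%nat))). lra. }
assert (E : norm (minus (u (n + m)%nat) (u n)) <= 2 * K * (1 / 2) ^ n * (1 - (1 / 2) ^ m)).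
{ induction m.
  - rewrite Nat.add_0_r. simpl. rewrite (minus_eq_zero (G := V)), norm_zeroC. lra.
  - rewrite Nat.add_succ_r.
    eapply Rle_trans; [apply (norm_minus_trans _ _ (u (n + m)%nat))|].
    specialize (H (n + m)%nat). rewrite pow_add in H. simpl. lra. }
eapply Rle_trans; [exact E|].
assert (H1 := half_pow_pos n). assert (H2 := half_pow_pos m).
assert (0 <= 2 * K * (1 / 2) ^ n) by nra. nra.
Qed.

Lemma geometric_lim_dist K (u : nat -> V) l n :
  geometric K u -> seq_lim u l -> norm (minus l (u n)) <= 2 * K * (1 / 2) ^ n.
Proof.
intros H Hl. apply (seq_lim_bound u l (u n) _ n); [exact Hl|].
intros m Hm. replace m with (n + (m - n))%nat by lia. now apply geometric_dist.
Qed.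

Hypothesis HV : seq_complete V.

Definition filter_lim (F : (V -> Prop) -> Prop) : V :=
  epsilon (inhabits zero) (fun x : V => forall eps : posreal, F (ball x eps)).

Lemma filter_lim_spec (F : (V -> Prop) -> Prop) :
  ProperFilter F -> cauchy F -> forall eps : posreal, F (ball (filter_lim F) eps).
Proof.
intros PF HF. unfold filter_lim. apply epsilon_spec.
assert (Hc : forall n, exists x : V, F (ball x (mkposreal _ (half_pow_pos n)))) by (intros n; apply HF).
destruct (choice _ _ (fun n (x : V) => F (ball x (mkposreal _ (half_pow_pos n)))) Hc) as [u Hu].
set (c := @norm_factor C_AbsRing V). assert (Hcp : 0 < c) by apply norm_factor_gt_0.
assert (Hg : geometric (2 * c) u).
{ intros n. destruct (filter_ex _ (filter_and _ _ (Hu n) (Hu (S n)))) as [y [H1 H2]].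
  apply norm_compat2 in H1. apply norm_compat2 in H2. simpl in H1, H2. fold c in H1, H2.
  eapply Rle_trans; [apply (norm_minus_trans _ _ y)|].
  rewrite norm_minus_sym. assert (H3 := half_pow_pos n). nra. }
destruct (HV _ _ Hg) as [l Hl]. exists l. intros eps.
assert (He := cond_pos eps).
destruct (half_pow_small c (eps / 2) ltac:(lra)) as [N HN].
destruct (Hl (eps / 2) ltac:(lra)) as [N' HN'].
set (n := max N N'). specialize (HN n ltac:(lia)). specialize (HN' n ltac:(lia)).
apply filter_imp with (2 := Hu n). intros y Hy.
apply norm_compat1. apply norm_compat2 in Hy. simpl in Hy. fold c in Hy.
eapply Rle_lt_trans; [apply (norm_minus_trans _ _ (u n))|]. lra.
Qed.

Definition seq_complete_mixin :
  CompleteSpace.mixin_of (NormedModule.UniformSpace C_AbsRing V).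
Proof.
refine (@CompleteSpace.Mixin _ filter_lim filter_lim_spec _).
intros F1 F2 H12 H21.
(* The limit is a choice depending on the filter as a set; filters that refine each other are equal
   by extensionality, so they receive the same limit. *)
replace F2 with F1; [intros eps; apply ball_center|].
apply functional_extensionality. intros P. apply propositional_extensionality.
split; intros H; [now apply H21|now apply H12].
Defined.

Definition complete_of_seq : CompleteNormedModule C_AbsRing :=
  CompleteNormedModule.Pack C_AbsRing V
    (CompleteNormedModule.Class C_AbsRing V (NormedModule.class C_AbsRing V)
       seq_complete_mixin) V.

End Sequences.

Lemma is_series_seq_lim (V : NormedModule C_AbsRing) (a : nat -> V) l :
  is_series a l -> seq_lim (sum_n a) l.
Proof.
intros H eps He.
apply (proj1 (filterlim_locally_ball_norm (sum_n a) l) H (mkposreal eps He)).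
Qed.

Lemma complete_seq_complete (V : CompleteNormedModule C_AbsRing) : seq_complete V.
Proof.
intros K u H.
destruct (@ex_series_le C_AbsRing V (fun n => minus (u (S n)) (u n)) (fun n => K * (1 / 2) ^ n) H)
  as [l Hl].
{ apply (@ex_series_scal R_AbsRing R_NormedModule). apply ex_series_geom.
  rewrite Rabs_pos_eq; lra. }
apply is_series_seq_lim in Hl.
assert (E : forall n, sum_n (fun n => minus (u (S n)) (u n)) n = minus (u (S n)) (u 0%nat)).
{ induction n; [now rewrite sum_O|]. rewrite sum_Sn, IHn.
  etransitivity; [apply (plus_comm (G := V))|]. vec V. }
exists (plus l (u 0%nat)). intros eps He. destruct (Hl eps He) as [N HN].
exists (S N). intros n Hn. destruct n as [|n]; [lia|].
specialize (HN n ltac:(lia)). rewrite E in HN.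
norm_as V (minus (minus (u (S n)) (u 0%nat)) l). exact HN.
Qed.

Section BUCComplete.

Variable X : CompleteNormedModule C_AbsRing.

Lemma BUC_norm_le (f : BUC X) b : (forall t, norm (f t) <= b) -> norm f <= b.
Proof. apply BUC_norm_spec. Qed.

Lemma BUC_norm_ge (f : BUC X) t : norm (f t) <= norm f.
Proof. apply BUC_norm_spec. Qed.

Lemma BUC_minusE (f g : BUC X) t : (minus f g : BUC X) t = minus (f t) (g t).
Proof.
change (plus (f t) (scal (opp one : C_AbsRing) (g t)) = minus (f t) (g t)). vec X.
Qed.

Lemma BUC_seq_complete : seq_complete (BUC_NormedModule X).
Proof.
intros K u H.
assert (Ht : forall t, geometric K (fun n => u n t)).
{ intros t n. eapply Rle_trans; [|apply H].
  rewrite <- BUC_minusE. apply (BUC_norm_ge (minus (u (S n)) (u n))). }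
assert (Hl : forall t, exists l, seq_lim (fun n => u n t) l).
{ intros t. apply (complete_seq_complete X K), Ht. }
destruct (choice _ _ _ Hl) as [l Hl'].
assert (Hd : forall t n, norm (minus (l t) (u n t)) <= 2 * K * (1 / 2) ^ n).
{ intros t n. now apply (geometric_lim_dist X K (fun n => u n t)). }
assert (Hb : exists M, forall t, norm (l t) <= M).
{ destruct (buc_bounded (u 0%nat)) as [M HM]. exists (M + 2 * K). intros t.
  eapply Rle_trans; [apply (norm_le_minus _ _ (u 0%nat t))|].
  specialize (Hd t 0%nat). simpl in Hd. specialize (HM t). lra. }
assert (Hu : forall eps : posreal, exists delta : posreal,
    forall s t : nonnegreal, Rabs (s - t) < delta -> norm (minus (l s) (l t)) < eps).
{ intros eps. assert (He := cond_pos eps).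
  destruct (half_pow_small (2 * K) (eps / 3) ltac:(lra)) as [N HN].
  specialize (HN N (Nat.le_refl _)).
  destruct (buc_unif_cont (u N) (mkposreal (eps / 3) ltac:(lra))) as [d Hd'].
  exists d. intros s t Hst. specialize (Hd' s t Hst). simpl in Hd'.
  assert (H1 := Hd s N). assert (H2 := Hd t N). rewrite norm_minus_sym in H2.
  eapply Rle_lt_trans; [apply (norm_minus_trans _ _ (u N s))|].
  eapply Rle_lt_trans; [apply Rplus_le_compat_l, (norm_minus_trans _ _ (u N t))|]. lra. }
exists (mkBUC Hb Hu). intros eps He.
destruct (half_pow_small (2 * K) (eps / 2) ltac:(lra)) as [N HN].
exists N. intros n Hn. specialize (HN n Hn).
apply Rle_lt_trans with (2 * K * (1 / 2) ^ n); [|lra].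
apply BUC_norm_le. intros t. rewrite BUC_minusE, norm_minus_sym. apply Hd.
Qed.

Definition BUC_complete : CompleteNormedModule C_AbsRing := complete_of_seq _ BUC_seq_complete.

End BUCComplete.

Section QuotientComplete.

Variables (V : NormedModule C_AbsRing) (W : closed_subspace V).
Hypothesis HV : seq_complete V.

Lemma quot_class_norm (v : V) : norm (quot_class W v : quot_NormedModule W) <= norm v.
Proof. apply quot_norm_spec. now apply quot_class_mem. Qed.

Lemma quot_class_linear :
  @is_linear C_AbsRing V (quot_NormedModule W) (quot_class W).
Proof.
split.
- intros x y. symmetry. apply quot_plus_class.
- intros k x. symmetry. apply quot_scal_class.
- exists 1. split; [lra|]. intros x. rewrite Rmult_1_l. apply quot_class_norm.
Qed.

Lemma quot_class_minus (u v : V) :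
  quot_class W (minus u v) = minus (quot_class W u : quot_NormedModule W) (quot_class W v).
Proof. apply (linear_minus _ u v quot_class_linear). Qed.

(** Increments are lifted one at a time and summed. The quotient norm is an infimum that need not be
    attained, hence [K + 1] in place of [K] for the lifts. *)
Lemma quot_seq_complete : seq_complete (quot_NormedModule W).
Proof.
intros K u H.
assert (Hl : forall n, exists d : V,
  quot_class W d = minus (u (S n)) (u n) /\ norm d <= (K + 1) * (1 / 2) ^ n).
{ intros n.
  destruct (quot_norm_approx (minus (u (S n)) (u n)) (mkposreal _ (half_pow_pos n)))
    as [d [H1 H2]].
  exists d. split.
  - symmetry. now apply quot_class_mem.
  - specialize (H n). change (norm (minus (u (S n)) (u n)))
      with (quot_norm (minus (u (S n)) (u n))) in H. simpl in H2. lra. }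
destruct (choice _ _ _ Hl) as [d Hd].
set (v := fix v n := match n with O => quot_repr (u 0%nat) | S m => plus (v m) (d m) end).
assert (Hv : forall n, quot_class W (v n) = u n).
{ induction n; simpl.
  - apply quot_reprK.
  - etransitivity; [apply (linear_plus _ quot_class_linear)|]. rewrite IHn, (proj1 (Hd n)).
    vec (quot_NormedModule W). }
assert (Hg : geometric (K + 1) v).
{ intros n. simpl. norm_as V (d n). apply Hd. }
destruct (HV _ _ Hg) as [l Hl']. exists (quot_class W l). intros eps He.
destruct (Hl' eps He) as [N HN]. exists N. intros n Hn. specialize (HN n Hn).
rewrite <- Hv, <- quot_class_minus. eapply Rle_lt_trans; [apply quot_class_norm|exact HN].
Qed.

End QuotientComplete.

Definition Y_complete (X : CompleteNormedModule C_AbsRing) : CompleteNormedModule C_AbsRing :=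
  complete_of_seq (Y X) (quot_seq_complete _ (C0 X) (BUC_seq_complete X)).

(** * The Riemann-Lebesgue lemma *)

Section IntegralEstimates.

Variable V : CompleteNormedModule C_AbsRing.

Lemma VInt_swap (u : R -> V) a b : cont u -> VInt V u b a = opp (VInt V u a b).
Proof.
intros Hu. assert (H := VInt_chasles V u a b a Hu).
assert (H0 := VInt_chasles V u a a a Hu).
assert (E : VInt V u a a = zero).
{ replace (VInt V u a a) with (minus (plus (VInt V u a a) (VInt V u a a)) (VInt V u a a)) by vec V.
  rewrite H0. vec V. }
rewrite E in H.
replace (VInt V u b a) with (minus (plus (VInt V u a b) (VInt V u b a)) (VInt V u a b)) by vec V.
rewrite H. vec V.
Qed.

Lemma VInt_bound_abs (u : R -> V) a b M :
  cont u -> (forall x, Rmin a b <= x <= Rmax a b -> norm (u x) <= M) ->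
  norm (VInt V u a b) <= Rabs (b - a) * M.
Proof.
intros Hu H. destruct (Rle_dec a b) as [Hab|Hab].
- rewrite Rmin_left, Rmax_right in H by lra. rewrite Rabs_pos_eq by lra.
  now apply VInt_bound.
- rewrite Rmin_right, Rmax_left in H by lra.
  rewrite VInt_swap, (norm_opp (V := V)) by easy.
  replace (Rabs (b - a)) with (a - b) by (rewrite Rabs_left1; lra).
  apply VInt_bound; [lra|easy|easy].
Qed.

Lemma VInt_const (v : V) a b : VInt V (fun _ => v) a b = scal (RtoC (b - a) : C_AbsRing) v.
Proof. apply VInt_unique, (@is_RInt_const (real_CompleteNormedModule V)). Qed.

Lemma cont_bounded (u : R -> V) a b :
  cont u -> exists M, 0 < M /\ forall x, a <= x <= b -> norm (u x) <= M.
Proof.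
intros Hu. destruct (Rle_dec a b) as [Hab|Hab].
2:{ exists 1. split; [lra|]. intros x Hx. lra. }
destruct (continuity_ab_maj (fun x => norm (u x)) a b Hab) as [c [Hc _]].
- intros x _ eps He. destruct (Hu x eps He) as [d [Hd H]]. exists d. split; [easy|].
  intros y [_ Hy]. simpl in *. unfold R_dist in *.
  eapply Rle_lt_trans; [|apply (H y); rewrite Cmod_RtoC_minus; exact Hy].
  apply Rabs_le. split.
  + assert (H1 := norm_le_minus _ (u x) (u y)). rewrite norm_minus_sym in H1. lra.
  + assert (H1 := norm_le_minus _ (u y) (u x)). lra.
- exists (1 + norm (u c)). split; [assert (H := norm_ge_0 (u c)); lra|].
  intros x Hx. specialize (Hc x Hx). simpl in Hc. lra.
Qed.

Lemma cont_uniform (u : R -> V) a b eps :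
  cont u -> 0 < eps -> exists d, 0 < d /\
    forall x y, a <= x <= b -> a <= y <= b -> Rabs (y - x) < d -> norm (minus (u y) (u x)) < eps.
Proof.
intros Hu He.
destruct (@unifcont_normed_1d R_AbsRing (real_CompleteNormedModule V) u a b) with (eps := mkposreal eps He)
  as [d Hd].
- intros x _. now apply cont_continuous.
- exists d. split; [apply cond_pos|]. intros x y Hx Hy Hxy. exact (Hd x y Hx Hy Hxy).
Qed.

Lemma cont_cis_scal (l : R) (u : R -> V) :
  cont u -> cont (fun x => scal (cis (l * x) : C_AbsRing) (u x)).
Proof.
apply cont_scal. apply (cont_lipschitz (AbsRing_NormedModule C_AbsRing)) with (2 * Rabs l).
intros x y. change (Cmod (cis (l * y) - cis (l * x)) <= 2 * Rabs l * Rabs (y - x)).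
eapply Rle_trans; [apply cis_lip|].
rewrite <- Rmult_minus_distr_l, Rabs_mult. right; ring.
Qed.

(** The bound is uniform in the endpoints because it will be applied to averaging windows with
    varying centres. Bounds on [u] are taken on an interval longer by 1 on each side, which contains
    the shifted points. *)
Lemma riemann_lebesgue (u : R -> V) r eps :
  0 < r -> cont u -> 0 < eps -> exists l0, 0 < l0 /\
    forall l a b, l0 <= Rabs l -> - r <= a -> a <= b -> b <= r ->
      norm (VInt V (fun x => scal (cis (l * x) : C_AbsRing) (u x)) a b) <= eps.
Proof.
intros Hr Hu He.
destruct (cont_bounded u (- r - 1) (r + 1) Hu) as [M [HM HM']].
destruct (cont_uniform u (- r - 1) (r + 1) (eps / (2 * r)) Hu) as [d [Hd Hd']].
{ apply Rdiv_lt_0_compat; lra. }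
(* The half-period $t=\pi/l$ must be at most 1 to stay in the enlarged interval, below [d] for the
   modulus of continuity, and at most [eps / (2 * M)] so that each of the two boundary pieces left
   by the shift is at most [eps / 2]. *)
set (d0 := Rmin (Rmin 1 (d / 2)) (eps / (2 * M))).
assert (Hd0 : 0 < d0).
{ unfold d0. repeat apply Rmin_glb_lt; try lra. apply Rdiv_lt_0_compat; lra. }
exists (PI / d0). assert (Hpi := PI_RGT_0). split; [now apply Rdiv_lt_0_compat|].
intros l a b Hl Ha Hab Hb.
assert (Hl0 : l <> 0).
{ intros ->. rewrite Rabs_R0 in Hl. assert (0 < PI / d0) by now apply Rdiv_lt_0_compat. lra. }
set (t := PI / l).
assert (Ht : Rabs t <= d0).
{ unfold t, Rdiv. rewrite Rabs_mult, Rabs_inv, (Rabs_pos_eq PI) by lra.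
  apply (Rmult_le_compat_r d0) in Hl; [|lra].
  replace (PI / d0 * d0) with PI in Hl by (field; lra).
  assert (Hp : 0 < Rabs l) by now apply Rabs_pos_lt.
  apply Rmult_le_reg_r with (Rabs l); [easy|].
  replace (PI * / Rabs l * Rabs l) with PI by (field; lra). lra. }
assert (Ht1 : Rabs t <= 1).
{ eapply Rle_trans; [exact Ht|]. unfold d0. eapply Rle_trans; apply Rmin_l. }
assert (Htd : Rabs t < d).
{ eapply Rle_lt_trans; [exact Ht|]. eapply Rle_lt_trans; [apply Rmin_l|].
  eapply Rle_lt_trans; [apply Rmin_r|]. lra. }
assert (HtM : Rabs t * M <= eps / 2).
{ apply Rle_trans with (eps / (2 * M) * M).
  - apply Rmult_le_compat_r; [lra|]. eapply Rle_trans; [exact Ht|apply Rmin_r].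
  - right; field; lra. }
assert (Htb := Rabs_def2 t (1 + 1) ltac:(lra)).
assert (Htc : -1 <= t <= 1) by (apply Rcomplements.Rabs_le_between; exact Ht1).
set (w := (fun x => scal (cis (l * x) : C_AbsRing) (u x)) : R -> V).
assert (Hw : cont w) by now apply cont_cis_scal.
assert (Hwn : forall x, - r - 1 <= x <= r + 1 -> norm (w x) <= M).
{ intros x Hx. unfold w. rewrite norm_scalC, Cmod_cis, Rmult_1_l. now apply HM'. }
assert (E1 := VInt_shift V w a b t Hw).
assert (E2 := VInt_chasles V w a (a + t) (b + t) Hw).
assert (E3 := VInt_chasles V w a b (b + t) Hw).
assert (E4 := VInt_plus V w (fun x => w (x + t)) a b Hw (cont_shift V w t Hw)).
cbv beta in E4.
assert (B1 : norm (VInt V (fun x => plus (w x) (w (x + t))) a b) <= (b - a) * (eps / (2 * r))).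
{ apply VInt_bound; [easy|intros x; apply cont_plus; [apply Hw|now apply cont_shift]|].
  intros x Hx. unfold w.
  replace (l * (x + t)) with (l * x + PI) by (unfold t; field; exact Hl0).
  rewrite cis_plus. replace (cis PI) with (RtoC (-1))
    by (apply C_eq; simpl; [now rewrite cos_PI|now rewrite sin_PI]).
  norm_as V (scal (cis (l * x) : C_AbsRing) (minus (u x) (u (x + t)))).
  rewrite norm_scalC, Cmod_cis, Rmult_1_l. left. apply Hd'; [lra|lra|].
  replace (x - (x + t)) with (- t) by ring. now rewrite Rabs_Ropp. }
assert (B2 : norm (VInt V w b (b + t)) <= eps / 2).
{ eapply Rle_trans; [apply (VInt_bound_abs w b (b + t) M Hw)|].
  - intros x Hx. apply Hwn. revert Hx. unfold Rmin, Rmax. destruct (Rle_dec b (b + t)); lra.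
  - replace (b + t - b) with t by ring. exact HtM. }
assert (B3 : norm (VInt V w a (a + t)) <= eps / 2).
{ eapply Rle_trans; [apply (VInt_bound_abs w a (a + t) M Hw)|].
  - intros x Hx. apply Hwn. revert Hx. unfold Rmin, Rmax. destruct (Rle_dec a (a + t)); lra.
  - replace (a + t - a) with t by ring. exact HtM. }
assert (B4 : (b - a) * (eps / (2 * r)) <= eps).
{ apply Rle_trans with (2 * r * (eps / (2 * r))); [|right; field; lra].
  apply Rmult_le_compat_r; [|lra]. left. apply Rdiv_lt_0_compat; lra. }
(* Shifting by half a period changes the sign of the exponential. *)
assert (E : scal (RtoC 2 : C_AbsRing) (VInt V w a b)
  = plus (VInt V (fun x => plus (w x) (w (x + t))) a b)
      (minus (VInt V w a (a + t)) (VInt V w b (b + t)))).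
{ rewrite E4, E1.
  replace (VInt V w (a + t) (b + t)) with (minus (plus (VInt V w a b) (VInt V w b (b + t)))
    (VInt V w a (a + t))) by (rewrite E3, <- E2; vec V).
  vec V. }
assert (N := f_equal norm E). rewrite norm_scalC in N.
rewrite Cmod_R, Rabs_pos_eq in N by lra.
apply Rmult_le_reg_l with 2; [lra|]. eapply Rle_trans; [right; exact N|].
eapply Rle_trans; [apply (norm_plus_le V)|].
eapply Rle_trans; [apply Rplus_le_compat; [exact B1|apply (norm_minus_le V)]|].
eapply Rle_trans; [apply Rplus_le_compat_l, Rplus_le_compat; [exact B3|exact B2]|]. lra.
Qed.

End IntegralEstimates.

(** * Moving averages *)

Notation contC k := (cont (k : R -> AbsRing_NormedModule C_AbsRing)).

Lemma contC_lipschitz (k : R -> C) L :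
  (forall x y, Cmod (k y - k x) <= L * Rabs (y - x)) -> contC k.
Proof. exact (cont_lipschitz (AbsRing_NormedModule C_AbsRing) k L). Qed.

Lemma contC_mult (k l : R -> C) : contC k -> contC l -> contC (fun x => (k x * l x)%C).
Proof. exact (cont_scal (AbsRing_NormedModule C_AbsRing) k l). Qed.

Lemma contC_plus (k l : R -> C) : contC k -> contC l -> contC (fun x => (k x + l x)%C).
Proof.
intros Hk Hl x.
exact (cont_plus _ RtoC (AbsRing_NormedModule C_AbsRing) k l x (Hk x) (Hl x)).
Qed.

Lemma contC_const (c : C) : contC (fun _ => c).
Proof. intros x. apply cont_const. Qed.

Lemma contC_cis (l : R) : contC (fun x => cis (l * x)).
Proof.
apply contC_lipschitz with (2 * Rabs l). intros x y.
eapply Rle_trans; [apply cis_lip|].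
rewrite <- Rmult_minus_distr_l, Rabs_mult. right; ring.
Qed.

Lemma contC_comp_plus (k : R -> C) (t : R) : contC k -> contC (fun s => k (t + s)).
Proof.
intros H. apply (cont_comp_le (AbsRing_NormedModule C_AbsRing) k (fun s => t + s) 1); [|exact H].
intros x y. replace (t + y - (t + x)) with (y - x) by ring. lra.
Qed.

(** * Antiderivatives of the characters $y\mapsto e^{-ity}$ *)

Section Oscillation.

Notation CC := C_CompleteNormedModule.

(** The antiderivative is kept as an integral because its closed form divides by [t], while the
    frequencies [t + s] that occur below run through 0. *)
Definition prim (t x : R) : C := VInt CC (fun y => cis (- t * y)) 0 x.

Lemma cis_prod_lip t t' x r :
  Rabs x <= r -> Cmod (cis (- t * x) - cis (- t' * x)) <= 2 * r * Rabs (t - t').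
Proof.
intros Hr. eapply Rle_trans; [apply cis_lip|].
replace (- t * x - - t' * x) with (x * - (t - t')) by ring.
rewrite Rabs_mult, Rabs_Ropp. assert (H := Rabs_pos (t - t')). nra.
Qed.

Lemma cis_prod_lip_r t x y :
  Cmod (cis (- t * y) - cis (- t * x)) <= 2 * Rabs t * Rabs (y - x).
Proof.
eapply Rle_trans; [apply cis_lip|].
replace (- t * y - - t * x) with (- t * (y - x)) by ring.
rewrite Rabs_mult, Rabs_Ropp. right; ring.
Qed.

Lemma prim_chasles t x y : (prim t y - prim t x)%C = VInt CC (fun y => cis (- t * y)) x y.
Proof.
unfold prim. rewrite <- (VInt_chasles CC (fun y => cis (- t * y)) 0 x y (contC_cis (- t))).
change (plus (VInt CC (fun y => cis (- t * y)) 0 x) (VInt CC (fun y => cis (- t * y)) x y))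
  with (Cplus (VInt CC (fun y => cis (- t * y)) 0 x) (VInt CC (fun y => cis (- t * y)) x y)).
ring.
Qed.

Lemma VInt_cis_minus a b t c :
  minus (VInt CC (fun y => cis (- t * y)) a b) (scal (RtoC (b - a) : C_AbsRing) c)
  = VInt CC (fun y => minus (cis (- t * y) : CC) c) a b.
Proof.
rewrite (VInt_minus CC); [|apply contC_cis|apply contC_const].
f_equal. symmetry. apply (VInt_const CC).
Qed.

Lemma prim_quad t x y :
  Cmod (prim t y - prim t x - RtoC (y - x) * cis (- t * x))
    <= 2 * Rabs t * Rabs (y - x) * Rabs (y - x).
Proof.
rewrite prim_chasles.
change (norm (minus (VInt CC (fun y => cis (- t * y)) x y) (scal (RtoC (y - x) : C_AbsRing) (cis (- t * x) : CC)))
  <= 2 * Rabs t * Rabs (y - x) * Rabs (y - x)).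
rewrite VInt_cis_minus.
eapply Rle_trans; [apply (VInt_bound_abs CC) with (M := 2 * Rabs t * Rabs (y - x))|].
- apply (cont_minus CC); [apply contC_cis|apply contC_const].
- intros s Hs. eapply Rle_trans; [apply cis_prod_lip_r|].
  apply Rmult_le_compat_l; [assert (H := Rabs_pos t); lra|].
  revert Hs. unfold Rmin, Rmax, Rabs. destruct Rle_dec, Rcase_abs, Rcase_abs; lra.
- right; ring.
Qed.

Lemma prim_lip x t t' :
  Cmod (prim t' x - prim t x) <= 2 * Rabs x * Rabs x * Rabs (t' - t).
Proof.
unfold prim.
change (norm (minus (VInt CC (fun y => cis (- t' * y)) 0 x) (VInt CC (fun y => cis (- t * y)) 0 x))
  <= 2 * Rabs x * Rabs x * Rabs (t' - t)).
rewrite <- (VInt_minus CC); [|apply contC_cis|apply contC_cis].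
eapply Rle_trans; [apply (VInt_bound_abs CC) with (M := 2 * Rabs x * Rabs (t' - t))|].
- apply (cont_minus CC); apply contC_cis.
- intros s Hs. apply cis_prod_lip. now apply between_abs.
- rewrite Rminus_0_r. right; ring.
Qed.

End Oscillation.

Section Averages.

Variable eta : R.
Hypothesis eta_pos : 0 < eta.

Definition avg (V : CompleteNormedModule C_AbsRing) (u : R -> V) (x : R) : V :=
  scal (RtoC (/ (2 * eta)) : C_AbsRing) (VInt V u (x - eta) (x + eta)).

(** The Fourier transform of the uniform density on $[-\eta,\eta]$, that is $\sin(\eta t)/(\eta t)$
    away from 0; this form is continuous at 0 without a case distinction. *)
Definition osc (t : R) : C := (RtoC (/ (2 * eta)) * (prim t eta - prim t (- eta)))%C.

(** Characters are eigenvectors of the moving average: centring the window at [x] produces the phase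
    [cis (- t * x)], and the eigenvalue is [osc t]. *)
Lemma osc_prim t x :
  (RtoC (/ (2 * eta)) * (prim t (x + eta) - prim t (x - eta)))%C = (cis (- t * x) * osc t)%C.
Proof.
unfold osc. rewrite !prim_chasles.
replace (x - eta) with (- eta + x) by ring. rewrite (Rplus_comm x).
rewrite <- (VInt_shift C_CompleteNormedModule (fun y => cis (- t * y)) (- eta) eta x)
  by apply contC_cis.
replace (VInt C_CompleteNormedModule (fun x0 => cis (- t * (x0 + x))) (- eta) eta)
  with (cis (- t * x) * VInt C_CompleteNormedModule (fun y => cis (- t * y)) (- eta) eta)%C.
{ ring. }
rewrite <- (VInt_scal C_CompleteNormedModule (cis (- t * x)) (fun y => cis (- t * y)))
  by apply contC_cis.
apply VInt_ext; [lra|]. intros y _.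
rewrite Rmult_plus_distr_l, cis_plus. apply Cmult_comm.
Qed.

Lemma osc_lip t t' : Cmod (osc t' - osc t) <= 2 * eta * Rabs (t' - t).
Proof.
unfold osc.
replace (RtoC (/ (2 * eta)) * (prim t' eta - prim t' (- eta))
    - RtoC (/ (2 * eta)) * (prim t eta - prim t (- eta)))%C
  with (RtoC (/ (2 * eta)) * ((prim t' eta - prim t eta) + - (prim t' (- eta) - prim t (- eta))))%C
  by ring.
rewrite Cmod_mult, Cmod_R, Rabs_pos_eq by (left; apply Rinv_0_lt_compat; lra).
eapply Rle_trans.
{ apply Rmult_le_compat_l; [left; apply Rinv_0_lt_compat; lra|].
  eapply Rle_trans; [apply Cmod_triangle|]. rewrite Cmod_opp.
  apply Rplus_le_compat; apply prim_lip. }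
rewrite Rabs_Ropp, (Rabs_pos_eq eta) by lra. right. field. lra.
Qed.

Lemma cont_osc : contC osc.
Proof. apply contC_lipschitz with (2 * eta). intros x y. apply osc_lip. Qed.

(** The pair [(0, / t)] is $i/t$, the inverse of the factor $-it$ that differentiation of $e^{-ity}$
    produces. *)
Lemma diff_cis t x :
  t <> 0 -> @diff_at R RtoC (AbsRing_NormedModule C_AbsRing)
    (fun y => ((0, (/ t)%R) * cis (- t * y))%C) x (cis (- t * x)).
Proof.
intros Ht.
assert (Hq : forall y, Rabs (t * (y - x)) <= 1 ->
  Cmod ((0, (/ t)%R) * cis (- t * y) - (0, (/ t)%R) * cis (- t * x) - RtoC (y - x) * cis (- t * x))
    <= 13 * Rabs t * Rabs (y - x) * Rabs (y - x)).
{ intros y Hy. set (w := (0, (- (t * (y - x)))%R) : C).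
  assert (Hw : Cmod w = Rabs (t * (y - x))).
  { unfold w. replace (0, (- (t * (y - x)))%R) with ((0, (-1)%R) * RtoC (t * (y - x)))%C
      by (apply C_eq; simpl; ring).
    rewrite Cmod_mult, Cmod_R. replace (Cmod (0, (-1)%R)) with 1; [ring|].
    unfold Cmod; simpl. rewrite <- sqrt_1 at 1. f_equal; ring. }
  assert (Q := cexp_quad w ltac:(rewrite Hw; exact Hy)). rewrite Hw in Q.
  replace ((0, (/ t)%R) * cis (- t * y) - (0, (/ t)%R) * cis (- t * x) - RtoC (y - x) * cis (- t * x))%C
    with ((0, (/ t)%R) * cis (- t * x) * (cexp w - 1 - w))%C.
  - rewrite !Cmod_mult, Cmod_cis. replace (Cmod (0, (/ t)%R)) with (/ Rabs t).
    + assert (Hp : 0 < Rabs t) by now apply Rabs_pos_lt.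
      apply Rle_trans with (/ Rabs t * 1 * (13 * Rabs (t * (y - x)) * Rabs (t * (y - x)))).
      * apply Rmult_le_compat_l; [|exact Q]. rewrite Rmult_1_r.
        left; now apply Rinv_0_lt_compat.
      * rewrite Rabs_mult. right. field. lra.
    + replace (0, (/ t)%R) with ((0, 1) * RtoC (/ t))%C by (apply C_eq; simpl; ring).
      rewrite Cmod_mult, Cmod_R, Rabs_inv. replace (Cmod (0, 1)) with 1; [ring|].
      unfold Cmod; simpl. rewrite <- sqrt_1 at 1. f_equal; ring.
  - unfold w. rewrite cexp_imag.
    replace (- t * y) with (- t * x + - (t * (y - x))) by ring. rewrite cis_plus.
    replace (0, (- (t * (y - x)))%R) with ((0, (-1)%R) * RtoC t * RtoC (y - x))%C
      by (apply C_eq; simpl; ring).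
    assert (E : ((0, (/ t)%R) * ((0, (-1)%R) * RtoC t) = 1)%C).
    { apply C_eq; simpl; field; exact Ht. }
    replace ((0, (/ t)%R) * cis (- t * x) *
      (cis (- (t * (y - x))) - 1 - (0, (-1)%R) * RtoC t * RtoC (y - x)))%C
    with ((0, (/ t)%R) * cis (- t * x) * cis (- (t * (y - x))) - (0, (/ t)%R) * cis (- t * x)
      - ((0, (/ t)%R) * ((0, (-1)%R) * RtoC t)) * (RtoC (y - x) * cis (- t * x)))%C by ring.
    rewrite E. ring. }
assert (Hp : 0 < Rabs t) by now apply Rabs_pos_lt.
apply diff_quad with (K := 13 * Rabs t) (rho := / Rabs t); [now apply Rinv_0_lt_compat|].
intros y Hy. rewrite Cmod_RtoC_minus, <- RtoC_minus in *. apply Hq. rewrite Rabs_mult.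
apply (Rmult_le_compat_l (Rabs t)) in Hy; [|lra]. rewrite Rinv_r in Hy; lra.
Qed.

Lemma osc_sinc t : t <> 0 -> osc t = RtoC (sin (eta * t) / (eta * t)).
Proof.
intros Ht. unfold osc. rewrite prim_chasles.
rewrite (VInt_ftc C_CompleteNormedModule (fun y => ((0, (/ t)%R) * cis (- t * y))%C : C_CompleteNormedModule)
  (fun y => cis (- t * y))); [|lra| |apply contC_cis].
- change (RtoC (/ (2 * eta)) * ((0, (/ t)%R) * cis (- t * eta) - (0, (/ t)%R) * cis (- t * - eta))
    = RtoC (sin (eta * t) / (eta * t)))%C.
  replace (- t * - eta) with (eta * t) by ring. replace (- t * eta) with (- (eta * t)) by ring.
  apply C_eq; simpl; rewrite cos_neg, sin_neg; field; lra.
- intros x _. exact (diff_cis t x Ht).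
Qed.

Lemma osc_decay t : t <> 0 -> Cmod (osc t) <= / (eta * Rabs t).
Proof.
intros Ht. assert (Hp : 0 < Rabs t) by now apply Rabs_pos_lt.
rewrite osc_sinc, Cmod_R by easy. unfold Rdiv.
rewrite Rabs_mult, Rabs_inv, Rabs_mult, (Rabs_pos_eq eta) by lra.
rewrite <- (Rmult_1_l (/ (eta * Rabs t))) at 2. apply Rmult_le_compat_r.
- left. apply Rinv_0_lt_compat. nra.
- apply Rabs_le. split; apply SIN_bound.
Qed.

Variable V : CompleteNormedModule C_AbsRing.

Lemma avg_cont (u : R -> V) : cont u -> cont (avg V u).
Proof.
intros Hu. unfold avg. apply cont_scal; [apply contC_const|].
intros x. apply cont_ext with (fun x => minus (VInt V u 0 (x + eta)) (VInt V u 0 (x + - eta))).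
- intros y. rewrite <- (VInt_chasles V u 0 (y - eta) (y + eta)) by easy. unfold Rminus. vec V.
- revert x. apply (cont_minus V).
  + apply (cont_shift V (fun x => VInt V u 0 x) eta). intros x.
    apply diff_cont with (u x). now apply diff_VInt.
  + apply (cont_shift V (fun x => VInt V u 0 x) (- eta)). intros x.
    apply diff_cont with (u x). now apply diff_VInt.
Qed.

Lemma avg_ext (u v : R -> V) x :
  (forall y, x - eta <= y <= x + eta -> u y = v y) -> avg V u x = avg V v x.
Proof. intros H. unfold avg. f_equal. apply VInt_ext; [lra|exact H]. Qed.

Lemma avg_minus (u v : R -> V) x :
  cont u -> cont v -> avg V (fun y => minus (u y) (v y)) x = minus (avg V u x) (avg V v x).
Proof. intros Hu Hv. unfold avg. rewrite (VInt_minus V) by easy. vec V. Qed.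

Lemma avg_bound (u : R -> V) x M :
  cont u -> (forall y, x - eta <= y <= x + eta -> norm (u y) <= M) -> norm (avg V u x) <= M.
Proof.
intros Hu H. unfold avg. rewrite (norm_scalC V), Cmod_R, Rabs_pos_eq
  by (left; apply Rinv_0_lt_compat; lra).
apply Rle_trans with (/ (2 * eta) * ((x + eta - (x - eta)) * M)).
- apply Rmult_le_compat_l; [left; apply Rinv_0_lt_compat; lra|]. apply VInt_bound; [lra|easy|easy].
- right. field. lra.
Qed.

Lemma avg_linear (L : V -> V) (u : R -> V) x :
  is_linear L -> cont u -> avg V (fun y => L (u y)) x = L (avg V u x).
Proof.
intros HL Hu. unfold avg. rewrite (VInt_linear V V L) by easy.
symmetry. apply (linear_scal L HL).
Qed.

Lemma cont_prim_scal (w : R -> V) t x :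
  cont w -> cont (fun s => scal (prim (t + s) x : C_AbsRing) (w s)).
Proof.
intros Hw. apply cont_scal; [|easy].
apply (contC_comp_plus (fun s => prim s x) t). apply contC_lipschitz with (2 * Rabs x * Rabs x).
intros s s'. apply prim_lip.
Qed.

Lemma cont_cis_plus_scal (w : R -> V) t x :
  cont w -> cont (fun s => scal (cis (- (t + s) * x) : C_AbsRing) (w s)).
Proof.
intros Hw. apply cont_scal; [|easy].
apply (contC_comp_plus (fun s => cis (- s * x)) t).
apply contC_lipschitz with (2 * Rabs x).
intros s s'. now apply cis_prod_lip.
Qed.

Lemma cont_fourier (w : R -> V) t :
  cont w -> cont (fun x => VInt V (fun s => scal (cis (- (t + s) * x) : C_AbsRing) (w s)) 0 1).
Proof.
intros Hw. destruct (cont_bounded V w 0 1 Hw) as [M [HM HM']].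
apply (cont_lipschitz V) with (2 * (Rabs t + 1) * M). intros x y.
rewrite <- (VInt_minus V); [|now apply cont_cis_plus_scal|now apply cont_cis_plus_scal].
eapply Rle_trans; [apply (VInt_bound V) with (M := 2 * (Rabs t + 1) * M * Rabs (y - x)); [lra| |]|].
- apply (cont_minus V); now apply cont_cis_plus_scal.
- intros s Hs. norm_as V (scal (Cminus (cis (- (t + s) * y)) (cis (- (t + s) * x)) : C_AbsRing) (w s)).
  rewrite (norm_scalC V).
  apply Rle_trans with (2 * (Rabs t + 1) * Rabs (y - x) * M); [|right; ring].
  apply Rmult_le_compat; [apply Cmod_ge_0|apply norm_ge_0| |now apply HM'].
  eapply Rle_trans; [apply cis_prod_lip_r|].
  apply Rmult_le_compat_r; [apply Rabs_pos|].
  assert (H := Rabs_triang t s). rewrite (Rabs_pos_eq s) in H by lra. lra.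
- right; ring.
Qed.

(* Fubini for this particular kernel, by differentiating [x |-> int (prim (t+s) x) (w s) ds]. *)
Lemma avg_fourier (w : R -> V) t x :
  cont w ->
  avg V (fun y => VInt V (fun s => scal (cis (- (t + s) * y) : C_AbsRing) (w s)) 0 1) x
  = VInt V (fun s => scal (cis (- (t + s) * x) : C_AbsRing) (scal (osc (t + s) : C_AbsRing) (w s))) 0 1.
Proof.
intros Hw. destruct (cont_bounded V w 0 1 Hw) as [M [HM HM']].
unfold avg.
rewrite (VInt_ftc V (fun y => VInt V (fun s => scal (prim (t + s) y : C_AbsRing) (w s)) 0 1)).
- rewrite <- (VInt_minus V); [|now apply cont_prim_scal|now apply cont_prim_scal].
  rewrite <- (VInt_scal V) by (apply (cont_minus V); now apply cont_prim_scal).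
  apply VInt_ext; [lra|]. intros s _. cbv beta.
  transitivity (scal (RtoC (/ (2 * eta)) * (prim (t + s) (x + eta) - prim (t + s) (x - eta)) : C_AbsRing)%C (w s)).
  { vec V. }
  rewrite osc_prim. vec V.
- lra.
- intros y _. apply diff_quad with (K := 2 * (Rabs t + 1) * M) (rho := 1); [lra|].
  intros z _. rewrite Cmod_RtoC_minus, <- RtoC_minus.
  rewrite <- (VInt_minus V); [|now apply cont_prim_scal|now apply cont_prim_scal].
  rewrite <- (VInt_scal V) by now apply cont_cis_plus_scal.
  assert (C1 : cont (fun s => minus (scal (prim (t + s) z : C_AbsRing) (w s))
    (scal (prim (t + s) y : C_AbsRing) (w s)))) by (apply (cont_minus V); now apply cont_prim_scal).
  assert (C2 : cont (fun s => scal (RtoC (z - y) : C_AbsRing)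
    (scal (cis (- (t + s) * y) : C_AbsRing) (w s)))).
  { apply cont_scal; [apply contC_const|now apply cont_cis_plus_scal]. }
  eapply Rle_trans; [right; exact (f_equal (@norm C_AbsRing V) (eq_sym (VInt_minus V _ _ 0 1 C1 C2)))|].
  eapply Rle_trans; [apply (VInt_bound V) with (M := 2 * (Rabs t + 1) * M * Rabs (z - y) * Rabs (z - y)); [lra| |]|].
  + exact (cont_minus V _ _ C1 C2).
  + intros s Hs.
    norm_as V (scal (prim (t + s) z - prim (t + s) y - RtoC (z - y) * cis (- (t + s) * y) : C_AbsRing)%C (w s)).
    rewrite (norm_scalC V).
    apply Rle_trans with (2 * (Rabs t + 1) * Rabs (z - y) * Rabs (z - y) * M); [|right; ring].
    apply Rmult_le_compat; [apply Cmod_ge_0|apply norm_ge_0| |now apply HM'].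
    eapply Rle_trans; [apply prim_quad|].
    apply Rmult_le_compat_r; [apply Rabs_pos|]. apply Rmult_le_compat_r; [apply Rabs_pos|].
    assert (H := Rabs_triang t s). rewrite (Rabs_pos_eq s) in H by lra. lra.
  + right; ring.
- now apply cont_fourier.
Qed.

End Averages.

(** * Telescoping along an isometric group *)

Record isometric_group (V : NormedModule C_AbsRing) (S : R -> V -> V) : Prop := {
  group_plus : forall t x y, S t (plus x y) = plus (S t x) (S t y);
  group_scal : forall t (c : C) x, S t (scal (c : C_AbsRing) x) = scal (c : C_AbsRing) (S t x);
  group_norm : forall t x, norm (S t x) = norm x;
  group_add : forall s t x, S (s + t) x = S s (S t x);
  group_0 : forall x, S 0 x = x;
  group_cont : forall x, cont (fun t => S t x)
}.

Arguments isometric_group {V} S.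

Section Group.

Variables (V : NormedModule C_AbsRing) (S : R -> V -> V).
Hypothesis HS : isometric_group S.

Lemma group_linear t : is_linear (S t).
Proof.
split; [apply (group_plus _ _ HS)|intros k x; apply (group_scal _ _ HS)|].
exists 1. split; [lra|]. intros x. rewrite (group_norm _ _ HS). lra.
Qed.

Lemma group_minus t x y : S t (minus x y) = minus (S t x) (S t y).
Proof. apply (linear_minus _ x y (group_linear t)). Qed.

Lemma group_comm s t x : S s (S t x) = S t (S s x).
Proof. now rewrite <- !(group_add _ _ HS), Rplus_comm. Qed.

(** Multiplication by a character rotates the spectrum: the point [cis xi] for [S 1] becomes 1 for
    the twisted group, so only the point 1 has to be treated. *)
Lemma group_twist xi :
  isometric_group (fun t x => scal (cis (- xi * t) : C_AbsRing) (S t x)).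
Proof.
split.
- intros t x y. rewrite (group_plus _ _ HS). vec V.
- intros t c x. rewrite (group_scal _ _ HS). vec V.
- intros t x. rewrite norm_scalC, Cmod_cis, (group_norm _ _ HS). ring.
- intros s t x. rewrite Rmult_plus_distr_l, cis_plus, (group_add _ _ HS), (group_scal _ _ HS). vec V.
- intros x. rewrite Rmult_0_r, cis_0, (group_0 _ _ HS). vec V.
- intros x. apply cont_scal; [apply contC_cis|apply (group_cont _ _ HS)].
Qed.

Lemma cont_group_plus x t : cont (fun s => S (t + s) x).
Proof.
apply (cont_comp_le V (fun t => S t x) (fun s => t + s) 1); [|apply (group_cont _ _ HS)].
intros a b. replace (t + b - (t + a)) with (b - a) by ring. lra.
Qed.

Lemma cont_group (u : R -> V) t : cont u -> cont (fun s => S t (u s)).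
Proof.
intros Hu x eps He. destruct (Hu x eps He) as [d [Hd H]]. exists d. split; [easy|].
intros y Hy. rewrite <- group_minus, (group_norm _ _ HS). now apply H.
Qed.

End Group.

Lemma cont_sum_n (V : NormedModule C_AbsRing) (u : nat -> R -> V) N :
  (forall n, cont (u n)) -> cont (fun x => sum_n (fun n => u n x) N).
Proof.
intros H. induction N; intros x.
- apply cont_ext with (u 0%nat); [intros y; now rewrite sum_O|apply H].
- apply cont_ext with (fun x => plus (sum_n (fun n => u n x) N) (u (Datatypes.S N) x)).
  + intros y. now rewrite sum_Sn.
  + apply cont_plus; [apply IHN|apply H].
Qed.

(** * Fourfold averages and the telescoping sum *)

Section Core.

Variables (V : CompleteNormedModule C_AbsRing) (S : R -> V -> V).
Hypothesis HS : isometric_group S.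
Variable f : V.
Variable eta : R.
Hypothesis eta_pos : 0 < eta.

Notation A := (avg eta V).

(** Four windows of half-width [eta] read [u] on $[-4\eta,4\eta]$ only, the interval on which
    [solvable] provides an equation. *)
Definition avg4 (u : R -> V) : V := A (A (A (A u))) 0.

Lemma avg4_ext (u v : R -> V) :
  (forall y, Rabs y <= 4 * eta -> u y = v y) -> avg4 u = avg4 v.
Proof.
intros H. unfold avg4.
assert (step : forall (u v : R -> V) r, (forall y, Rabs y <= r -> u y = v y) ->
  forall y, Rabs y <= r - eta -> A u y = A v y).
{ intros u' v' r H' y Hy. apply avg_ext; [easy|]. intros z Hz. apply H'.
  apply Rcomplements.Rabs_le_between in Hy. apply Rabs_le. lra. }
apply (step _ _ eta); [|rewrite Rabs_R0; lra].
intros y Hy. apply (step _ _ (2 * eta)); [|lra]. clear y Hy.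
intros y Hy. apply (step _ _ (3 * eta)); [|lra]. clear y Hy.
intros y Hy. apply (step _ _ (4 * eta)); [|lra]. exact H.
Qed.

Lemma avg4_minus (u v : R -> V) :
  cont u -> cont v -> avg4 (fun y => minus (u y) (v y)) = minus (avg4 u) (avg4 v).
Proof.
intros Hu Hv. unfold avg4.
assert (step : forall u v : R -> V, cont u -> cont v ->
  A (fun y => minus (u y) (v y)) = fun y => minus (A u y) (A v y)).
{ intros u' v' Hu' Hv'. apply functional_extensionality. intros y. now apply avg_minus. }
rewrite (step u v) by easy.
rewrite (step (A u) (A v)) by now apply avg_cont.
rewrite (step (A (A u)) (A (A v))) by now do 2 apply avg_cont.
rewrite (step (A (A (A u))) (A (A (A v)))) by now do 3 apply avg_cont.
reflexivity.
Qed.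

Lemma avg4_bound (u : R -> V) M :
  cont u -> (forall x, Rabs x <= 3 * eta -> norm (A u x) <= M) -> norm (avg4 u) <= M.
Proof.
intros Hu H. unfold avg4.
apply avg_bound; [easy|now do 3 apply avg_cont|]. intros y Hy.
apply avg_bound; [easy|now do 2 apply avg_cont|]. intros z Hz.
apply avg_bound; [easy|now apply avg_cont|]. intros x Hx.
apply H. apply Rabs_le. lra.
Qed.

Definition osc4 (t : R) : C := (osc eta t * osc eta t * (osc eta t * osc eta t))%C.

Lemma cont_osc4 : contC osc4.
Proof. unfold osc4. apply contC_mult; apply contC_mult; now apply cont_osc. Qed.

Definition fourier (w : R -> V) (t x : R) : V :=
  VInt V (fun s => scal (cis (- (t + s) * x) : C_AbsRing) (w s)) 0 1.

(** Each average multiplies the integrand by one factor [osc]; evaluation at 0 removes the remaining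
    phase. *)
Lemma avg4_fourier (w : R -> V) t :
  cont w -> avg4 (fourier w t) = VInt V (fun s => scal (osc4 (t + s) : C_AbsRing) (w s)) 0 1.
Proof.
intros Hw. unfold avg4.
set (m := fun w s => scal (osc eta (t + s) : C_AbsRing) (w s : V)).
assert (Hm : forall w, cont w -> cont (m w)).
{ intros w' Hw'. apply cont_scal; [|easy]. apply (contC_comp_plus (osc eta) t). now apply cont_osc. }
assert (step : forall w, cont w -> A (fourier w t) = fourier (m w) t).
{ intros w' Hw'. apply functional_extensionality. intros y. now apply avg_fourier. }
rewrite (step w), (step (m w)), (step (m (m w))), (step (m (m (m w)))) by now repeat apply Hm.
unfold fourier. apply VInt_ext; [lra|]. intros s _. unfold m, osc4.
rewrite Rmult_0_r, cis_0. vec V.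
Qed.

(* The equation of the transform of [f], weighted by [p],
   has a continuous solution near the origin. *)
Definition solvable (p : R -> C) : Prop :=
  exists H : R -> V, cont H /\ forall x, Rabs x <= 4 * eta ->
    minus (scal (cis x : C_AbsRing) (H x)) (S 1 (H x))
    = VInt V (fun s => scal (p s * cis (x * (1 - s)) : C_AbsRing)%C (S s f)) 0 1.

Definition sample (t s : R) : V := scal (osc4 (t + s) : C_AbsRing) (S (t + s) f).

(** Pairing $n$ with $-n-1$ runs once through the integers from $-L-1$ to $L$; at $s=1/2$ the two
    arguments of [osc4] in a pair are opposite. *)
Definition partial (L : nat) (s : R) : V :=
  sum_n (fun n => plus (sample (INR n) s) (sample (- INR n - 1) s)) L.

Lemma partial_0 s : partial 0 s = plus (sample (INR 0) s) (sample (- INR 0 - 1) s).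
Proof. apply sum_O. Qed.

Lemma partial_S L s : partial (Datatypes.S L) s = plus (partial L s)
  (plus (sample (INR (Datatypes.S L)) s) (sample (- INR (Datatypes.S L) - 1) s)).
Proof. apply sum_Sn. Qed.

Lemma cont_sample t : cont (sample t).
Proof.
apply cont_scal; [apply (contC_comp_plus osc4 t), cont_osc4|now apply cont_group_plus].
Qed.

Lemma cont_partial L : cont (partial L).
Proof. apply cont_sum_n. intros n x. apply cont_plus; apply cont_sample. Qed.

(** [L0] depends on [p] through the solution [H], about which only continuity is known. This is
    harmless as long as [p] is fixed before [L] grows. *)
Lemma solvable_partial (p : R -> C) eps :
  contC p -> solvable p -> 0 < eps -> exists L0, forall L, (L0 <= L)%nat ->
    norm (VInt V (fun s => scal (p s : C_AbsRing) (partial L s)) 0 1) <= eps.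
Proof.
intros Hp [H [Hc HH]] He.
set (g := (fun t x => scal (cis (- t * x) : C_AbsRing) (S t (H x))) : R -> R -> V).
assert (Hg : forall t, cont (g t)).
{ intros t. apply (cont_cis_scal V). now apply cont_group. }
(* Because $-(t+s)x=-(t+1)x+x(1-s)$, multiplying the equation by [cis (- (t + 1) * x)] and applying
   [S t] turns its right side into a Fourier integral of frequency [t + s] and its left side into a
   first difference in [t]. *)
assert (Hsol : forall t x, Rabs x <= 4 * eta ->
  fourier (fun s => scal (p s : C_AbsRing) (S (t + s) f)) t x = minus (g t x) (g (t + 1) x)).
{ intros t x Hx. unfold g.
  transitivity (scal (cis (- (t + 1) * x) : C_AbsRing)
    (S t (minus (scal (cis x : C_AbsRing) (H x)) (S 1 (H x))))).
  - rewrite HH by easy.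
    assert (C1 : cont (fun s => scal (p s * cis (x * (1 - s)) : C_AbsRing)%C (S s f))).
    { apply cont_scal; [|apply (group_cont _ _ HS)]. apply contC_mult; [easy|].
      apply contC_lipschitz with (2 * Rabs x). intros a b. eapply Rle_trans; [apply cis_lip|].
      replace (x * (1 - b) - x * (1 - a)) with (x * - (b - a)) by ring.
      rewrite Rabs_mult, Rabs_Ropp. right; ring. }
    rewrite <- (VInt_linear V V (S t)) by (easy || apply (group_linear V S HS)).
    rewrite <- (VInt_scal V) by now apply (cont_group V S HS).
    apply VInt_ext; [lra|]. intros s _. cbv beta.
    rewrite (group_scal _ _ HS), (group_add _ _ HS).
    replace (- (t + s) * x) with (- (t + 1) * x + x * (1 - s)) by ring.
    rewrite cis_plus. vec V.
  - rewrite (group_minus V S HS), (group_scal _ _ HS), <- (group_add _ _ HS).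
    replace (- t * x) with (- (t + 1) * x + x) by ring. rewrite cis_plus. vec V. }
assert (Hw : forall t, cont (fun s => scal (p s : C_AbsRing) (S (t + s) f))).
{ intros t. apply cont_scal; [easy|]. now apply cont_group_plus. }
assert (Hps : forall t, cont (fun s => scal (p s : C_AbsRing) (sample t s))).
{ intros t. apply cont_scal; [easy|apply cont_sample]. }
assert (Htel : forall t, VInt V (fun s => scal (p s : C_AbsRing) (sample t s)) 0 1
  = minus (avg4 (g t)) (avg4 (g (t + 1)))).
{ intros t. rewrite <- avg4_minus by easy.
  rewrite <- (avg4_ext _ _ (Hsol t)), avg4_fourier by easy.
  apply VInt_ext; [lra|]. intros s _. unfold sample. vec V. }
(* Each pair extends the block of consecutive indices by one at both ends, so only the two outermost
   values of [g] survive. *)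
assert (Hsum : forall L, VInt V (fun s => scal (p s : C_AbsRing) (partial L s)) 0 1
  = minus (avg4 (g (- INR L - 1))) (avg4 (g (INR L + 1)))).
{ assert (Hpair : forall n, VInt V (fun s => scal (p s : C_AbsRing)
      (plus (sample (INR n) s) (sample (- INR n - 1) s))) 0 1
    = plus (minus (avg4 (g (INR n))) (avg4 (g (INR n + 1))))
        (minus (avg4 (g (- INR n - 1))) (avg4 (g (- INR n - 1 + 1))))).
  { intros n. rewrite <- (Htel (INR n)), <- (Htel (- INR n - 1)).
    refine (eq_trans _ (VInt_plus V _ _ 0 1 (Hps (INR n)) (Hps (- INR n - 1)))).
    apply VInt_ext; [lra|]. intros s _. vec V. }
  induction L.
  - rewrite (VInt_ext V _ _ 0 1 Rle_0_1
      (fun s _ => f_equal (scal (p s : C_AbsRing)) (partial_0 s))).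
    rewrite Hpair. replace (- INR 0 - 1 + 1) with (INR 0) by (simpl; ring). vec V.
  - transitivity (plus (VInt V (fun s => scal (p s : C_AbsRing) (partial L s)) 0 1)
      (VInt V (fun s => scal (p s : C_AbsRing)
        (plus (sample (INR (Datatypes.S L)) s) (sample (- INR (Datatypes.S L) - 1) s))) 0 1)).
    + rewrite <- (VInt_plus V).
      * apply VInt_ext; [lra|]. intros s _. rewrite partial_S. vec V.
      * apply cont_scal; [easy|apply cont_partial].
      * apply cont_scal; [easy|]. intros x. apply cont_plus; apply cont_sample.
    + rewrite IHL, Hpair.
      replace (INR (Datatypes.S L)) with (INR L + 1) by now rewrite S_INR.
      replace (- (INR L + 1) - 1 + 1) with (- INR L - 1) by ring. vec V. }
assert (Hsmall : exists l0, forall t, l0 <= Rabs t -> norm (avg4 (g t)) <= eps / 2).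
{ destruct (riemann_lebesgue V H (4 * eta) (eps / 2 * (2 * eta))) as [l0 [_ Hl0]]; [lra|easy|nra|].
  exists l0. intros t Ht. apply avg4_bound; [easy|]. intros x Hx.
  (* [S t] commutes with the average and preserves the norm, so it disappears and only the
     oscillating integral of the fixed function [H] remains. The tolerance carries the factor
     [2 * eta] to absorb the normalization of the average. The three outer averages merely preserve
     the bound. *)
  replace (A (g t) x) with (S t (A (fun y => scal (cis (- t * y) : C_AbsRing) (H y)) x)).
  - rewrite (group_norm _ _ HS). unfold avg.
    rewrite (norm_scalC V), Cmod_R, Rabs_pos_eq by (left; apply Rinv_0_lt_compat; lra).
    apply Rle_trans with (/ (2 * eta) * (eps / 2 * (2 * eta))); [|right; field; lra].
    apply Rmult_le_compat_l; [left; apply Rinv_0_lt_compat; lra|].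
    apply Rcomplements.Rabs_le_between in Hx.
    apply Hl0; [now rewrite Rabs_Ropp|lra|lra|lra].
  - rewrite <- (avg_linear eta V (S t)).
    + apply avg_ext; [easy|]. intros y _. unfold g. apply (group_scal _ _ HS).
    + apply (group_linear V S HS).
    + now apply (cont_cis_scal V). }
destruct Hsmall as [l0 Hl0]. destruct (INR_unbounded l0) as [L0 HL0].
exists L0. intros L HL. rewrite Hsum. apply le_INR in HL.
eapply Rle_trans; [apply (norm_minus_le V)|].
assert (H0 := pos_INR L).
apply Rle_trans with (eps / 2 + eps / 2); [|lra].
apply Rplus_le_compat; apply Hl0.
- rewrite Rabs_left1; lra.
- rewrite Rabs_pos_eq; lra.
Qed.

End Core.

(** * Concentration at the midpoint *)

Lemma contC_RtoC (g : R -> R) : (forall x, continuous g x) -> contC (fun x => RtoC (g x)).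
Proof.
intros H x eps He.
destruct (proj1 (filterlim_locally g (g x)) (H x) (mkposreal eps He)) as [d Hd].
exists d. split; [apply cond_pos|]. intros y Hy. rewrite Cmod_RtoC_minus in Hy.
change (Cmod (RtoC (g y) - RtoC (g x)) < eps). rewrite Cmod_RtoC_minus. exact (Hd y Hy).
Qed.

Lemma RInt_correct_cont (g : R -> R) a b : (forall x, continuous g x) -> is_RInt g a b (RInt g a b).
Proof.
intros H. apply (@RInt_correct R_CompleteNormedModule).
apply (@ex_RInt_continuous R_CompleteNormedModule). intros z _. apply H.
Qed.

Lemma VInt_scal_const (V : CompleteNormedModule C_AbsRing) (g : R -> R) (v : V) a b :
  a <= b -> (forall x, continuous g x) ->
  VInt V (fun s => scal (RtoC (g s) : C_AbsRing) v) a b = scal (RtoC (RInt g a b) : C_AbsRing) v.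
Proof.
intros Hab Hg.
rewrite (VInt_ftc V (fun x => scal (RtoC (RInt g a x) : C_AbsRing) v)).
- rewrite (is_RInt_unique _ _ _ _ (@is_RInt_point R_NormedModule g a)).
  change (@zero R_NormedModule) with 0. vec V.
- easy.
- intros x _.
  assert (Hd : is_derive (fun b => RInt g a b) x (g x)).
  { apply (@is_derive_RInt R_NormedModule) with a; [|apply Hg].
    exists (mkposreal 1 Rlt_0_1). intros y _. now apply RInt_correct_cont. }
  destruct Hd as [_ Hd]. intros eps He. assert (Hv := norm_ge_0 v).
  assert (Hp : 0 < eps / (1 + norm v)) by (apply Rdiv_lt_0_compat; lra).
  destruct (Hd x (fun P HP => HP) (mkposreal _ Hp)) as [d H1].
  exists d. split; [apply cond_pos|]. intros y Hy.
  rewrite Cmod_RtoC_minus, <- RtoC_minus in *. specialize (H1 y Hy).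
  norm_as V (scal (RtoC (RInt g a y - RInt g a x - (y - x) * g x) : C_AbsRing) v).
  + rewrite norm_scalC, Cmod_R.
    change (Rabs (RInt g a y - RInt g a x - (y - x) * g x)
      <= eps / (1 + norm v) * Rabs (y - x)) in H1.
    apply Rle_trans with (eps / (1 + norm v) * Rabs (y - x) * (1 + norm v)).
    * apply Rmult_le_compat; [apply Rabs_pos|easy|exact H1|lra].
    * right. field. lra.
- apply cont_scal; [now apply contC_RtoC|]. intros y. apply cont_const.
Qed.

Definition bump (s : R) : R := sin (PI * s) * sin (PI * s).

Lemma bump_cont N x : continuous (fun s => bump s ^ N) x.
Proof.
apply (@ex_derive_continuous R_AbsRing R_NormedModule). unfold bump. auto_derive. easy.
Qed.

Lemma bump_ge0 s : 0 <= bump s.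
Proof. unfold bump. nra. Qed.

Lemma bump_cos s : bump s = cos (PI * Rabs (s - 1 / 2)) * cos (PI * Rabs (s - 1 / 2)).
Proof.
unfold bump. replace (PI * s) with (PI * (s - 1 / 2) + PI / 2) by field.
rewrite sin_plus, cos_PI2, sin_PI2.
replace (cos (PI * Rabs (s - 1 / 2))) with (cos (PI * (s - 1 / 2))); [ring|].
unfold Rabs. destruct Rcase_abs; [|easy].
replace (PI * - (s - 1 / 2)) with (- (PI * (s - 1 / 2))) by ring. now rewrite cos_neg.
Qed.

Lemma cos_PI_decr x y : 0 <= x <= y -> y <= 1 / 2 -> 0 <= cos (PI * y) <= cos (PI * x).
Proof.
intros Hxy Hy. assert (Hpi := PI_RGT_0). split.
- apply cos_ge_0; nra.
- destruct (Req_dec x y) as [->|Hn]; [lra|]. left. apply cos_decreasing_1; nra.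
Qed.

Definition bump_mass (N : nat) : R := RInt (fun s => bump s ^ N) 0 1.

(** Only the window of half-width [d / 2] around the midpoint is counted; there [bump] is at least
    its value at the ends of the window. *)
Lemma bump_mass_ge (d : R) N :
  0 < d <= 1 / 2 -> d * (cos (PI * (d / 2)) * cos (PI * (d / 2))) ^ N <= bump_mass N.
Proof.
intros Hd. unfold bump_mass.
set (b := cos (PI * (d / 2)) * cos (PI * (d / 2))).
set (g := fun s => bump s ^ N).
assert (Hc : forall x, continuous g x) by apply bump_cont.
assert (Hg : forall x, 0 <= g x) by (intros x; apply pow_le, bump_ge0).
assert (Hex : forall x y, ex_RInt g x y).
{ intros x y. exists (RInt g x y). now apply RInt_correct_cont. }
rewrite <- (RInt_Chasles (V := R_CompleteNormedModule) g 0 (1 / 2 - d / 2) 1) by apply Hex.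
rewrite <- (RInt_Chasles (V := R_CompleteNormedModule) g (1 / 2 - d / 2) (1 / 2 + d / 2) 1) by apply Hex.
assert (H1 : 0 <= RInt g 0 (1 / 2 - d / 2)) by (apply RInt_ge_0; [lra|apply Hex|intros; apply Hg]).
assert (H2 : 0 <= RInt g (1 / 2 + d / 2) 1) by (apply RInt_ge_0; [lra|apply Hex|intros; apply Hg]).
assert (H3 : d * b ^ N <= RInt g (1 / 2 - d / 2) (1 / 2 + d / 2)).
{ apply Rle_trans with (RInt (fun _ => b ^ N) (1 / 2 - d / 2) (1 / 2 + d / 2)).
  - rewrite RInt_const. change (d * b ^ N <= (1 / 2 + d / 2 - (1 / 2 - d / 2)) * b ^ N).
    right. f_equal. field.
  - apply RInt_le; [lra|apply ex_RInt_const|apply Hex|]. intros x Hx. unfold g.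
    assert (Ha : Rabs (x - 1 / 2) <= d / 2) by (apply Rabs_le; lra).
    assert (H4 := cos_PI_decr (Rabs (x - 1 / 2)) (d / 2)
      ltac:(split; [apply Rabs_pos|exact Ha]) ltac:(lra)).
    apply pow_incr. split.
    + unfold b. nra.
    + rewrite bump_cos. unfold b. nra. }
change (d * b ^ N <= RInt g 0 (1 / 2 - d / 2)
  + (RInt g (1 / 2 - d / 2) (1 / 2 + d / 2) + RInt g (1 / 2 + d / 2) 1)).
lra.
Qed.

(** Laplace's method. At distance at least $d$ from the midpoint the bump is at most $a=\cos^2(\pi
    d)$, while the mass is at least $d\,b^N$ with $b=\cos^2(\pi d/2)>a$. The error is measured
    relative to the mass, since the bump is not normalized. *)
Lemma bump_concentrates (V : CompleteNormedModule C_AbsRing) (W : R -> V) eps :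
  cont W -> 0 < eps -> exists N, 0 < bump_mass N /\
    norm (VInt V (fun s => scal (RtoC (bump s ^ N) : C_AbsRing) (minus (W s) (W (1 / 2)))) 0 1)
      <= eps * bump_mass N.
Proof.
intros HW He.
assert (HD : cont (fun s => minus (W s) (W (1 / 2)))).
{ apply (cont_minus V); [easy|]. intros x. apply cont_const. }
destruct (cont_bounded V _ 0 1 HD) as [B [HB HB']].
destruct (HW (1 / 2) (eps / 2) ltac:(lra)) as [d0 [Hd0 Hd0']].
set (d := Rmin (d0 / 2) (1 / 2)).
assert (Hd : 0 < d <= 1 / 2) by (unfold d; split; [apply Rmin_glb_lt; lra|apply Rmin_r]).
assert (Hdd : d < d0) by (eapply Rle_lt_trans; [apply Rmin_l|lra]).
set (ca := cos (PI * d)). set (cb := cos (PI * (d / 2))).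
assert (Hpi := PI_RGT_0).
assert (Hab : 0 <= ca < cb).
{ split; [apply (cos_PI_decr d d); lra|]. apply cos_decreasing_1; nra. }
set (a := ca * ca). set (b := cb * cb).
assert (Hb : 0 < b) by (unfold b; nra).
assert (Ha : 0 <= a) by (unfold a; nra).
assert (Hr : Rabs (a / b) < 1).
{ rewrite Rabs_pos_eq by (apply Rdiv_le_0_compat; easy).
  apply Rlt_div_l; [easy|]. rewrite Rmult_1_l. unfold a, b. nra. }
(* This threshold amounts to $B a^N\le\frac{\varepsilon}{2}\,d\,b^N$, so the far part costs at most
   [eps / 2] times the mass. *)
destruct (pow_lt_1_zero (a / b) Hr (eps / 2 * d / B)) as [N HN].
{ repeat apply Rmult_lt_0_compat; try lra. now apply Rinv_0_lt_compat. }
specialize (HN N (Nat.le_refl _)). exists N.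
assert (HbN : 0 < b ^ N) by now apply pow_lt.
assert (Hm := bump_mass_ge d N Hd). fold cb in Hm. fold b in Hm.
split; [nra|].
assert (HaN : B * a ^ N <= eps / 2 * bump_mass N).
{ apply Rle_trans with (eps / 2 * (d * b ^ N)); [|apply Rmult_le_compat_l; lra].
  rewrite Rabs_pos_eq in HN by (apply pow_le, Rdiv_le_0_compat; easy).
  unfold Rdiv at 1 in HN. rewrite Rpow_mult_distr, pow_inv in HN.
  apply (Rmult_lt_compat_r (b ^ N * B)) in HN; [|nra].
  replace (a ^ N * / b ^ N * (b ^ N * B)) with (B * a ^ N) in HN by (field; lra).
  replace (eps / 2 * d / B * (b ^ N * B)) with (eps / 2 * (d * b ^ N)) in HN by (field; lra).
  lra. }
set (h := fun s => eps / 2 * bump s ^ N + B * a ^ N).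
assert (Hh : RInt h 0 1 = eps / 2 * bump_mass N + B * a ^ N).
{ apply is_RInt_unique. unfold h.
  replace (eps / 2 * bump_mass N + B * a ^ N)
    with (plus (scal (eps / 2) (bump_mass N)) (scal (1 - 0) (B * a ^ N)))
    by (change (eps / 2 * bump_mass N + (1 - 0) * (B * a ^ N) = eps / 2 * bump_mass N + B * a ^ N); ring).
  apply (@is_RInt_plus R_NormedModule).
  - apply (@is_RInt_scal R_NormedModule). apply RInt_correct_cont, bump_cont.
  - apply (@is_RInt_const R_NormedModule). }
eapply Rle_trans; [apply (VInt_le V _ h 0 1)|rewrite Hh; lra].
- lra.
- apply cont_scal; [|exact HD]. apply contC_RtoC, bump_cont.
- intros x. apply (@ex_derive_continuous R_AbsRing R_NormedModule). unfold h, bump. auto_derive. easy.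
- intros s Hs. rewrite (norm_scalC V), Cmod_R, Rabs_pos_eq by apply pow_le, bump_ge0.
  unfold h. assert (Hp : 0 <= bump s ^ N) by apply pow_le, bump_ge0.
  destruct (Rlt_dec (Rabs (s - 1 / 2)) d) as [Hl|Hl].
  + assert (E : norm (minus (W s) (W (1 / 2))) < eps / 2).
    { apply Hd0'. rewrite Cmod_RtoC_minus. lra. }
    assert (0 <= B * a ^ N) by (apply Rmult_le_pos; [lra|now apply pow_le]).
    apply Rle_trans with (bump s ^ N * (eps / 2)); [|lra].
    apply Rmult_le_compat_l; [easy|]. left. exact E.
  + assert (E := HB' s Hs). cbv beta in E.
    assert (Hs2 : Rabs (s - 1 / 2) <= 1 / 2) by (apply Rabs_le; lra).
    assert (H4 := cos_PI_decr d (Rabs (s - 1 / 2)) ltac:(lra) Hs2).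
    assert (Hq : bump s ^ N <= a ^ N).
    { apply pow_incr. split; [apply bump_ge0|]. rewrite bump_cos. unfold a, ca. nra. }
    apply Rle_trans with (a ^ N * B).
    * apply Rmult_le_compat; [easy|apply norm_ge_0|exact Hq|exact E].
    * assert (0 <= eps / 2 * bump s ^ N) by (apply Rmult_le_pos; lra). lra.
Qed.

(** * The weighted sum at the midpoint *)

Section Vanishing.

Variables (V : CompleteNormedModule C_AbsRing) (S : R -> V -> V).
Hypothesis HS : isometric_group S.
Variable f : V.
Variable eta : R.
Hypothesis eta_pos : 0 < eta.

Notation solv := (solvable V S f eta).
Notation samp := (sample V S f eta).
Notation part := (partial V S f eta).

Hypothesis Hexp : forall k : Z, solv (fun s => cis (2 * PI * IZR k * s)).

Lemma solvable_ext p q : (forall s, p s = q s) -> solv p -> solv q.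
Proof.
intros E [H [Hc HH]]. exists H. split; [easy|]. intros x Hx. rewrite HH by easy.
apply VInt_ext; [lra|]. intros s _. now rewrite E.
Qed.

Lemma solvable_comb (p q : R -> C) (a b : C) :
  contC p -> contC q -> solv p -> solv q -> solv (fun s => (a * p s + b * q s)%C).
Proof.
intros Hp Hq [H [Hc HH]] [H' [Hc' HH']].
exists (fun x => plus (scal (a : C_AbsRing) (H x)) (scal (b : C_AbsRing) (H' x))). split.
- intros x. apply cont_plus; apply cont_scal; try easy; apply contC_const.
- intros x Hx.
  assert (Hk : forall r, contC r ->
    cont (fun s => scal (r s * cis (x * (1 - s)) : C_AbsRing)%C (S s f))).
  { intros r Hr. apply cont_scal; [|apply (group_cont _ _ HS)]. apply contC_mult; [easy|].
    apply contC_lipschitz with (2 * Rabs x). intros u v. eapply Rle_trans; [apply cis_lip|].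
    replace (x * (1 - v) - x * (1 - u)) with (x * - (v - u)) by ring.
    rewrite Rabs_mult, Rabs_Ropp. right; ring. }
  rewrite (group_plus _ _ HS), !(group_scal _ _ HS).
  transitivity (plus
    (scal (a : C_AbsRing) (minus (scal (cis x : C_AbsRing) (H x)) (S 1 (H x))))
    (scal (b : C_AbsRing) (minus (scal (cis x : C_AbsRing) (H' x)) (S 1 (H' x)))));
    [vec V|].
  rewrite HH, HH' by easy.
  rewrite <- (VInt_scal V a _ 0 1 (Hk p Hp)), <- (VInt_scal V b _ 0 1 (Hk q Hq)).
  rewrite <- (VInt_plus V).
  + apply VInt_ext; [lra|]. intros s _. cbv beta. vec V.
  + apply cont_scal; [apply contC_const|now apply Hk].
  + apply cont_scal; [apply contC_const|now apply Hk].
Qed.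

(** As $\sin^2(\pi s)=\frac12-\frac14(e^{2\pi is}+e^{-2\pi is})$, one more factor [bump] mixes the
    frequencies $k$ and $k\pm1$; the induction therefore carries all [k] together. *)
Lemma solvable_bump N : forall k : Z, solv (fun s => (cis (2 * PI * IZR k * s) * RtoC (bump s ^ N))%C).
Proof.
assert (Hc : forall k N, contC (fun s => (cis (2 * PI * IZR k * s) * RtoC (bump s ^ N))%C)).
{ intros k M. apply contC_mult; [apply contC_cis|apply contC_RtoC, bump_cont]. }
induction N; intros k.
- apply solvable_ext with (2 := Hexp k). intros s. simpl. ring.
- refine (solvable_ext _ _ _ (solvable_comb _ _ (RtoC 1) (RtoC (-1 / 4))
    _ _ (solvable_comb _ _ (RtoC (1 / 2)) (RtoC (-1 / 4)) _ _ (IHN k) (IHN (k + 1)%Z))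
    (IHN (k - 1)%Z))); try apply Hc.
  + intros s. rewrite plus_IZR, minus_IZR.
    replace (2 * PI * (IZR k + 1) * s) with (2 * PI * IZR k * s + 2 * (PI * s)) by ring.
    replace (2 * PI * (IZR k - 1) * s) with (2 * PI * IZR k * s + - (2 * (PI * s))) by ring.
    rewrite !cis_plus.
    replace (RtoC (bump s ^ Datatypes.S N))
      with (RtoC (bump s ^ N) * (RtoC (1 / 2) + RtoC (-1 / 4) * (cis (2 * (PI * s)) + cis (- (2 * (PI * s))))))%C.
    * ring.
    * simpl pow. rewrite RtoC_mult, Cmult_comm. f_equal. unfold bump.
      apply C_eq; simpl; rewrite cos_neg, sin_neg, cos_2a_sin; field.
  + apply contC_plus; apply contC_mult; try apply contC_const; apply Hc.
Qed.

(** The fourth-order decay is deliberately weakened to second order, which already lets the tails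
    telescope through $1/(m+1)^2\le1/m-1/(m+1)$. The full rate is used only for the weights of the
    local inverse. *)
Lemma osc4_decay t n : 1 <= n -> n <= Rabs t -> Cmod (osc4 eta t) <= / eta ^ 4 * / (n * n).
Proof.
intros Hn Ht. assert (H0 : t <> 0) by (intros ->; rewrite Rabs_R0 in Ht; lra).
assert (H := osc_decay eta eta_pos t H0).
assert (Hi : / (eta * Rabs t) <= / eta * / n).
{ rewrite <- Rinv_mult. apply Rinv_le_contravar; nra. }
unfold osc4. rewrite !Cmod_mult.
set (o := Cmod (osc eta t)) in *. assert (Ho : 0 <= o) by apply Cmod_ge_0.
set (r := / eta * / n) in *.
assert (Hr : 0 < r) by (apply Rmult_lt_0_compat; apply Rinv_0_lt_compat; lra).
apply Rle_trans with (r * r * (r * r)).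
- assert (o * o <= r * r) by nra. apply Rmult_le_compat; nra.
- unfold r. replace (/ eta * / n * (/ eta * / n) * (/ eta * / n * (/ eta * / n)))
    with (/ eta ^ 4 * (/ (n * n) * / (n * n))) by (field; lra).
  apply Rmult_le_compat_l; [left; apply Rinv_0_lt_compat, pow_lt; easy|].
  assert (/ (n * n) <= 1). { rewrite <- Rinv_1. apply Rinv_le_contravar; nra. }
  assert (0 < / (n * n)) by (apply Rinv_0_lt_compat; nra). nra.
Qed.

Lemma sample_pair_bound n s :
  (1 <= n)%nat -> 0 <= s <= 1 ->
  norm (plus (samp (INR n) s) (samp (- INR n - 1) s))
    <= 2 * / eta ^ 4 * norm f * / (INR n * INR n).
Proof.
intros Hn Hs. apply le_INR in Hn. simpl in Hn.
eapply Rle_trans; [apply (norm_plus_le V)|]. unfold sample.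
rewrite !(norm_scalC V), !(group_norm _ _ HS).
assert (H1 := osc4_decay (INR n + s) (INR n) Hn ltac:(rewrite Rabs_pos_eq; lra)).
assert (H2 := osc4_decay (- INR n - 1 + s) (INR n) Hn ltac:(rewrite Rabs_left1; lra)).
assert (Hf := norm_ge_0 f). nra.
Qed.

Lemma partial_tail s M L :
  (1 <= M)%nat -> (M <= L)%nat -> 0 <= s <= 1 ->
  norm (minus (part L s) (part M s)) <= 2 * / eta ^ 4 * norm f * (/ INR M - / INR L).
Proof.
intros HM HL Hs. induction HL.
- rewrite (minus_eq_zero (G := V)), norm_zeroC. lra.
- rewrite partial_S.
  norm_as V (plus (minus (part m s) (part M s))
    (plus (samp (INR (Datatypes.S m)) s) (samp (- INR (Datatypes.S m) - 1) s))).
  eapply Rle_trans; [apply (norm_plus_le V)|].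
  eapply Rle_trans; [apply Rplus_le_compat; [exact IHHL|apply sample_pair_bound; [lia|easy]]|].
  assert (H1 : 1 <= INR m) by (apply (le_INR 1); lia). rewrite S_INR.
  assert (Hc : 0 <= 2 * / eta ^ 4 * norm f).
  { apply Rmult_le_pos; [|apply norm_ge_0]. apply Rmult_le_pos; [lra|].
    left; apply Rinv_0_lt_compat, pow_lt; easy. }
  rewrite <- Rmult_plus_distr_l. apply Rmult_le_compat_l; [easy|].
  assert (HM1 : 1 <= INR M) by (apply (le_INR 1); lia).
  replace (/ INR M - / (INR m + 1)) with (/ INR M - / INR m + (/ INR m * / (INR m + 1)))
    by (field; lra).
  apply Rplus_le_compat_l. rewrite <- Rinv_mult. apply Rinv_le_contravar; nra.
Qed.

(** The order of choices is the point: [M] first, making the tails small uniformly in $s\in[0,1]$;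
    then [N], concentrating the bump for the single continuous function [part M]; finally [L], for
    which the bump of exponent [N] is a fixed weight. No estimate uniform in [N] or in the frequency
    is needed. *)
Lemma partial_half eps :
  0 < eps -> exists L0, forall L, (L0 <= L)%nat -> norm (part L (1 / 2)) <= eps.
Proof.
intros He.
set (c := 2 * / eta ^ 4 * norm f).
assert (Hc : 0 <= c).
{ apply Rmult_le_pos; [|apply norm_ge_0]. apply Rmult_le_pos; [lra|].
  left; apply Rinv_0_lt_compat, pow_lt; easy. }
destruct (INR_unbounded (c / (eps / 3))) as [M0 HM0].
exists (Datatypes.S M0). intros M HM.
assert (HMc : c * / INR M <= eps / 3).
{ assert (Hp : 1 <= INR M) by (apply (le_INR 1); lia).
  assert (HM' : INR M0 <= INR M) by (apply le_INR; lia).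
  apply Rmult_le_reg_r with (INR M); [lra|]. rewrite Rmult_assoc, Rinv_l by lra.
  apply (Rmult_lt_compat_r (eps / 3)) in HM0; [|lra].
  replace (c / (eps / 3) * (eps / 3)) with c in HM0 by (field; lra). nra. }
assert (Htail : forall L s, (M <= L)%nat -> 0 <= s <= 1 ->
  norm (minus (part L s) (part M s)) <= eps / 3).
{ intros L s HL Hs. eapply Rle_trans; [apply partial_tail; [lia|easy|easy]|]. fold c.
  assert (0 < / INR L) by (apply Rinv_0_lt_compat, lt_0_INR; lia). nra. }
assert (HpM := cont_partial V S HS f eta eta_pos M).
destruct (bump_concentrates V (part M) (eps / 3) HpM ltac:(lra)) as [N [HI HN]].
set (I := bump_mass N) in *.
assert (Hb : contC (fun s => RtoC (bump s ^ N))) by apply contC_RtoC, bump_cont.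
assert (Hsol : solv (fun s => RtoC (bump s ^ N))).
{ apply solvable_ext with (2 := solvable_bump N 0%Z). intros s.
  replace (2 * PI * 0 * s) with 0 by ring. rewrite cis_0. ring. }
destruct (solvable_partial V S HS f eta eta_pos _ (eps / 3 * I) Hb Hsol ltac:(nra)) as [L0 HL0].
set (L := max L0 M). specialize (HL0 L ltac:(lia)).
assert (HpL := cont_partial V S HS f eta eta_pos L).
assert (D1 : cont (fun s => minus (part L s) (part M s))) by now apply (cont_minus V).
assert (D2 : cont (fun s => minus (part M s) (part M (1 / 2)))).
{ apply (cont_minus V); [easy|]. intros x. apply cont_const. }
assert (H2 : norm (VInt V (fun s => scal (RtoC (bump s ^ N) : C_AbsRing)
    (minus (part L s) (part M s))) 0 1) <= eps / 3 * I).
{ replace (eps / 3 * I) with (RInt (fun s => eps / 3 * bump s ^ N) 0 1).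
  - apply VInt_le; [lra|now apply cont_scal| |].
    + intros x. apply (@ex_derive_continuous R_AbsRing R_NormedModule). unfold bump. auto_derive. easy.
    + intros s Hs. rewrite (norm_scalC V), Cmod_R, Rabs_pos_eq by apply pow_le, bump_ge0.
      rewrite Rmult_comm. apply Rmult_le_compat_r; [apply pow_le, bump_ge0|].
      apply Htail; [lia|easy].
  - apply is_RInt_unique. apply (@is_RInt_scal R_NormedModule). apply RInt_correct_cont, bump_cont. }
(* Three errors, each at most [eps / 3 * I]: the telescoped integral for [L], the tail between [M]
   and [L], and the oscillation of [part M] near the midpoint. The mass [I] cancels at the end. *)
assert (E : scal (RtoC I : C_AbsRing) (part M (1 / 2))
  = minus (minus (VInt V (fun s => scal (RtoC (bump s ^ N) : C_AbsRing) (part L s)) 0 1)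
      (VInt V (fun s => scal (RtoC (bump s ^ N) : C_AbsRing) (minus (part L s) (part M s))) 0 1))
      (VInt V (fun s => scal (RtoC (bump s ^ N) : C_AbsRing) (minus (part M s) (part M (1 / 2)))) 0 1)).
{ unfold I, bump_mass.
  rewrite <- (VInt_scal_const V (fun s => bump s ^ N)) by (apply bump_cont || lra).
  assert (C1 := cont_scal V _ _ Hb HpL). assert (C2 := cont_scal V _ _ Hb D1).
  assert (C3 := cont_scal V _ _ Hb D2).
  assert (C12 := cont_minus V _ _ C1 C2).
  refine (eq_trans _ (f_equal (fun a => minus a _) (VInt_minus V _ _ 0 1 C1 C2))).
  refine (eq_trans _ (VInt_minus V _ _ 0 1 C12 C3)).
  apply VInt_ext; [lra|]. intros s _. cbv beta. vec V. }
apply Rmult_le_reg_l with I; [easy|].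
apply Rle_trans with (norm (scal (RtoC I : C_AbsRing) (part M (1 / 2)))).
{ rewrite (norm_scalC V), Cmod_R, Rabs_pos_eq by lra. lra. }
rewrite E.
eapply Rle_trans; [apply (norm_minus_le V)|].
eapply Rle_trans; [apply Rplus_le_compat; [apply (norm_minus_le V)|exact HN]|].
eapply Rle_trans; [apply Rplus_le_compat_r, Rplus_le_compat; [exact HL0|exact H2]|]. lra.
Qed.

End Vanishing.

(** * Local resolvents *)

Section Limits.

Variable V : NormedModule C_AbsRing.

Lemma seq_lim_plus (u v : nat -> V) l m :
  seq_lim u l -> seq_lim v m -> seq_lim (fun n => plus (u n) (v n)) (plus l m).
Proof.
intros Hu Hv eps He.
destruct (Hu (eps / 2)) as [N HN]; [lra|]. destruct (Hv (eps / 2)) as [N' HN']; [lra|].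
exists (max N N'). intros n Hn. specialize (HN n ltac:(lia)). specialize (HN' n ltac:(lia)).
rewrite (minus_plus_plus (G := V)). eapply Rle_lt_trans; [apply norm_plus_le|]. lra.
Qed.

Lemma seq_lim_linear (W : NormedModule C_AbsRing) (L : V -> W) (u : nat -> V) l :
  is_linear L -> seq_lim u l -> seq_lim (fun n => L (u n)) (L l).
Proof.
intros HL Hu eps He. destruct (linear_norm L HL) as [M [HM HM']].
destruct (Hu (eps / M)) as [N HN]; [now apply Rdiv_lt_0_compat|].
exists N. intros n Hn. specialize (HN n Hn).
rewrite <- (linear_minus L _ _ HL). eapply Rle_lt_trans; [apply HM'|].
apply (Rmult_lt_compat_l M) in HN; [|easy].
replace (M * (eps / M)) with eps in HN by (field; lra). exact HN.
Qed.

Lemma seq_lim_ext (u v : nat -> V) l : (forall n, u n = v n) -> seq_lim u l -> seq_lim v l.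
Proof.
intros E H eps He. destruct (H eps He) as [N HN]. exists N. intros n Hn.
rewrite <- E. now apply HN.
Qed.

Lemma seq_lim_S (u : nat -> V) l : seq_lim u l -> seq_lim (fun n => u (S n)) l.
Proof.
intros H eps He. destruct (H eps He) as [N HN]. exists N. intros n Hn. apply HN. lia.
Qed.

Lemma seq_lim_const (l : V) : seq_lim (fun _ => l) l.
Proof.
intros eps He. exists 0%nat. intros n _. rewrite (minus_eq_zero (G := V)), norm_zeroC. exact He.
Qed.

End Limits.

Section Neumann.

Variable V : CompleteNormedModule C_AbsRing.

Lemma neumann (T : V -> V) q y :
  is_linear T -> 0 <= q < 1 -> (forall x, norm (T x) <= q * norm x) ->
  exists x, minus x (T x) = y.
Proof.
intros HT Hq HTq.
set (a := fun n => Nat.iter n T y).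
assert (Ha : forall n, norm (a n) <= norm y * q ^ n).
{ induction n; simpl; [lra|]. eapply Rle_trans; [apply HTq|].
  apply (Rmult_le_compat_l q) in IHn; [|lra]. unfold a in *. lra. }
destruct (@ex_series_le C_AbsRing V a (fun n => norm y * q ^ n) Ha) as [x Hx].
{ apply (@ex_series_scal R_AbsRing R_NormedModule). apply ex_series_geom.
  rewrite Rabs_pos_eq; lra. }
apply is_series_seq_lim in Hx. exists x.
assert (E : forall n, sum_n a (S n) = plus y (T (sum_n a n))).
{ induction n.
  - rewrite sum_Sn, !sum_O. reflexivity.
  - rewrite sum_Sn. rewrite IHn at 1. rewrite (sum_Sn a n), (linear_plus T HT).
    change (a (S (S n))) with (T (a (S n))). vec V. }
assert (H : x = plus y (T x)).
{ apply (seq_lim_unique V (fun n => sum_n a (S n))).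
  - now apply seq_lim_S.
  - apply seq_lim_ext with (fun n => plus y (T (sum_n a n))); [intros n; now rewrite E|].
    apply (seq_lim_plus V); [apply seq_lim_const|]. now apply (seq_lim_linear V V T). }
rewrite H at 1. vec V.
Qed.

(* A bounded operator that commutes with [L] and inverts [z0 - L] at the single vector [f]
   already yields the local resolvent of [L] at [f] near [z0]. *)
Lemma local_resolvent (L T : V -> V) (z0 : C) (f : V) :
  is_linear L -> is_linear T -> (forall x, T (L x) = L (T x)) ->
  minus (scal (z0 : C_AbsRing) (T f)) (L (T f)) = f ->
  exists (r : R) (h : C -> V), 0 < r /\ forall z, Cmod (z - z0) < r ->
    minus (scal (z : C_AbsRing) (h z)) (L (h z)) = f /\ @ex_derive C_AbsRing V h z.
Proof.
intros HL HT Hcomm Hf. destruct (linear_norm T HT) as [M [HM HMT]].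
(* The candidate is $h(z)=(1-(z_0-z)T)^{-1}Tf$, the usual expansion of a resolvent with [T] in place
   of the missing inverse of $z_0-L$. The radius [/ (2 * M)] makes [N z] a contraction with factor
   1/2. *)
set (N := fun (z : C) (x : V) => scal (Cminus z0 z : C_AbsRing) (T x)).
assert (HN : forall z, is_linear (N z)).
{ intros z. split.
  - intros x y. unfold N. rewrite (linear_plus T HT). vec V.
  - intros k x. unfold N. rewrite (linear_scal T HT). vec V.
  - exists ((1 + Cmod (z0 - z)) * M). assert (H := Cmod_ge_0 (z0 - z)). split; [nra|].
    intros x. unfold N. rewrite (norm_scalC V). specialize (HMT x).
    assert (H0 := norm_ge_0 (T x)). assert (H1 := norm_ge_0 x). nra. }
assert (HNb : forall z, Cmod (z - z0) < / (2 * M) -> forall x, norm (N z x) <= 1 / 2 * norm x).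
{ intros z Hz x. unfold N. rewrite (norm_scalC V).
  replace (Cmod (z0 - z)) with (Cmod (z - z0)) by (rewrite <- Cmod_opp; f_equal; ring).
  apply Rle_trans with (/ (2 * M) * (M * norm x)); [|right; field; lra].
  apply Rmult_le_compat; [apply Cmod_ge_0|apply norm_ge_0|lra|apply HMT]. }
assert (Hinj : forall z, Cmod (z - z0) < / (2 * M) -> forall x,
  norm x <= 2 * norm (minus x (N z x))).
{ intros z Hz x. assert (H := norm_le_minus V x (N z x)). specialize (HNb z Hz x).
  lra. }
assert (Hsol : forall z y, Cmod (z - z0) < / (2 * M) -> exists x, minus x (N z x) = y).
{ intros z y Hz. apply (neumann (N z) (1 / 2)); [easy|lra|now apply HNb]. }
set (h := (fun z => epsilon (inhabits zero) (fun x : V => minus x (N z x) = T f)) : C -> V).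
assert (Hh : forall z, Cmod (z - z0) < / (2 * M) -> minus (h z) (N z (h z)) = T f).
{ intros z Hz. unfold h. apply epsilon_spec. now apply Hsol. }
exists (/ (2 * M)), h. split; [apply Rinv_0_lt_compat; lra|]. intros z Hz. split.
(* [A] is $(z_0-L)T$, which fixes $f$ but need not be the identity. It commutes with [T], hence
   fixes $Tf$, and by uniqueness for $1-N_z$ it also fixes $h(z)$; this is the place where
   commutation is needed. *)
- set (A := (fun x => minus (scal (z0 : C_AbsRing) (T x)) (L (T x))) : V -> V).
  assert (HA : A (h z) = h z).
  { apply (minus_zero_eq V). apply (norm_eq_zero (V := V)).
    apply Rle_antisym; [|apply norm_ge_0].
    eapply Rle_trans; [apply (Hinj z Hz)|].
    assert (E0 : minus (minus (A (h z)) (h z)) (N z (minus (A (h z)) (h z))) = zero).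
    2:{ apply Rle_trans with (2 * 0); [|lra]. apply Rmult_le_compat_l; [lra|right].
      etransitivity; [exact (f_equal (@norm C_AbsRing V) E0)|apply (norm_zeroC V)]. }
    { assert (E := Hh z Hz). apply (f_equal A) in E.
      assert (Ef : A (T f) = T f).
      { transitivity (T (A f)); [|unfold A; now rewrite Hf].
        unfold A. rewrite (linear_minus T _ _ HT), (linear_scal T HT), Hcomm. reflexivity. }
      rewrite Ef, <- (Hh z Hz) in E. revert E. unfold A, N.
      rewrite !(linear_minus T _ _ HT), !(linear_scal T HT), !(linear_minus L _ _ HL),
        !(linear_scal L HL), !Hcomm.
      intros E. symmetry. apply (minus_zero_eq V).
      apply (f_equal (fun a => minus a
        (minus (h z) (scal (Cminus z0 z : C_AbsRing) (T (h z)))))) in E.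
      rewrite (minus_eq_zero (G := V)) in E. rewrite <- E. vec V. } }
  assert (E := Hh z Hz).
  assert (E1 : h z = plus (T f) (N z (h z))) by (rewrite <- E; vec V).
  assert (E2 : minus (scal (z0 : C_AbsRing) (h z)) (L (h z))
    = plus f (scal (Cminus z0 z : C_AbsRing) (A (h z)))).
  { rewrite E1 at 1 2. rewrite (linear_plus L HL). unfold N. rewrite (linear_scal L HL).
    rewrite <- Hf at 3. unfold A. vec V. }
  rewrite HA in E2.
  transitivity (minus (minus (scal (z0 : C_AbsRing) (h z)) (L (h z)))
    (scal (Cminus z0 z : C_AbsRing) (h z))); [vec V|]. rewrite E2. vec V.
(* Differentiating $h-(z_0-z)Th=Tf$ formally gives $(1-N_z)h'=-Th$, and [d] is defined by this
   equation. *)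
- destruct (Hsol z (opp (T (h z))) Hz) as [d Hd]. exists d.
  apply diff_is_deriveC.
  apply diff_quad with (K := 2 * norm (T d)) (rho := (/ (2 * M) - Cmod (z - z0)) / 2); [lra|].
  intros w Hw.
  assert (Hw0 : Cmod (w - z0) < / (2 * M)).
  { replace (w - z0)%C with ((w - z) + (z - z0))%C by ring.
    eapply Rle_lt_trans; [apply Cmod_triangle|]. assert (H := Cmod_ge_0 (w - z)). lra. }
  eapply Rle_trans; [apply (Hinj w Hw0)|].
  (* The first-order remainder, multiplied by $1-N_w$, is exactly $-(w-z)^2Td$, because
     $N_z-N_w=(w-z)T$. *)
  assert (E0 : minus (minus (minus (h w) (h z)) (scal (Cminus w z : C_AbsRing) d))
      (N w (minus (minus (h w) (h z)) (scal (Cminus w z : C_AbsRing) d)))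
    = scal (- ((w - z) * (w - z)) : C_AbsRing)%C (T d)).
  2:{ eapply Rle_trans;
        [apply Rmult_le_compat_l; [lra|right; exact (f_equal (@norm C_AbsRing V) E0)]|].
      rewrite (norm_scalC V), Cmod_opp, Cmod_mult. right; ring. }
  { assert (Ew := Hh w Hw0). assert (Ez := Hh z Hz).
    rewrite !(linear_minus (N w) _ _ (HN w)), (linear_scal (N w) (HN w)).
    assert (Ew' : h w = plus (T f) (N w (h w))) by (rewrite <- Ew; vec V).
    assert (Ez' : h z = plus (T f) (N z (h z))) by (rewrite <- Ez; vec V).
    assert (Ed' : d = minus (N z d) (T (h z))).
    { replace d with (plus (minus d (N z d)) (N z d)) at 1 by vec V. rewrite Hd. vec V. }
    symmetry. transitivity (minus (minus (minus (plus (T f) (N w (h w))) (plus (T f) (N z (h z))))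
      (scal (Cminus w z : C_AbsRing) (minus (N z d) (T (h z)))))
      (minus (minus (N w (h w)) (N w (h z))) (scal (Cminus w z : C_AbsRing) (N w d)))).
    * unfold N. vec V.
    * now rewrite <- Ew', <- Ez', <- Ed'. }
Qed.

End Neumann.

(** * Inverting [1 - S 1] at a single vector *)

Section Weights.

Variable eta : R.
Hypothesis eta_pos : 0 < eta.

Definition weight (n : nat) : R :=
  (sin (eta * (INR n + 1 / 2)) / (eta * (INR n + 1 / 2))) ^ 4.

Lemma weight_ge0 n : 0 <= weight n.
Proof.
unfold weight. set (x := sin _ / _). replace (x ^ 4) with ((x * x) * (x * x)) by ring. nra.
Qed.

Lemma osc4_weight n : osc4 eta (INR n + 1 / 2) = RtoC (weight n).
Proof.
assert (H := pos_INR n). unfold osc4. rewrite osc_sinc by (easy || lra).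
unfold weight. rewrite <- !RtoC_mult. f_equal. ring.
Qed.

Lemma osc4_weight_opp n : osc4 eta (- INR n - 1 + 1 / 2) = RtoC (weight n).
Proof.
assert (H := pos_INR n). unfold osc4. rewrite osc_sinc by (easy || lra).
unfold weight. rewrite <- !RtoC_mult. f_equal.
replace (- INR n - 1 + 1 / 2) with (- (INR n + 1 / 2)) by field.
rewrite Ropp_mult_distr_r_reverse, sin_neg.
replace (- sin (eta * (INR n + 1 / 2)) / - (eta * (INR n + 1 / 2)))
  with (sin (eta * (INR n + 1 / 2)) / (eta * (INR n + 1 / 2))) by (field; lra).
ring.
Qed.

(** A telescoping bound for [weight n] times the $2n+1$ translates in [tel n]. With $x=n+\frac12$
    that product is at most $2/(\eta^4x^3)$, and $x^3\ge(n+1)(n+2)/16$, with equality at $n=0$; this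
    gives 32. *)
Definition majorant (n : nat) : R := 32 / eta ^ 4 * (/ (INR n + 1) - / (INR n + 2)).

Lemma weight_majorant n : weight n * (2 * INR n + 1) <= majorant n.
Proof.
assert (H := pos_INR n). unfold weight, majorant.
set (x := INR n + 1 / 2). replace (2 * INR n + 1) with (2 * x) by (unfold x; field).
assert (Hx : 0 < x) by (unfold x; lra).
assert (He : 0 < eta ^ 4) by now apply pow_lt.
set (s := sin (eta * x)).
assert (Hs : s ^ 4 <= 1).
{ assert (B := SIN_bound (eta * x)). fold s in B.
  replace (s ^ 4) with ((s * s) * (s * s)) by ring. assert (s * s <= 1) by nra. nra. }
unfold Rdiv at 1. rewrite Rpow_mult_distr, pow_inv, Rpow_mult_distr.
apply Rle_trans with (1 * / (eta ^ 4 * x ^ 4) * (2 * x)).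
- apply Rmult_le_compat_r; [lra|]. apply Rmult_le_compat_r; [|exact Hs].
  left. apply Rinv_0_lt_compat, Rmult_lt_0_compat; [easy|now apply pow_lt].
- replace (1 * / (eta ^ 4 * x ^ 4) * (2 * x)) with (/ eta ^ 4 * (2 * / (x * x * x))) by (field; lra).
  replace (32 / eta ^ 4 * (/ (INR n + 1) - / (INR n + 2)))
    with (/ eta ^ 4 * (2 * / ((INR n + 1) * (INR n + 2) / 16))) by (field; lra).
  apply Rmult_le_compat_l; [left; now apply Rinv_0_lt_compat|].
  apply Rmult_le_compat_l; [lra|]. apply Rinv_le_contravar.
  + nra.
  + replace (INR n) with (x - 1 / 2) by (unfold x; field).
    assert (Hx2 : 1 / 2 <= x) by (unfold x; lra). nra.
Qed.

Lemma sum_majorant N : sum_n majorant N = 32 / eta ^ 4 * (1 - / (INR N + 2)).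
Proof.
assert (He : 0 < eta ^ 4) by now apply pow_lt.
induction N.
- rewrite sum_O. unfold majorant. simpl. field. lra.
- rewrite sum_Sn, IHN. unfold majorant. rewrite S_INR.
  assert (H := pos_INR N).
  change (32 / eta ^ 4 * (1 - / (INR N + 2)) + 32 / eta ^ 4 * (/ (INR N + 1 + 1) - / (INR N + 1 + 2))
    = 32 / eta ^ 4 * (1 - / (INR N + 1 + 2))).
  field. lra.
Qed.

Lemma majorant_bound N : sum_n majorant N <= 32 / eta ^ 4.
Proof.
assert (He : 0 < eta ^ 4) by now apply pow_lt.
rewrite sum_majorant. assert (H := pos_INR N).
assert (0 < 32 / eta ^ 4) by (apply Rdiv_lt_0_compat; lra).
assert (0 < / (INR N + 2)) by (apply Rinv_0_lt_compat; lra). nra.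
Qed.

Lemma ex_series_majorant : ex_series majorant.
Proof.
assert (He : 0 < eta ^ 4) by now apply pow_lt.
exists (32 / eta ^ 4).
enough (H : is_lim_seq (sum_n majorant) (32 / eta ^ 4)) by exact H.
apply (is_lim_seq_ext (fun N => 32 / eta ^ 4 * (1 - / (INR N + 2)))).
- intros N. symmetry. apply sum_majorant.
- replace (Finite (32 / eta ^ 4)) with (Rbar_mult (32 / eta ^ 4) (1 - 0))
    by (simpl; f_equal; ring).
  apply is_lim_seq_scal_l. apply is_lim_seq_minus'; [apply is_lim_seq_const|].
  replace (Finite 0) with (Rbar_inv p_infty) by easy.
  apply is_lim_seq_inv; [|easy].
  apply (is_lim_seq_plus _ _ p_infty 2); [apply is_lim_seq_INR|apply is_lim_seq_const|easy].
Qed.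

End Weights.

Section Telescoping.

Variables (V : CompleteNormedModule C_AbsRing) (S : R -> V -> V).
Hypothesis HS : isometric_group S.

(* Formally [(2 - S n - S (- n - 1)) / (1 - S 1)]. *)
Fixpoint tel (n : nat) (x : V) : V :=
  match n with
  | O => opp (S (-1) x)
  | Datatypes.S m => plus (tel m x) (minus (S (INR m) x) (S (- INR m - 2) x))
  end.

Lemma tel_plus n x y : tel n (plus x y) = plus (tel n x) (tel n y).
Proof.
induction n; simpl; rewrite ?IHn, !(group_plus _ _ HS); vec V.
Qed.

Lemma tel_scal n (c : C) x : tel n (scal (c : C_AbsRing) x) = scal (c : C_AbsRing) (tel n x).
Proof.
induction n; simpl; rewrite ?IHn, !(group_scal _ _ HS); vec V.
Qed.

Lemma tel_group n t x : tel n (S t x) = S t (tel n x).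
Proof.
induction n; simpl.
- rewrite (group_comm V S HS).
  transitivity (S t (scal (opp one : C_AbsRing) (S (-1) x))).
  + rewrite (group_scal _ _ HS). vec V.
  + f_equal. vec V.
- rewrite IHn, (group_plus _ _ HS), (group_minus V S HS).
  now rewrite (group_comm V S HS (INR n)), (group_comm V S HS (- INR n - 2)).
Qed.

Lemma tel_norm n x : norm (tel n x) <= (2 * INR n + 1) * norm x.
Proof.
induction n.
- simpl. rewrite (norm_opp (V := V)), (group_norm _ _ HS). lra.
- rewrite S_INR. simpl tel. eapply Rle_trans; [apply (norm_plus_le V)|].
  eapply Rle_trans; [apply Rplus_le_compat; [exact IHn|apply (norm_minus_le V)]|].
  rewrite !(group_norm _ _ HS). lra.
Qed.

Lemma tel_eq n x :
  minus (tel n x) (S 1 (tel n x)) = minus (minus (scal (RtoC 2 : C_AbsRing) x) (S (INR n) x)) (S (- INR n - 1) x).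
Proof.
induction n.
- simpl. replace (opp (S (-1) x)) with (scal (opp one : C_AbsRing) (S (-1) x)) by vec V.
  rewrite (group_scal _ _ HS), <- (group_add _ _ HS).
  replace (1 + -1) with 0 by ring. rewrite (group_0 _ _ HS).
  replace (-0 - 1) with (-1) by ring. vec V.
- simpl tel. rewrite (group_plus _ _ HS), (group_minus V S HS), <- !(group_add _ _ HS), S_INR.
  replace (1 + (- INR n - 2)) with (- INR n - 1) by ring.
  replace (- (INR n + 1) - 1) with (- INR n - 2) by ring. rewrite (Rplus_comm 1).
  transitivity (plus (minus (tel n x) (S 1 (tel n x)))
    (minus (minus (S (INR n) x) (S (- INR n - 2) x)) (minus (S (INR n + 1) x) (S (- INR n - 1) x))));
    [vec V|]. rewrite IHn. vec V.
Qed.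

Variable f : V.
Variable eta : R.
Hypothesis eta_pos : 0 < eta.
Hypothesis eta_le1 : eta <= 1.

Definition tel_sum (N : nat) (x : V) : V :=
  sum_n (fun n => scal (RtoC (weight eta n) : C_AbsRing) (tel n x)) N.

Lemma tel_sum_0 x : tel_sum 0 x = scal (RtoC (weight eta 0) : C_AbsRing) (tel 0 x).
Proof. apply sum_O. Qed.

Lemma tel_sum_S N x : tel_sum (Datatypes.S N) x = plus (tel_sum N x)
  (scal (RtoC (weight eta (Datatypes.S N)) : C_AbsRing) (tel (Datatypes.S N) x)).
Proof. apply sum_Sn. Qed.

Lemma tel_term_norm n x :
  norm (scal (RtoC (weight eta n) : C_AbsRing) (tel n x)) <= majorant eta n * norm x.
Proof.
rewrite (norm_scalC V), Cmod_R, Rabs_pos_eq by apply weight_ge0.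
apply Rle_trans with (weight eta n * ((2 * INR n + 1) * norm x)).
- apply Rmult_le_compat_l; [apply weight_ge0|apply tel_norm].
- rewrite <- Rmult_assoc. apply Rmult_le_compat_r; [apply norm_ge_0|now apply weight_majorant].
Qed.

Lemma tel_sum_lim x : exists l, seq_lim (fun N => tel_sum N x) l.
Proof.
destruct (@ex_series_le C_AbsRing V (fun n => scal (RtoC (weight eta n) : C_AbsRing) (tel n x))
  (fun n => majorant eta n * norm x)) as [l Hl].
- intros n. apply tel_term_norm.
- apply ex_series_scal_r. now apply ex_series_majorant.
- exists l. now apply is_series_seq_lim in Hl.
Qed.

Lemma tel_sum_plus N x y : tel_sum N (plus x y) = plus (tel_sum N x) (tel_sum N y).
Proof.
unfold tel_sum. induction N; [rewrite !sum_O|rewrite !sum_Sn, IHN];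
  rewrite tel_plus; vec V.
Qed.

Lemma tel_sum_scal N (c : C) x : tel_sum N (scal (c : C_AbsRing) x) = scal (c : C_AbsRing) (tel_sum N x).
Proof.
unfold tel_sum. induction N; [rewrite !sum_O|rewrite !sum_Sn, IHN];
  rewrite tel_scal; vec V.
Qed.

Lemma tel_sum_group N t x : tel_sum N (S t x) = S t (tel_sum N x).
Proof.
unfold tel_sum. induction N; [rewrite !sum_O|rewrite !sum_Sn, IHN];
  rewrite tel_group, ?(group_plus _ _ HS), (group_scal _ _ HS); reflexivity.
Qed.

Lemma tel_sum_norm N x : norm (tel_sum N x) <= 32 / eta ^ 4 * norm x.
Proof.
apply Rle_trans with (sum_n (majorant eta) N * norm x).
- unfold tel_sum. induction N; [rewrite !sum_O; apply tel_term_norm|].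
  rewrite !sum_Sn. eapply Rle_trans; [apply (norm_plus_le V)|].
  eapply Rle_trans; [apply Rplus_le_compat; [exact IHN|apply tel_term_norm]|].
  right. symmetry. apply Rmult_plus_distr_r.
- apply Rmult_le_compat_r; [apply norm_ge_0|now apply majorant_bound].
Qed.

(** The shift by $-1/2$ brings the half-integer times of [sample] back to integers, and the factor 2
    counts the two equal weights of a pair. The identity holds for every [x]; only at [f] does the
    last term become small. *)
Lemma tel_sum_eq N x :
  minus (tel_sum N x) (S 1 (tel_sum N x))
  = minus (scal (RtoC (2 * sum_n (weight eta) N) : C_AbsRing) x)
      (S (- (1 / 2)) (partial V S x eta N (1 / 2))).
Proof.
assert (Hpair : forall n, S (- (1 / 2)) (plus (sample V S x eta (INR n) (1 / 2))
    (sample V S x eta (- INR n - 1) (1 / 2)))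
  = scal (RtoC (weight eta n) : C_AbsRing) (plus (S (INR n) x) (S (- INR n - 1) x))).
{ intros n. unfold sample. rewrite osc4_weight, osc4_weight_opp by easy.
  rewrite (group_plus _ _ HS), !(group_scal _ _ HS), <- !(group_add _ _ HS).
  replace (- (1 / 2) + (INR n + 1 / 2)) with (INR n) by ring.
  replace (- (1 / 2) + (- INR n - 1 + 1 / 2)) with (- INR n - 1) by ring. vec V. }
induction N.
- rewrite partial_0, Hpair, tel_sum_0, sum_O, (group_scal _ _ HS).
  transitivity (scal (RtoC (weight eta 0) : C_AbsRing) (minus (tel 0 x) (S 1 (tel 0 x)))); [vec V|].
  rewrite tel_eq. vec V.
- rewrite partial_S, tel_sum_S, sum_Sn, (group_plus _ _ HS 1), (group_scal _ _ HS 1).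
  rewrite (group_plus _ _ HS (- (1 / 2)) (partial V S x eta N (1 / 2))), Hpair.
  set (m := Datatypes.S N) in *.
  transitivity (plus (minus (tel_sum N x) (S 1 (tel_sum N x)))
    (scal (RtoC (weight eta m) : C_AbsRing) (minus (tel m x) (S 1 (tel m x))))); [vec V|].
  rewrite IHN, tel_eq.
  change (plus (sum_n (weight eta) N) (weight eta m)) with (sum_n (weight eta) N + weight eta m).
  vec V.
Qed.

Hypothesis Hexp : forall k : Z, solvable V S f eta (fun s => cis (2 * PI * IZR k * s)).

(** [tel_sum] converges strongly with a uniform norm bound, so its limit is bounded and keeps
    commuting with the group. At [f], [tel_sum_eq] becomes in the limit multiplication by $2c$,
    where $c$ is the sum of the weights; dividing by $2c$ gives the operator. *)
Lemma local_inverse : exists T : V -> V,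
  is_linear T /\ (forall t x, T (S t x) = S t (T x)) /\ minus (T f) (S 1 (T f)) = f.
Proof.
destruct (choice _ _ _ tel_sum_lim) as [T HT].
assert (HTlin : is_linear T).
{ split.
  - intros x y. apply (seq_lim_unique V (fun N => tel_sum N (plus x y))); [apply HT|].
    apply seq_lim_ext with (fun N => plus (tel_sum N x) (tel_sum N y)).
    + intros N. symmetry; apply tel_sum_plus.
    + apply (seq_lim_plus V); apply HT.
  - intros k x. apply (seq_lim_unique V (fun N => tel_sum N (scal k x))); [apply HT|].
    apply seq_lim_ext with (fun N => scal (k : C_AbsRing) (tel_sum N x)).
    + intros N. symmetry; apply tel_sum_scal.
    + apply (seq_lim_linear V V (fun x => scal k x)); [apply is_linear_scalC|apply HT].
  - exists (32 / eta ^ 4). split; [apply Rdiv_lt_0_compat; [lra|now apply pow_lt]|].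
    intros x. assert (H := seq_lim_bound V _ _ zero (32 / eta ^ 4 * norm x) 0 (HT x)).
    rewrite (minus_zero_r (G := V)) in H. apply H. intros n _.
    rewrite (minus_zero_r (G := V)). apply tel_sum_norm. }
assert (Hlin1 := group_linear V S HS).
assert (HTS : forall t x, T (S t x) = S t (T x)).
{ intros t x. apply (seq_lim_unique V (fun N => tel_sum N (S t x))); [apply HT|].
  apply seq_lim_ext with (fun N => S t (tel_sum N x)).
  - intros N. symmetry; apply tel_sum_group.
  - apply (seq_lim_linear V V (S t)); [apply Hlin1|apply HT]. }
assert (Hc : ex_series (weight eta)).
{ apply (@ex_series_le R_AbsRing R_CompleteNormedModule) with (majorant eta).
  - intros n. change (Rabs (weight eta n) <= majorant eta n).
    rewrite Rabs_pos_eq by apply weight_ge0.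
    eapply Rle_trans; [|now apply weight_majorant].
    assert (H := pos_INR n). assert (H1 := weight_ge0 eta n). nra.
  - now apply ex_series_majorant. }
destruct Hc as [c Hc].
assert (Hlim : forall eps, 0 < eps -> exists N, forall n, (N <= n)%nat ->
  Rabs (sum_n (weight eta) n - c) < eps).
{ intros eps He. exact (proj1 (filterlim_locally_ball_norm (sum_n (weight eta)) c) Hc (mkposreal eps He)). }
(* The bound [eta <= 1] places $\eta/2$ in $(0,\pi)$, so the first weight is positive; as all
   weights are nonnegative, their sum is positive too. *)
assert (Hw0 : 0 < weight eta 0).
{ unfold weight. apply pow_lt. simpl. rewrite Rplus_0_l. apply Rdiv_lt_0_compat; [|lra].
  assert (Hpi := PI2_1). apply sin_gt_0; lra. }
assert (Hcp : 0 < c).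
{ destruct (Hlim (weight eta 0) Hw0) as [N HN]. specialize (HN N (Nat.le_refl _)).
  apply Rabs_def2 in HN.
  assert (Hs : forall n, weight eta 0 <= sum_n (weight eta) n).
  { induction n; [rewrite sum_O; lra|]. rewrite sum_Sn.
    change (weight eta 0 <= sum_n (weight eta) n + weight eta (Datatypes.S n)).
    assert (H := weight_ge0 eta (Datatypes.S n)). lra. }
  specialize (Hs N). lra. }
exists (fun x => scal (RtoC (/ (2 * c)) : C_AbsRing) (T x)).
split; [|split].
- split.
  + intros x y. rewrite (linear_plus T HTlin). vec V.
  + intros k x. rewrite (linear_scal T HTlin). vec V.
  + destruct (linear_norm T HTlin) as [M [HM HM']].
    assert (Hi : 0 < / (2 * c)) by (apply Rinv_0_lt_compat; lra).
    exists (/ (2 * c) * M). split; [nra|]. intros x.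
    rewrite (norm_scalC V), Cmod_R, Rabs_pos_eq by lra.
    rewrite Rmult_assoc. apply Rmult_le_compat_l; [lra|apply HM'].
- intros t x. now rewrite HTS, (group_scal _ _ HS).
- rewrite (group_scal _ _ HS).
  transitivity (scal (RtoC (/ (2 * c)) : C_AbsRing) (minus (T f) (S 1 (T f)))); [vec V|].
  replace (minus (T f) (S 1 (T f))) with (scal (RtoC (2 * c) : C_AbsRing) f).
  { transitivity (scal (RtoC (/ (2 * c) * (2 * c)) : C_AbsRing) f); [vec V|].
    rewrite Rinv_l by lra. vec V. }
  apply (seq_lim_unique V (fun N => minus (tel_sum N f) (S 1 (tel_sum N f)))).
  + intros eps He.
    assert (Hf := norm_ge_0 f).
    destruct (Hlim (eps / (4 * (1 + norm f)))) as [N1 HN1].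
    { apply Rdiv_lt_0_compat; lra. }
    destruct (partial_half V S HS f eta eta_pos Hexp (eps / 4) ltac:(lra)) as [N2 HN2].
    exists (max N1 N2). intros n Hn. specialize (HN1 n ltac:(lia)). specialize (HN2 n ltac:(lia)).
    rewrite tel_sum_eq.
    norm_as V (minus (scal (RtoC (2 * (sum_n (weight eta) n - c)) : C_AbsRing) f)
      (S (- (1 / 2)) (partial V S f eta n (1 / 2)))).
    eapply Rle_lt_trans; [apply (norm_minus_le V)|].
    rewrite (norm_scalC V), (group_norm _ _ HS), Cmod_R, Rabs_mult, (Rabs_pos_eq 2) by lra.
    set (a := Rabs (sum_n (weight eta) n - c)) in *.
    assert (H0 : 0 <= a) by apply Rabs_pos.
    apply (Rmult_lt_compat_r (1 + norm f)) in HN1; [|lra].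
    replace (eps / (4 * (1 + norm f)) * (1 + norm f)) with (eps / 4) in HN1 by (field; lra).
    nra.
  + apply seq_lim_ext with (fun N => plus (tel_sum N f) (scal (opp one : C_AbsRing) (S 1 (tel_sum N f)))).
    { intros N. vec V. }
    replace (minus (T f) (S 1 (T f))) with (plus (T f) (scal (opp one : C_AbsRing) (S 1 (T f)))) by vec V.
    apply (seq_lim_plus V); [apply HT|].
    apply (seq_lim_linear V V (fun x => scal (opp one : C_AbsRing) x)); [apply is_linear_scalC|].
    apply (seq_lim_linear V V (S 1)); [apply Hlin1|apply HT].
Qed.

End Telescoping.

(** * Transforms along an isometric group *)

Lemma ball_of_Cmod (z w : C) e : Cmod (w - z) < e -> @ball C_UniformSpace z e w.
Proof. exact (C_NormedModule_mixin_compat1 z w e). Qed.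

(** Balls of [C] as a product space are squares; the factor $\sqrt2$ is rounded up to 2. *)
Lemma Cmod_of_ball (z w : C) (e : posreal) : @ball C_UniformSpace z e w -> Cmod (w - z) < 2 * e.
Proof.
intros H. eapply Rlt_le_trans; [exact (C_NormedModule_mixin_compat2 z w e H)|].
apply Rmult_le_compat_r; [left; apply cond_pos|].
assert (H2 := sqrt_sqrt 2 ltac:(lra)). assert (H3 := sqrt_pos 2). nra.
Qed.

Lemma Cmod_minus_triangle (x y z : C) : Cmod (x - z) <= Cmod (x - y) + Cmod (y - z).
Proof. replace (x - z)%C with ((x - y) + (y - z))%C by ring. apply Cmod_triangle. Qed.

Lemma Cmod_minus_sym (x y : C) : Cmod (x - y) = Cmod (y - x).
Proof. rewrite <- Cmod_opp. f_equal. ring. Qed.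

Lemma extends_disk (V : NormedModule C_AbsRing) (dom : C -> Prop) (F : C -> V) z0 :
  extends_analytically_at dom F z0 <->
  exists (d : R) (h : C -> V), 0 < d /\ forall z, Cmod (z - z0) < d ->
    @ex_derive C_AbsRing V h z /\ (dom z -> h z = F z).
Proof.
split.
- intros (U & h & HU & Hz0 & Hh & HF). destruct (HU z0 Hz0) as [e He].
  exists e, h. split; [apply cond_pos|]. intros z Hz.
  assert (HUz : U z) by (apply He; now apply ball_of_Cmod).
  split; [now apply Hh|intros Hd; now apply HF].
- intros (d & h & Hd & Hh). exists (fun z => Cmod (z - z0) < d), h.
  split; [|split; [|split]].
  + intros z Hz. exists (mkposreal ((d - Cmod (z - z0)) / 2) ltac:(lra)).
    intros w Hw. apply Cmod_of_ball in Hw. simpl in Hw.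
    eapply Rle_lt_trans; [apply (Cmod_minus_triangle w z z0)|]. lra.
  + replace (z0 - z0)%C with (RtoC 0) by ring. now rewrite Cmod_0.
  + intros z Hz. now apply Hh.
  + intros z Hz Hdom. now apply Hh.
Qed.

Section Transform.

Variables (V : CompleteNormedModule C_AbsRing) (S : R -> V -> V).
Hypothesis HS : isometric_group S.

Definition expker (z : C) (s : R) : C := cexp (z * RtoC (1 - s)).

Lemma expkerE z s : expker z s = (RtoC (exp (fst z * (1 - s))) * cis (snd z * (1 - s)))%C.
Proof.
unfold expker, cexp. simpl.
replace (fst z * (1 - s) - snd z * 0) with (fst z * (1 - s)) by ring.
now replace (fst z * 0 + snd z * (1 - s)) with (snd z * (1 - s)) by ring.
Qed.

Lemma contC_expker z : contC (expker z).
Proof.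
intros x. apply cont_ext with
  (fun s => (RtoC (exp (fst z * (1 - s))) * cis (snd z * (1 - s)))%C : AbsRing_NormedModule C_AbsRing).
- intros s. symmetry. apply expkerE.
- revert x. apply contC_mult.
  + apply contC_RtoC. intros x. apply (@ex_derive_continuous R_AbsRing R_NormedModule).
    auto_derive. easy.
  + apply contC_lipschitz with (2 * Rabs (snd z)). intros x y.
    eapply Rle_trans; [apply cis_lip|].
    replace (snd z * (1 - y) - snd z * (1 - x)) with (snd z * - (y - x)) by ring.
    rewrite Rabs_mult, Rabs_Ropp. right; ring.
Qed.

Lemma exp_mono x y : x <= y -> exp x <= exp y.
Proof. intros [H|H]; [left; now apply exp_increasing|right; now rewrite H]. Qed.

Lemma expker_norm z s : 0 <= s <= 1 -> Cmod (expker z s) <= exp (Rabs (fst z)).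
Proof.
intros Hs. rewrite expkerE, Cmod_mult, Cmod_cis, Cmod_R, Rmult_1_r.
rewrite Rabs_pos_eq by (left; apply exp_pos). apply exp_mono.
assert (H := Rle_abs (fst z)). assert (H0 := Rabs_pos (fst z)). nra.
Qed.

Lemma expker_quad z w s : 0 <= s <= 1 -> Cmod (w - z) <= 1 ->
  Cmod (expker w s - expker z s - (w - z) * (RtoC (1 - s) * expker z s))
    <= 13 * exp (Rabs (fst z)) * Cmod (w - z) * Cmod (w - z).
Proof.
intros Hs Hw.
set (v := ((w - z) * RtoC (1 - s))%C).
assert (Hv : Cmod v <= Cmod (w - z)).
{ unfold v. rewrite Cmod_mult, Cmod_R, Rabs_pos_eq by lra. assert (H := Cmod_ge_0 (w - z)). nra. }
replace (expker w s) with (expker z s * cexp v)%C.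
2:{ unfold expker, v. rewrite <- cexp_plus. f_equal. ring. }
replace (expker z s * cexp v - expker z s - (w - z) * (RtoC (1 - s) * expker z s))%C
  with (expker z s * (cexp v - 1 - v))%C by (unfold v; ring).
rewrite Cmod_mult.
assert (Q := cexp_quad v ltac:(lra)). assert (K := expker_norm z s Hs).
assert (H0 := Cmod_ge_0 v). assert (H1 := Cmod_ge_0 (expker z s)).
apply Rle_trans with (exp (Rabs (fst z)) * (13 * Cmod v * Cmod v)).
- apply Rmult_le_compat; [easy|apply Cmod_ge_0|easy|easy].
- assert (He := exp_pos (Rabs (fst z))).
  replace (13 * exp (Rabs (fst z)) * Cmod (w - z) * Cmod (w - z))
    with (exp (Rabs (fst z)) * (13 * Cmod (w - z) * Cmod (w - z))) by ring.
  apply Rmult_le_compat_l; [lra|]. nra.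
Qed.

(** The operator $B(z)$ of the overview; [transform'] is its derivative in $z$, obtained by
    differentiating the kernel. *)
Definition transform (z : C) (v : V) : V :=
  VInt V (fun s => scal (expker z s : C_AbsRing) (S s v)) 0 1.

Definition transform' (z : C) (v : V) : V :=
  VInt V (fun s => scal (RtoC (1 - s) * expker z s : C_AbsRing)%C (S s v)) 0 1.

Lemma contC_expker' z : contC (fun s => (RtoC (1 - s) * expker z s)%C).
Proof.
apply contC_mult; [|apply contC_expker]. apply contC_RtoC. intros x.
apply (@ex_derive_continuous R_AbsRing R_NormedModule). auto_derive. easy.
Qed.

Lemma cont_kernel (k : R -> C) v : contC k -> cont (fun s => scal (k s : C_AbsRing) (S s v)).
Proof. intros Hk. apply cont_scal; [easy|apply (group_cont _ _ HS)]. Qed.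

Lemma kernel_bound (k : R -> C) v M : contC k -> (forall s, 0 <= s <= 1 -> Cmod (k s) <= M) ->
  norm (VInt V (fun s => scal (k s : C_AbsRing) (S s v)) 0 1) <= M * norm v.
Proof.
intros Hk HM. rewrite <- (Rmult_1_l (M * norm v)). replace 1 with (1 - 0) at 2 by ring.
apply VInt_bound; [lra|now apply cont_kernel|]. intros s Hs.
rewrite (norm_scalC V), (group_norm _ _ HS).
apply Rmult_le_compat_r; [apply norm_ge_0|now apply HM].
Qed.

Lemma kernel_minus (k : R -> C) u v : contC k ->
  VInt V (fun s => scal (k s : C_AbsRing) (S s (minus u v))) 0 1
  = minus (VInt V (fun s => scal (k s : C_AbsRing) (S s u)) 0 1)
      (VInt V (fun s => scal (k s : C_AbsRing) (S s v)) 0 1).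
Proof.
intros Hk. rewrite <- (VInt_minus V _ _ 0 1 (cont_kernel k u Hk) (cont_kernel k v Hk)).
apply VInt_ext; [lra|]. intros s _. cbv beta. rewrite (group_minus V S HS). vec V.
Qed.

Lemma kernel_scal (k : R -> C) (c : C) v : contC k ->
  VInt V (fun s => scal (k s : C_AbsRing) (S s (scal (c : C_AbsRing) v))) 0 1
  = scal (c : C_AbsRing) (VInt V (fun s => scal (k s : C_AbsRing) (S s v)) 0 1).
Proof.
intros Hk. rewrite <- (VInt_scal V c _ 0 1 (cont_kernel k v Hk)).
apply VInt_ext; [lra|]. intros s _. cbv beta. rewrite (group_scal _ _ HS). vec V.
Qed.

Lemma transform_group z t v : transform z (S t v) = S t (transform z v).
Proof.
unfold transform. rewrite <- (VInt_linear V V (S t) _ 0 1 (group_linear V S HS t)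
  (cont_kernel _ v (contC_expker z))).
apply VInt_ext; [lra|]. intros s _. cbv beta.
now rewrite (group_scal _ _ HS), (group_comm V S HS).
Qed.

Lemma transform_quad z w v : Cmod (w - z) <= 1 ->
  norm (minus (minus (transform w v) (transform z v))
      (scal (Cminus w z : C_AbsRing) (transform' z v)))
    <= 13 * exp (Rabs (fst z)) * Cmod (w - z) * Cmod (w - z) * norm v.
Proof.
intros Hw. unfold transform, transform'.
assert (Cw := cont_kernel _ v (contC_expker w)). assert (Cz := cont_kernel _ v (contC_expker z)).
assert (Cp := cont_kernel _ v (contC_expker' z)).
assert (Cm := cont_minus V _ _ Cw Cz).
assert (Cs : cont (fun s => scal (Cminus w z : C_AbsRing)
  (scal (RtoC (1 - s) * expker z s : C_AbsRing)%C (S s v)))).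
{ apply cont_scal; [apply contC_const|exact Cp]. }
assert (Ck : contC (fun s => expker w s - expker z s - (w - z) * (RtoC (1 - s) * expker z s))%C).
{ intros x. apply cont_ext with (fun s => (expker w s + (RtoC (-1) * expker z s
    + (- (w - z)) * (RtoC (1 - s) * expker z s)))%C : AbsRing_NormedModule C_AbsRing).
  - intros s. replace (RtoC (-1)) with (- RtoC 1)%C by (apply C_eq; simpl; ring).
    change ((expker w s + (- (1) * expker z s + - (w - z) * (RtoC (1 - s) * expker z s)))%C
      = (expker w s - expker z s - (w - z) * (RtoC (1 - s) * expker z s))%C). ring.
  - revert x. apply contC_plus; [apply contC_expker|].
    apply contC_plus; (apply contC_mult; [apply contC_const|]);
      [apply contC_expker|apply contC_expker']. }
eapply Rle_trans.
2:{ apply (kernel_bound _ v _ Ck). intros s Hs. now apply expker_quad. }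
right. apply (f_equal (@norm C_AbsRing V)).
rewrite <- (VInt_minus V _ _ 0 1 Cw Cz), <- (VInt_scal V _ _ 0 1 Cp).
refine (eq_trans (eq_sym (VInt_minus V _ _ 0 1 Cm Cs)) _).
apply VInt_ext; [lra|]. intros s _. cbv beta. vec V.
Qed.

Lemma transform_bound z v : norm (transform z v) <= exp (Rabs (fst z)) * norm v.
Proof. apply (kernel_bound _ v _ (contC_expker z)). apply expker_norm. Qed.

Lemma transform'_bound z v : norm (transform' z v) <= exp (Rabs (fst z)) * norm v.
Proof.
apply (kernel_bound _ v _ (contC_expker' z)). intros s Hs.
rewrite Cmod_mult, Cmod_R, Rabs_pos_eq by lra.
assert (H := expker_norm z s Hs). assert (H0 := Cmod_ge_0 (expker z s)). nra.
Qed.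

Lemma diff_transform (w : C -> V) z l :
  diff_at (fun z => z) w z l ->
  diff_at (fun z => z) (fun y => transform y (w y)) z (plus (transform' z (w z)) (transform z l)).
Proof.
intros Hw. assert (He := exp_pos (Rabs (fst z))).
apply (diff_op C (fun z => z) V V transform (transform' z) w z l (exp (Rabs (fst z)))
  (13 * exp (Rabs (fst z))) 1); try lra.
- intros y u v. apply kernel_minus, contC_expker.
- intros c u. apply kernel_scal, contC_expker.
- intros u v. apply kernel_minus, contC_expker'.
- apply transform_bound.
- apply transform'_bound.
- intros y v Hy. now apply transform_quad.
- exact Hw.
Qed.

Lemma cexp_diff z : @is_derive C_AbsRing (AbsRing_NormedModule C_AbsRing) cexp z (cexp z).
Proof.
apply diff_is_deriveC. apply diff_quad with (K := 13 * exp (fst z)) (rho := 1); [lra|].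
intros y Hy.
change (Cmod (cexp y - cexp z - (y - z) * cexp z) <= 13 * exp (fst z) * Cmod (y - z) * Cmod (y - z)).
replace (cexp y) with (cexp z * cexp (y - z))%C
  by (rewrite <- cexp_plus; f_equal; ring).
replace (cexp z * cexp (y - z) - cexp z - (y - z) * cexp z)%C
  with (cexp z * (cexp (y - z) - 1 - (y - z)))%C by ring.
rewrite Cmod_mult, Cmod_cexp. assert (Q := cexp_quad _ Hy). assert (He := exp_pos (fst z)).
replace (13 * exp (fst z) * Cmod (y - z) * Cmod (y - z))
  with (exp (fst z) * (13 * Cmod (y - z) * Cmod (y - z))) by ring.
apply Rmult_le_compat_l; lra.
Qed.

Lemma cexp_cont z eps : 0 < eps -> exists d, 0 < d /\
  forall w, Cmod (w - z) < d -> Cmod (cexp w - cexp z) < eps.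
Proof.
exact (diff_cont C (fun z => z) (AbsRing_NormedModule C_AbsRing) cexp z (cexp z)
  (is_deriveC_diff _ _ _ _ (cexp_diff z)) eps).
Qed.

(** Neumann series on both sides of the circle: $z-S(1)=-S(1)(1-zS(-1))$ inside,
    $z-S(1)=z(1-z^{-1}S(1))$ outside. *)
Lemma group_resolvent_exists z y : Cmod z <> 1 ->
  exists x, minus (scal (z : C_AbsRing) x) (S 1 x) = y.
Proof.
intros Hz. destruct (Rlt_dec (Cmod z) 1) as [Hlt|Hge].
- destruct (neumann V (fun x => scal (z : C_AbsRing) (S (-1) x)) (Cmod z) (opp (S (-1) y))) as [x Hx].
  + split.
    * intros a b. rewrite (group_plus _ _ HS). vec V.
    * intros c a. rewrite (group_scal _ _ HS). vec V.
    * exists 1. split; [lra|]. intros a. rewrite (norm_scalC V), (group_norm _ _ HS).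
      apply Rmult_le_compat_r; [apply norm_ge_0|lra].
  + split; [apply Cmod_ge_0|easy].
  + intros a. rewrite (norm_scalC V), (group_norm _ _ HS). lra.
  + exists x. apply (f_equal (S 1)) in Hx.
    rewrite (group_minus V S HS), (group_scal _ _ HS), <- (group_add _ _ HS) in Hx.
    replace (1 + -1) with 0 in Hx by ring. rewrite (group_0 _ _ HS) in Hx.
    replace (opp (S (-1) y)) with (scal (opp one : C_AbsRing) (S (-1) y)) in Hx by vec V.
    rewrite (group_scal _ _ HS), <- (group_add _ _ HS) in Hx.
    replace (1 + -1) with 0 in Hx by ring. rewrite (group_0 _ _ HS) in Hx.
    transitivity (opp (minus (S 1 x) (scal (z : C_AbsRing) x))); [vec V|].
    etransitivity; [exact (f_equal opp Hx)|]. vec V.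
- assert (Hz0 : z <> RtoC 0) by (intros ->; rewrite Cmod_0 in Hge; lra).
  assert (Hi : Cmod (/ z) < 1).
  { rewrite Cmod_inv, <- Rinv_1 by easy. apply Rinv_lt_contravar; lra. }
  destruct (neumann V (fun x => scal (/ z : C_AbsRing)%C (S 1 x)) (Cmod (/ z))
    (scal (/ z : C_AbsRing)%C y)) as [x Hx].
  + split.
    * intros a b. rewrite (group_plus _ _ HS). vec V.
    * intros c a. rewrite (group_scal _ _ HS). vec V.
    * exists 1. split; [lra|]. intros a. rewrite (norm_scalC V), (group_norm _ _ HS).
      apply Rmult_le_compat_r; [apply norm_ge_0|lra].
  + split; [apply Cmod_ge_0|easy].
  + intros a. rewrite (norm_scalC V), (group_norm _ _ HS). lra.
  + exists x. transitivity (scal (z : C_AbsRing) (minus x (scal (/ z : C_AbsRing)%C (S 1 x)))).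
    * vec V; field; exact Hz0.
    * rewrite Hx. vec V; field; exact Hz0.
Qed.

(** A difference $d$ of two solutions satisfies $zd=S(1)d$, hence $|z|\,\|d\|=\|d\|$. *)
Lemma group_resolvent_unique z x y : Cmod z <> 1 ->
  minus (scal (z : C_AbsRing) x) (S 1 x) = minus (scal (z : C_AbsRing) y) (S 1 y) -> x = y.
Proof.
intros Hz H. apply (minus_zero_eq V).
assert (E : scal (z : C_AbsRing) (minus x y) = S 1 (minus x y)).
{ rewrite (group_minus V S HS).
  replace (S 1 x) with (minus (scal (z : C_AbsRing) x) (minus (scal (z : C_AbsRing) x) (S 1 x))) by vec V.
  rewrite H. vec V. }
assert (E1 : Cmod z * norm (minus x y) = norm (minus x y)).
{ rewrite <- (norm_scalC V). etransitivity; [exact (f_equal (@norm C_AbsRing V) E)|].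
  apply (group_norm _ _ HS). }
apply (norm_eq_zero (V := V)).
assert (E2 : (Cmod z - 1) * norm (minus x y) = 0) by (rewrite Rmult_minus_distr_r, E1; ring).
apply Rmult_integral in E2. destruct E2 as [E2|E2]; [lra|exact E2].
Qed.

(** [F] and [G] stand for $\hat f$ and $R(\cdot,S(1))f$. They are known only through the equations
    they solve, and uniqueness of the solutions replaces any formula for them. *)
Variables (f : V) (F G : C -> V).
Hypothesis HF : forall z, fst z <> 0 ->
  minus (scal (cexp z : C_AbsRing) (F z)) (S 1 (F z)) = transform z f.
Hypothesis HG : forall z, Cmod z <> 1 -> minus (scal (z : C_AbsRing) (G z)) (S 1 (G z)) = f.

Lemma Cmod_cexp_neq1 z : fst z <> 0 -> Cmod (cexp z) <> 1.
Proof.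
intros Hz. rewrite Cmod_cexp. rewrite <- exp_0. intros H. apply exp_inv in H. easy.
Qed.

Lemma transform_resolvent z : fst z <> 0 -> F z = transform z (G (cexp z)).
Proof.
intros Hz. assert (H1 := Cmod_cexp_neq1 z Hz).
apply (group_resolvent_unique (cexp z) _ _ H1).
rewrite HF by easy. rewrite <- transform_group.
rewrite <- (HG (cexp z)) at 1 by easy.
etransitivity; [apply (kernel_minus _ _ _ (contC_expker z))|].
f_equal. apply (kernel_scal _ _ _ (contC_expker z)).
Qed.

Lemma resolvent_extends_transform xi :
  extends_analytically_at (fun z => Cmod z <> 1) G (cis xi) ->
  extends_analytically_at (fun z => Re z <> 0) F (0, xi).
Proof.
rewrite !extends_disk. intros (d & h & Hd & Hh).
destruct (cexp_cont (0, xi) d Hd) as [e [He He']]. rewrite cexp_imag in He'.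
exists e, (fun z => transform z (h (cexp z))). split; [easy|]. intros z Hz.
destruct (Hh (cexp z) (He' z Hz)) as [[l Hl] HhG]. split.
- assert (Hc := is_derive_comp h cexp z l (cexp z) Hl (cexp_diff z)).
  eexists. apply diff_is_deriveC. apply diff_transform. apply (is_deriveC_diff V). exact Hc.
- intros Hdom. rewrite HhG by now apply Cmod_cexp_neq1. symmetry. now apply transform_resolvent.
Qed.

Definition boundary_value (xi : R) (y : V) : Prop :=
  forall eps, 0 < eps -> exists d, 0 < d /\
    forall z, fst z <> 0 -> Cmod (z - (0, xi)) < d -> norm (minus (F z) y) < eps.

Lemma boundary_points xi d : 0 < d -> fst (((d / 2)%R, xi) : C) <> 0 /\ Cmod (((d / 2)%R, xi) - (0, xi))%C < d.
Proof.
intros Hd. split; [simpl; lra|].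
replace (((d / 2)%R, xi) - (0, xi))%C with (RtoC (d / 2)) by (apply C_eq; simpl; field).
rewrite Cmod_R, Rabs_pos_eq; lra.
Qed.

Lemma boundary_unique xi y y' : boundary_value xi y -> boundary_value xi y' -> y = y'.
Proof.
intros H H'. apply (vanishing_eq V). intros eps He.
destruct (H (eps / 2) ltac:(lra)) as [d [Hd H1]].
destruct (H' (eps / 2) ltac:(lra)) as [d' [Hd' H2]].
destruct (boundary_points xi (Rmin d d') ltac:(now apply Rmin_glb_lt)) as [P1 P2].
set (z := (Rmin d d' / 2, xi) : C) in *.
specialize (H1 z P1 (Rlt_le_trans _ _ _ P2 (Rmin_l _ _))).
specialize (H2 z P1 (Rlt_le_trans _ _ _ P2 (Rmin_r _ _))).
eapply Rle_trans; [apply (norm_minus_trans V _ (F z))|].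
apply Rle_trans with (eps / 2 + eps / 2); [|lra].
apply Rplus_le_compat; left; [rewrite (norm_minus_sym V); exact H1|exact H2].
Qed.

(** Defined from [F] alone, as its limit from off the imaginary axis. Extensions of [F] on different
    disks thus yield one and the same function of [xi], with nothing to glue. *)
Definition boundary (xi : R) : V := epsilon (inhabits zero) (boundary_value xi).

Lemma boundary_eq xi y : boundary_value xi y -> boundary xi = y.
Proof.
intros H. apply (boundary_unique xi); [|easy]. unfold boundary. apply epsilon_spec. now exists y.
Qed.

(** An extension [h] is continuous on its disk, so at every nearby imaginary point its value is the
    limit of [F]. Hence [boundary] coincides with [h] along the axis near [xi] and inherits its
    continuity. *)
Lemma regular_boundary xi :
  extends_analytically_at (fun z => Re z <> 0) F (0, xi) ->
  boundary_value xi (boundary xi) /\ cont_at RtoC boundary xi.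
Proof.
rewrite extends_disk. intros (d & h & Hd & Hh).
assert (Hb : forall x, Rabs (x - xi) < d -> boundary_value x (h (0, x))).
{ intros x Hx.
  assert (Hx0 : Cmod ((0, x) - (0, xi)) = Rabs (x - xi)).
  { replace ((0, x) - (0, xi))%C with ((0, 1) * RtoC (x - xi))%C by (apply C_eq; simpl; ring).
    rewrite Cmod_mult, Cmod_R. change (0, 1) with Ci. rewrite Cmod_Ci. ring. }
  destruct (Hh (0, x)) as [[l Hl] _]; [now rewrite Hx0|].
  apply is_deriveC_diff, diff_cont in Hl. intros eps He.
  destruct (Hl eps He) as [e [He' H]].
  exists (Rmin e (d - Rabs (x - xi))). split; [apply Rmin_glb_lt; lra|]. intros z Hz Hzx.
  assert (A1 := Rlt_le_trans _ _ _ Hzx (Rmin_l _ _)).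
  assert (A2 := Rlt_le_trans _ _ _ Hzx (Rmin_r _ _)).
  destruct (Hh z) as [_ Hhz].
  { eapply Rle_lt_trans; [apply (Cmod_minus_triangle z (0, x))|]. rewrite Hx0. lra. }
  rewrite <- Hhz by exact Hz. now apply H. }
assert (E : forall x, Rabs (x - xi) < d -> boundary x = h (0, x)).
{ intros x Hx. now apply boundary_eq, Hb. }
assert (H0 : Rabs (xi - xi) < d) by (rewrite Rminus_diag, Rabs_R0; exact Hd).
split; [rewrite E by easy; now apply Hb|].
intros eps He.
destruct (Hh (0, xi)) as [[l Hl] _].
{ replace ((0, xi) - (0, xi))%C with (RtoC 0) by (apply C_eq; simpl; ring). now rewrite Cmod_0. }
apply is_deriveC_diff, diff_cont in Hl. destruct (Hl eps He) as [e [He' H]].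
exists (Rmin e d). split; [now apply Rmin_glb_lt|]. intros y Hy.
rewrite Cmod_RtoC_minus in Hy.
assert (A1 := Rlt_le_trans _ _ _ Hy (Rmin_l _ _)).
assert (A2 := Rlt_le_trans _ _ _ Hy (Rmin_r _ _)).
rewrite !E by easy. apply H.
replace ((0, y) - (0, xi))%C with ((0, 1) * RtoC (y - xi))%C by (apply C_eq; simpl; ring).
rewrite Cmod_mult, Cmod_R. change (0, 1) with Ci. rewrite Cmod_Ci. lra.
Qed.

Lemma boundary_equation xi y : boundary_value xi y ->
  minus (scal (cis xi : C_AbsRing) y) (S 1 y)
  = VInt V (fun s => scal (cis (xi * (1 - s)) : C_AbsRing) (S s f)) 0 1.
Proof.
intros Hy.
transitivity (transform (0, xi) f).
2:{ apply VInt_ext; [lra|]. intros s _. rewrite expkerE. simpl. rewrite Rmult_0_l, exp_0.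
    f_equal. ring. }
apply (vanishing_eq V). intros eps He.
assert (Ht := diff_cont C (fun z => z) V (fun z => transform z f) (0, xi) (transform' (0, xi) f)).
destruct Ht with (eps := eps / 3) as [d1 [Hd1 H1]]; [|lra|].
{ apply diff_quad with (K := 13 * exp (Rabs 0) * norm f) (rho := 1); [lra|]. intros z Hz.
  eapply Rle_trans; [now apply transform_quad|]. simpl fst. right; ring. }
(* The distance from [F z] to [y] enters twice, once through the isometry [S 1] and once multiplied
   by [cexp z], of modulus at most 2: together $\varepsilon/9+2\varepsilon/9$. *)
destruct (Hy (eps / 9) ltac:(lra)) as [d2 [Hd2 H2]].
destruct (cexp_cont (0, xi) (Rmin 1 (eps / 3 / (1 + norm y)))) as [d3 [Hd3 H3]].
{ assert (Hn := norm_ge_0 y). apply Rmin_glb_lt; [lra|]. apply Rdiv_lt_0_compat; lra. }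
rewrite cexp_imag in H3.
destruct (boundary_points xi (Rmin d1 (Rmin d2 d3))) as [P1 P2].
{ repeat apply Rmin_glb_lt; easy. }
set (z := (Rmin d1 (Rmin d2 d3) / 2, xi) : C) in *.
specialize (H1 z (Rlt_le_trans _ _ _ P2 (Rmin_l _ _))).
assert (P3 := Rlt_le_trans _ _ _ P2 (Rmin_r _ _)).
specialize (H2 z P1 (Rlt_le_trans _ _ _ P3 (Rmin_l _ _))).
specialize (H3 z (Rlt_le_trans _ _ _ P3 (Rmin_r _ _))).
assert (A1 := Rlt_le_trans _ _ _ H3 (Rmin_l _ _)).
assert (A2 := Rlt_le_trans _ _ _ H3 (Rmin_r _ _)).
cbv beta in H1. rewrite <- HF in H1 by exact P1.
assert (Hn := norm_ge_0 y).
apply (Rmult_lt_compat_r (1 + norm y)) in A2; [|lra].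
replace (eps / 3 / (1 + norm y) * (1 + norm y)) with (eps / 3) in A2 by (field; lra).
assert (Hc : Cmod (cexp z) <= 2).
{ replace (cexp z) with (cis xi + (cexp z - cis xi))%C by ring.
  eapply Rle_trans; [apply Cmod_triangle|]. rewrite Cmod_cis. lra. }
norm_as V (plus
  (minus (minus (scal (cexp z : C_AbsRing) (F z)) (S 1 (F z))) (transform (0, xi) f))
  (minus (minus (S 1 (F z)) (S 1 y)) (plus (scal (cexp z : C_AbsRing) (minus (F z) y))
    (scal (Cminus (cexp z) (cis xi) : C_AbsRing) y)))).
eapply Rle_trans; [apply (norm_plus_le V)|].
eapply Rle_trans; [apply Rplus_le_compat_l, (norm_minus_le V)|].
eapply Rle_trans; [apply Rplus_le_compat_l, Rplus_le_compat_l, (norm_plus_le V)|].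
rewrite <- (group_minus V S HS), (group_norm _ _ HS), !(norm_scalC V).
assert (B1 : Cmod (cexp z) * norm (minus (F z) y) <= 2 * (eps / 9)).
{ apply Rmult_le_compat; [apply Cmod_ge_0|apply norm_ge_0|easy|lra]. }
assert (B2 := Cmod_ge_0 (cexp z - cis xi)).
apply Rle_trans with (eps / 3 + (eps / 9 + (2 * (eps / 9) + eps / 3))); [|lra].
apply Rplus_le_compat; [left; exact H1|].
apply Rplus_le_compat; [left; exact H2|].
apply Rplus_le_compat; [exact B1|]. nra.
Qed.

(** The hypothesis is phrased through [cis xi] rather than [xi], so it covers neighborhoods of the
    same size around all the points $\xi_0+2\pi k$. *)
Lemma transform_extends_resolvent xi0 eps :
  0 < eps ->
  (forall xi, Cmod (cis xi - cis xi0) < eps ->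
    extends_analytically_at (fun z => Re z <> 0) F (0, xi)) ->
  extends_analytically_at (fun z => Cmod z <> 1) G (cis xi0).
Proof.
intros He Hext.
(* Offsets up to [4 * eta] are needed and [cis] is Lipschitz with constant 2, so [8 * eta < eps]
   keeps them in the regular region; [eta <= 1] serves the positivity of the first weight. *)
set (eta := Rmin 1 (eps / 16)).
assert (Heta : 0 < eta <= 1) by (unfold eta; split; [apply Rmin_glb_lt; lra|apply Rmin_l]).
assert (Heta' : 8 * eta < eps).
{ assert (H := Rmin_r 1 (eps / 16)). fold eta in H. lra. }
assert (Hreg : forall (k : Z) x, Rabs x <= 4 * eta ->
  extends_analytically_at (fun z => Re z <> 0) F (0, xi0 + x + 2 * PI * IZR k)).
{ intros k x Hx. apply Hext. rewrite cis_plus, cis_2PI_Z, Cmult_1_r.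
  eapply Rle_lt_trans; [apply cis_lip|]. replace (xi0 + x - xi0) with x by ring. lra. }
set (S' := fun t x => scal (cis (- xi0 * t) : C_AbsRing) (S t x)).
assert (HS' : isometric_group S') by now apply group_twist.
(* [solvable] asks for a function continuous on the whole line, whereas the boundary values are
   controlled only for $|x|\le4\eta$; clamping extends them constantly. *)
set (clamp := fun x => Rmax (- (4 * eta)) (Rmin (4 * eta) x)).
assert (Hclamp : forall x, Rabs (clamp x) <= 4 * eta).
{ intros x. unfold clamp, Rmax, Rmin. apply Rabs_le. repeat destruct Rle_dec; lra. }
assert (Hclip : forall x y, Rabs (clamp y - clamp x) <= Rabs (y - x)).
{ intros x y. unfold clamp, Rmax, Rmin, Rabs.
  repeat destruct Rle_dec; repeat destruct Rcase_abs; lra. }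
assert (Hcid : forall x, Rabs x <= 4 * eta -> clamp x = x).
{ intros x Hx. apply Rcomplements.Rabs_le_between in Hx.
  unfold clamp. rewrite Rmin_right, Rmax_right; lra. }
assert (Hexp : forall k : Z, solvable V S' f eta (fun s => cis (2 * PI * IZR k * s))).
(* The sign of [k] is reversed because the kernel contains $1-s$: a frequency $-2\pi k$ contributes
   $e^{-2\pi ik(1-s)}=e^{2\pi iks}$. *)
{ intros k. exists (fun x => boundary (xi0 + clamp x + 2 * PI * IZR (- k))). split.
  - intros x e He'.
    destruct (regular_boundary _ (Hreg (- k)%Z (clamp x) (Hclamp x))) as [_ Hc].
    destruct (Hc e He') as [d [Hd H]]. exists d. split; [easy|]. intros y Hy. apply H.
    rewrite Cmod_RtoC_minus in *. eapply Rle_lt_trans; [|exact Hy].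
    eapply Rle_trans; [|apply Hclip]. right. f_equal. ring.
  - intros x Hx. rewrite Hcid by easy.
    destruct (regular_boundary _ (Hreg (- k)%Z x Hx)) as [Hb _].
    assert (E := boundary_equation _ _ Hb). set (xi := xi0 + x + 2 * PI * IZR (- k)) in *.
    set (y := boundary xi) in *. unfold S'.
    transitivity (scal (cis (- xi0) : C_AbsRing) (minus (scal (cis xi : C_AbsRing) y) (S 1 y))).
    { replace (- xi0 * 1) with (- xi0) by ring. unfold xi.
      rewrite !cis_plus, cis_2PI_Z.
      transitivity (minus (scal (cis (- xi0) * cis xi0 * cis x : C_AbsRing)%C y)
        (scal (cis (- xi0) : C_AbsRing) (S 1 y))); [|vec V].
      rewrite cis_opp. vec V. }
    rewrite E, <- (VInt_scal V).
    + apply VInt_ext; [lra|]. intros s _. cbv beta.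
      transitivity (scal (cis (- xi0 + xi * (1 - s)) : C_AbsRing) (S s f)); [rewrite cis_plus; vec V|].
      replace (- xi0 + xi * (1 - s))
        with (- xi0 * s + x * (1 - s) + 2 * PI * IZR k * s + 2 * PI * IZR (- k))
        by (unfold xi; rewrite opp_IZR; ring).
      rewrite !cis_plus, cis_2PI_Z. vec V.
    + apply cont_kernel. apply contC_lipschitz with (2 * Rabs xi). intros u v.
      eapply Rle_trans; [apply cis_lip|].
      replace (xi * (1 - v) - xi * (1 - u)) with (xi * - (v - u)) by ring.
      rewrite Rabs_mult, Rabs_Ropp. right; ring. }
destruct (local_inverse V S' HS' f eta (proj1 Heta) (proj2 Heta) Hexp) as (T & HT & HTS & HTf).
assert (HTS1 : forall x, T (S 1 x) = S 1 (T x)).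
{ intros x. assert (E := HTS 1 x). unfold S' in E. rewrite (linear_scal T HT) in E.
  apply (f_equal (fun y => scal (cis xi0 : C_AbsRing) y)) in E.
  replace (- xi0 * 1) with (- xi0) in E by ring.
  transitivity (scal (cis (- xi0) * cis xi0 : C_AbsRing)%C (T (S 1 x)));
    [rewrite cis_opp; vec V|].
  transitivity (scal (cis xi0 : C_AbsRing) (scal (cis (- xi0) : C_AbsRing) (T (S 1 x)))); [vec V|].
  etransitivity; [exact E|].
  transitivity (scal (cis (- xi0) * cis xi0 : C_AbsRing)%C (S 1 (T x))); [vec V|].
  rewrite cis_opp. vec V. }
(* The twist is undone here: since $S'(1)=e^{-i\xi_0}S(1)$, the operator $e^{-i\xi_0}T$ inverts
   $e^{i\xi_0}-S(1)$ at $f$. *)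
destruct (local_resolvent V (S 1) (fun x => scal (cis (- xi0) : C_AbsRing) (T x)) (cis xi0) f)
  as (r & h & Hr & Hh).
- apply (group_linear V S HS).
- destruct (linear_norm T HT) as [M [HM HM']]. split.
  + intros x y. rewrite (linear_plus T HT). vec V.
  + intros k x. rewrite (linear_scal T HT). vec V.
  + exists M. split; [easy|]. intros x. rewrite (norm_scalC V), Cmod_cis, Rmult_1_l. apply HM'.
- intros x. now rewrite HTS1, (group_scal _ _ HS).
- rewrite <- HTf at 3. unfold S'. rewrite (group_scal _ _ HS).
  replace (- xi0 * 1) with (- xi0) by ring.
  transitivity (minus (scal (cis (- xi0) * cis xi0 : C_AbsRing)%C (T f))
    (scal (cis (- xi0) : C_AbsRing) (S 1 (T f)))); [vec V|].
  rewrite cis_opp. vec V.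
- apply extends_disk. exists r, h. split; [easy|]. intros z Hz.
  destruct (Hh z Hz) as [E Hd]. split; [easy|]. intros Hz1.
  apply (group_resolvent_unique z _ _ Hz1). now rewrite E, HG.
Qed.

End Transform.

(** * The translation group *)

Definition npos (r : R) : nonnegreal := mknonnegreal (Rmax 0 r) (Rmax_l 0 r).

Lemma nonnegreal_eq (a b : nonnegreal) : (a : R) = b -> a = b.
Proof.
destruct a as [a Ha], b as [b Hb]; simpl. intros ->. f_equal. apply proof_irrelevance.
Qed.

Lemma npos_id (r : R) (t : nonnegreal) : r = t -> npos r = t.
Proof.
intros ->. apply nonnegreal_eq. simpl. apply Rmax_right, cond_nonneg.
Qed.

Lemma npos_lip a b : Rabs (npos a - npos b) <= Rabs (a - b).
Proof.
simpl. unfold Rmax, Rabs. repeat destruct Rle_dec; repeat destruct Rcase_abs; lra.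
Qed.

Section Translations.

Variable X : CompleteNormedModule C_AbsRing.

Notation B := (BUC_complete X).
Notation Q := (Y_complete X).

(** For negative [t] the function is continued to the left by its value at 0. On $BUC$ this is not a
    group, but the error is supported in a bounded interval and vanishes modulo $C_0$. *)
Definition shiftR (t : R) (g : BUC X) : BUC X.
Proof.
refine (@mkBUC X (fun s => g (npos (s + t))) _ _).
- destruct (buc_bounded g) as [M HM]. exists M. intros s. apply HM.
- intros eps. destruct (buc_unif_cont g eps) as [d Hd]. exists d.
  intros r s Hrs. apply Hd. eapply Rle_lt_trans; [apply npos_lip|].
  now replace (r + t - (s + t)) with (r - s) by ring.
Defined.

Lemma shiftR_minus t u v : shiftR t (minus u v) = minus (shiftR t u) (shiftR t v).
Proof. apply BUC_ext. intros s. reflexivity. Qed.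

Lemma shiftR_plus t u v : shiftR t (plus u v) = plus (shiftR t u) (shiftR t v).
Proof. apply BUC_ext. intros s. reflexivity. Qed.

Lemma shiftR_scal t (c : C_AbsRing) u : shiftR t (scal c u) = scal c (shiftR t u).
Proof. apply BUC_ext. intros s. reflexivity. Qed.

Lemma shiftR_vanishes t u : vanishes_at_infinity u -> vanishes_at_infinity (shiftR t u).
Proof.
intros H eps. destruct (H eps) as [T HT]. exists (T - t). intros s Hs. apply HT. simpl.
apply Rle_trans with (s + t); [lra|apply Rmax_r].
Qed.

Definition tgroup (t : R) : Q -> Q := @quot_map _ _ (C0 X) (shiftR t).

Lemma tgroupE t g : tgroup t (tilde g) = tilde (shiftR t g).
Proof.
apply (@quot_map_class _ _ (C0 X)).
- apply shiftR_minus.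
- intros u Hu. now apply shiftR_vanishes.
Qed.

Lemma tilde_repr (a : Q) : exists g, a = tilde g.
Proof. exists (quot_repr a). symmetry. apply quot_reprK. Qed.

Lemma tilde_eventually (u v : BUC X) T : (forall t : nonnegreal, T <= t -> u t = v t) -> tilde u = tilde v.
Proof.
intros H. apply quot_classP. intros eps. exists T. intros t Ht.
rewrite BUC_minusE, H by easy. eapply Rle_lt_trans; [right|apply cond_pos].
etransitivity; [exact (f_equal (@norm C_AbsRing X) (minus_eq_zero (G := X) _))|apply (norm_zeroC X)].
Qed.

Lemma tilde_linear : @is_linear C_AbsRing B Q (@tilde X).
Proof. exact (quot_class_linear (BUC_NormedModule X) (C0 X)). Qed.

Lemma tilde_minus (u v : B) : tilde (minus u v) = minus (tilde u : Q) (tilde v).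
Proof. exact (linear_minus _ u v tilde_linear). Qed.

Lemma tilde_scal (c : C) (u : B) : tilde (scal (c : C_AbsRing) u) = scal (c : C_AbsRing) (tilde u : Q).
Proof. exact (linear_scal _ tilde_linear c u). Qed.

Lemma tilde_plus (u v : B) : tilde (plus u v) = plus (tilde u : Q) (tilde v).
Proof. exact (linear_plus _ tilde_linear u v). Qed.

Lemma eval_linear (t : nonnegreal) : @is_linear C_AbsRing B X (fun g : BUC X => g t).
Proof.
split.
- intros u v. reflexivity.
- intros c u. reflexivity.
- exists 1. split; [lra|]. intros u. rewrite Rmult_1_l. apply (BUC_norm_ge X u t).
Qed.

(** Uniform continuity of [g] is what makes its translates norm continuous, hence the group strongly
    continuous. *)
Lemma cont_shiftR (g : BUC X) : forall t, @cont_at R RtoC B (fun t => shiftR t g) t.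
Proof.
intros t eps He. destruct (buc_unif_cont g (mkposreal (eps / 2) ltac:(lra))) as [d Hd].
exists d. split; [apply cond_pos|]. intros s Hs. rewrite Cmod_RtoC_minus in Hs.
apply Rle_lt_trans with (eps / 2); [|lra].
apply (BUC_norm_le X). intros r.
change ((minus (shiftR s g : B) (shiftR t g)) r) with ((minus (shiftR s g) (shiftR t g) : BUC X) r).
rewrite BUC_minusE. left. apply Hd. eapply Rle_lt_trans; [apply npos_lip|].
now replace (r + s - (r + t)) with (s - t) by ring.
Qed.

Lemma tgroup_norm_le t (a : Q) : norm (tgroup t a) <= norm a.
Proof.
change (quot_norm (tgroup t a) <= quot_norm a). apply quot_norm_spec. intros u Hu.
apply quot_class_mem in Hu. rewrite Hu.
change (quot_norm (tgroup t (tilde u)) <= norm u). rewrite tgroupE.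
apply Rle_trans with (norm (shiftR t u)); [apply (quot_class_norm _ (C0 X) (shiftR t u))|].
apply (BUC_norm_le X). intros s. apply (BUC_norm_ge X u).
Qed.

(** The truncations on the two sides can differ only at points below $|s|$. *)
Lemma tgroup_add s t (a : Q) : tgroup (s + t) a = tgroup s (tgroup t a).
Proof.
destruct (tilde_repr a) as [g ->]. rewrite !tgroupE.
apply tilde_eventually with (Rabs s). intros r Hr. simpl. f_equal. apply nonnegreal_eq. simpl.
assert (H := Rle_abs (- s)). rewrite Rabs_Ropp in H.
rewrite (Rmax_right 0 (r + s)) by lra. f_equal. ring.
Qed.

Lemma tgroup_0 (a : Q) : tgroup 0 a = a.
Proof.
destruct (tilde_repr a) as [g ->]. rewrite tgroupE. f_equal. apply BUC_ext. intros s. simpl.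
f_equal. apply npos_id. ring.
Qed.

Lemma tgroup_isometric : isometric_group (V := Q) tgroup.
Proof.
split.
- intros t a b. destruct (tilde_repr a) as [u ->], (tilde_repr b) as [v ->].
  rewrite !tgroupE.
  refine (eq_trans (f_equal (tgroup t) (eq_sym (tilde_plus u v))) _).
  refine (eq_trans (tgroupE t (plus u v)) _).
  refine (eq_trans (f_equal (@tilde X) (shiftR_plus t u v)) _).
  exact (tilde_plus (shiftR t u) (shiftR t v)).
- intros t c a. destruct (tilde_repr a) as [u ->].
  rewrite !tgroupE.
  refine (eq_trans (f_equal (tgroup t) (eq_sym (tilde_scal c u))) _).
  refine (eq_trans (tgroupE t (scal (c : C_AbsRing) u)) _).
  refine (eq_trans (f_equal (@tilde X) (shiftR_scal t c u)) _).
  exact (tilde_scal c (shiftR t u)).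
(* Every [tgroup t] is a contraction, including its inverse [tgroup (- t)]. *)
- intros t a. apply Rle_antisym; [apply tgroup_norm_le|].
  replace a with (tgroup (- t) (tgroup t a)) at 1; [apply tgroup_norm_le|].
  rewrite <- tgroup_add, Rplus_opp_l. apply tgroup_0.
- apply tgroup_add.
- apply tgroup_0.
- intros a t eps He. destruct (tilde_repr a) as [g ->].
  destruct (cont_shiftR g t eps He) as [d [Hd H]]. exists d. split; [easy|].
  intros s Hs. specialize (H s Hs). rewrite !tgroupE, <- tilde_minus.
  eapply Rle_lt_trans; [|exact H]. apply (quot_class_norm _ (C0 X)).
Qed.

Lemma shift_tilde_tgroup (a : Y X) : shift_tilde (mknonnegreal 1 Rle_0_1) a = tgroup 1 a.
Proof.
destruct (tilde_repr a) as [g ->]. rewrite tgroupE. rewrite shift_tildeE. f_equal.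
apply BUC_ext. intros s. simpl. f_equal. symmetry. now apply npos_id.
Qed.

Definition ext (g : BUC X) (r : R) : X := g (npos r).

Lemma cont_ext_fun g : cont (ext g).
Proof.
intros x eps He. destruct (buc_unif_cont g (mkposreal eps He)) as [d Hd].
exists d. split; [apply cond_pos|]. intros y Hy. apply Hd. rewrite Cmod_RtoC_minus in Hy.
eapply Rle_lt_trans; [apply npos_lip|exact Hy].
Qed.

(** A lift of [transform] to $BUC$, where functions have values and [has_derivative] can be checked
    pointwise. *)
Definition integral (z : C) (g : BUC X) : BUC X :=
  VInt B (fun s => scal (expker z s : C_AbsRing) (shiftR s g : B)) 0 1.

Lemma cont_integrand z g : forall t,
  @cont_at R RtoC B (fun s => scal (expker z s : C_AbsRing) (shiftR s g : B)) t.
Proof. apply cont_scal; [apply contC_expker|apply cont_shiftR]. Qed.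

Lemma transform_tilde z g : transform Q tgroup z (tilde g) = tilde (integral z g).
Proof.
unfold transform, integral.
rewrite <- (VInt_linear B Q (@tilde X) _ 0 1 tilde_linear (cont_integrand z g)).
apply VInt_ext; [lra|]. intros s _. rewrite tgroupE. symmetry. apply tilde_scal.
Qed.

Lemma integral_eval z g (t : nonnegreal) :
  integral z g t = VInt X (fun s => scal (expker z s : C_AbsRing) (ext g (t + s))) 0 1.
Proof.
exact (eq_sym (VInt_linear B X (fun g : BUC X => g t) _ 0 1 (eval_linear t) (cont_integrand z g))).
Qed.

Lemma diff_exp_scal (z : C) (a : R) (w : R -> X) x l :
  diff_at RtoC w x l ->
  diff_at RtoC (fun t => scal (cexp (z * RtoC (a + t)) : C_AbsRing) (w t)) x
    (plus (scal (z * cexp (z * RtoC (a + x)) : C_AbsRing)%C (w x))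
      (scal (cexp (z * RtoC (a + x)) : C_AbsRing) l)).
Proof.
intros Hw. set (e := cexp (z * RtoC (a + x))). assert (He := Cmod_ge_0 e). assert (Hz := Cmod_ge_0 z).
apply (diff_op R RtoC X X (fun t v => scal (cexp (z * RtoC (a + t)) : C_AbsRing) v)
  (fun v => scal (z * e : C_AbsRing)%C v) w x l ((1 + Cmod z) * (1 + Cmod e))
  (13 * (1 + Cmod e) * ((1 + Cmod z) * (1 + Cmod z))) (/ (1 + Cmod z))).
- intros y u v. vec X.
- intros c u. vec X.
- intros u v. vec X.
- intros v. rewrite (norm_scalC X). fold e. apply Rmult_le_compat_r; [apply norm_ge_0|]. nra.
- intros v. rewrite (norm_scalC X), Cmod_mult. apply Rmult_le_compat_r; [apply norm_ge_0|]. nra.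
- nra.
- nra.
- apply Rinv_0_lt_compat. lra.
- intros y v Hy. rewrite Cmod_RtoC_minus, <- RtoC_minus in *.
  set (h := (z * RtoC (y - x))%C).
  assert (Hh : Cmod h <= (1 + Cmod z) * Rabs (y - x)).
  { unfold h. rewrite Cmod_mult, Cmod_R. apply Rmult_le_compat_r; [apply Rabs_pos|lra]. }
  assert (Hh1 : Cmod h <= 1).
  { eapply Rle_trans; [exact Hh|]. apply (Rmult_le_compat_l (1 + Cmod z)) in Hy; [|lra].
    rewrite Rinv_r in Hy; lra. }
  assert (Hq := cexp_quad h Hh1).
  assert (E : cexp (z * RtoC (a + y)) = (e * cexp h)%C).
  { unfold e, h. rewrite <- cexp_plus. f_equal. rewrite !RtoC_plus, RtoC_minus. ring. }
  rewrite E. fold e.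
  norm_as X (scal (e * (cexp h - 1 - z * RtoC (y - x)) : C_AbsRing)%C v). fold h.
  rewrite (norm_scalC X), Cmod_mult. apply Rmult_le_compat_r; [apply norm_ge_0|].
  assert (H0 := Cmod_ge_0 h). assert (H1 := Rabs_pos (y - x)).
  set (b := (1 + Cmod z) * Rabs (y - x)) in *.
  replace (13 * (1 + Cmod e) * ((1 + Cmod z) * (1 + Cmod z)) * Rabs (y - x) * Rabs (y - x))
    with ((1 + Cmod e) * (13 * b * b)) by (unfold b; ring).
  apply Rmult_le_compat; [easy|apply Cmod_ge_0|lra|]. nra.
- exact Hw.
Qed.

Lemma diff_shift (w : R -> X) x a l : diff_at RtoC w (x + a) l -> diff_at RtoC (fun t => w (t + a)) x l.
Proof.
intros H eps He. destruct (H eps He) as [d [Hd H1]]. exists d. split; [easy|]. intros y Hy.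
specialize (H1 (y + a)). rewrite !Cmod_RtoC_minus, <- !RtoC_minus in *.
replace (y + a - (x + a)) with (y - x) in H1 by ring. now apply H1.
Qed.

Lemma diff_minus (u v : R -> X) x l m :
  diff_at RtoC u x l -> diff_at RtoC v x m ->
  diff_at RtoC (fun t => minus (u t) (v t)) x (minus l m).
Proof.
intros Hu Hv eps He. destruct (Hu (eps / 2) ltac:(lra)) as [d [Hd H1]].
destruct (Hv (eps / 2) ltac:(lra)) as [d' [Hd' H2]].
exists (Rmin d d'). split; [now apply Rmin_glb_lt|]. intros y Hy.
specialize (H1 y (Rlt_le_trans _ _ _ Hy (Rmin_l _ _))).
specialize (H2 y (Rlt_le_trans _ _ _ Hy (Rmin_r _ _))).
norm_as X (minus (minus (minus (u y) (u x)) (scal (Cminus (RtoC y) (RtoC x) : C_AbsRing) l))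
  (minus (minus (v y) (v x)) (scal (Cminus (RtoC y) (RtoC x) : C_AbsRing) m))).
eapply Rle_trans; [apply (norm_minus_le X)|].
eapply Rle_trans; [apply Rplus_le_compat; [exact H1|exact H2]|]. lra.
Qed.

(** Since [g] is merely continuous, $x$ must leave its argument: substituting $r=x+s$ gives
    $e^{z(1+x)}\int_x^{x+1}e^{-zr}g(r)\,dr$, where $x$ occurs only in the exponential and in the
    limits. *)
Lemma integral_diff z g (x : R) :
  diff_at RtoC (fun t => VInt X (fun s => scal (expker z s : C_AbsRing) (ext g (t + s))) 0 1) x
    (minus (scal (z : C_AbsRing) (VInt X (fun s => scal (expker z s : C_AbsRing) (ext g (x + s))) 0 1))
      (minus (scal (cexp z : C_AbsRing) (ext g x)) (ext g (x + 1)))).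
Proof.
set (p := (fun r => scal (cexp (- z * RtoC (0 + r)) : C_AbsRing) (ext g r)) : R -> X).
assert (Hexp : contC (fun r => cexp (- z * RtoC (0 + r)))).
{ intros r. apply cont_ext with (fun s => expker z (1 + s) : AbsRing_NormedModule C_AbsRing).
  - intros s. unfold expker. f_equal. replace (1 - (1 + s)) with (- (0 + s)) by ring.
    rewrite RtoC_opp. ring.
  - apply (contC_comp_plus (expker z) 1), contC_expker. }
assert (Hp : cont p) by (apply cont_scal; [exact Hexp|apply cont_ext_fun]).
set (Phi := fun y => VInt X p 0 y).
assert (HPhi : forall y, diff_at RtoC Phi y (p y)) by (intros y; now apply diff_VInt).
assert (HU : forall t, VInt X (fun s => scal (expker z s : C_AbsRing) (ext g (t + s))) 0 1
  = scal (cexp (z * RtoC (1 + t)) : C_AbsRing) (minus (Phi (t + 1)) (Phi t))).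
{ intros t. unfold Phi.
  replace (minus (VInt X p 0 (t + 1)) (VInt X p 0 t)) with (VInt X p t (t + 1))
    by (rewrite <- (VInt_chasles X p 0 t (t + 1) Hp); vec X).
  replace (VInt X p t (t + 1)) with (VInt X (fun s => p (s + t)) 0 1)
    by (rewrite (VInt_shift X p 0 1 t Hp); f_equal; ring).
  rewrite <- (VInt_scal X _ _ 0 1 (cont_shift X p t Hp)).
  apply VInt_ext; [lra|]. intros s _. unfold p. rewrite (Rplus_comm s t).
  replace (expker z s) with (cexp (z * RtoC (1 + t)) * cexp (- z * RtoC (0 + (t + s))))%C; [vec X|].
  rewrite <- cexp_plus. unfold expker. f_equal.
  rewrite !RtoC_plus, RtoC_minus. ring. }
assert (HD := diff_exp_scal z 1 (fun t => minus (Phi (t + 1)) (Phi t)) x _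
  (diff_minus _ _ x _ _ (diff_shift Phi x 1 _ (HPhi (x + 1))) (HPhi x))).
rewrite HU.
replace (minus (scal (z : C_AbsRing) (scal (cexp (z * RtoC (1 + x)) : C_AbsRing) (minus (Phi (x + 1)) (Phi x))))
  (minus (scal (cexp z : C_AbsRing) (ext g x)) (ext g (x + 1))))
  with (plus (scal (z * cexp (z * RtoC (1 + x)) : C_AbsRing)%C (minus (Phi (x + 1)) (Phi x)))
    (scal (cexp (z * RtoC (1 + x)) : C_AbsRing) (minus (p (x + 1)) (p x)))).
- intros eps He. destruct (HD eps He) as [d [Hd H]]. exists d. split; [easy|]. intros y Hy.
  rewrite !HU. now apply H.
- unfold p.
  assert (E1 : (cexp (z * RtoC (1 + x)) * cexp (- z * RtoC (0 + (x + 1))) = 1)%C).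
  { rewrite <- cexp_plus, <- cexp_0. f_equal. rewrite !RtoC_plus. ring. }
  assert (E2 : (cexp (z * RtoC (1 + x)) * cexp (- z * RtoC (0 + x)))%C = cexp z).
  { rewrite <- cexp_plus. f_equal. rewrite !RtoC_plus. ring. }
  transitivity (plus (scal (z * cexp (z * RtoC (1 + x)) : C_AbsRing)%C (minus (Phi (x + 1)) (Phi x)))
    (minus (scal (cexp (z * RtoC (1 + x)) * cexp (- z * RtoC (0 + (x + 1))) : C_AbsRing)%C (ext g (x + 1)))
      (scal (cexp (z * RtoC (1 + x)) * cexp (- z * RtoC (0 + x)) : C_AbsRing)%C (ext g x)))); [vec X|].
  rewrite E1, E2. vec X.
Qed.

Lemma diff_has_derivative (u v : BUC X) (w : R -> X) :
  (forall t : nonnegreal, u t = w t) -> (forall t : nonnegreal, diff_at RtoC w t (v t)) ->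
  has_derivative u v.
Proof.
intros Hu Hw t eps. destruct (Hw t (eps / 2)) as [d [Hd H]].
{ assert (H := cond_pos eps). lra. }
exists (mkposreal d Hd). intros s Hst Hs. simpl in Hs.
specialize (H s). rewrite Cmod_RtoC_minus, <- RtoC_minus in H. specialize (H Hs).
assert (Hn : RtoC (s - t) <> RtoC 0).
{ intros E. apply Hst. injection E. lra. }
rewrite !Hu.
norm_as X (scal (RtoC (/ (s - t)) : C_AbsRing)
  (minus (minus (w s) (w t)) (scal (RtoC (s - t) : C_AbsRing) (v t)))).
- rewrite (norm_scalC X), Cmod_R, Rabs_inv.
  assert (Hp : 0 < Rabs (s - t)) by (apply Rabs_pos_lt; lra).
  apply Rle_lt_trans with (/ Rabs (s - t) * (eps / 2 * Rabs (s - t))).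
  + apply Rmult_le_compat_l; [left; now apply Rinv_0_lt_compat|exact H].
  + replace (/ Rabs (s - t) * (eps / 2 * Rabs (s - t))) with (eps / 2) by (field; lra).
    assert (He := cond_pos eps). lra.
- rewrite RtoC_inv by lra. field. exact Hn.
Qed.

(** The point 0 is excluded because [ext u] is constant to its left, while the derivative of [u]
    there is one-sided. *)
Lemma has_derivative_diff (u v : BUC X) (t : nonnegreal) :
  has_derivative u v -> 0 < t -> diff_at RtoC (ext u) t (v t).
Proof.
intros H Ht eps He. destruct (H t (mkposreal eps He)) as [d Hd].
exists (Rmin d t). split; [apply Rmin_glb_lt; [apply cond_pos|easy]|]. intros y Hy.
rewrite Cmod_RtoC_minus, <- RtoC_minus in *.
assert (A1 := Rlt_le_trans _ _ _ Hy (Rmin_l _ _)).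
assert (A2 := Rlt_le_trans _ _ _ Hy (Rmin_r _ _)).
apply Rabs_def2 in A2.
destruct (Req_dec y t) as [->|Hn].
{ unfold ext. rewrite Rminus_diag, Rabs_R0, Rmult_0_r.
  right. etransitivity; [|apply (norm_zeroC X)]. f_equal. vec X. }
assert (Hy0 : (npos y : R) = y) by (simpl; apply Rmax_right; lra).
assert (Ht0 : npos t = t) by now apply npos_id.
specialize (Hd (npos y)). rewrite Hy0 in Hd. specialize (Hd Hn A1). simpl in Hd.
assert (Hc : RtoC (y - t) <> RtoC 0) by (intros E; injection E; lra).
unfold ext. rewrite Ht0.
norm_as X (scal (RtoC (y - t) : C_AbsRing)
  (minus (scal (RtoC (/ (y - t)) : C_AbsRing) (minus (u (npos y)) (u t))) (v t))).
{ rewrite (norm_scalC X), Cmod_R, Rmult_comm. apply Rmult_le_compat_r; [apply Rabs_pos|].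
  left. exact Hd. }
all: rewrite RtoC_inv by lra; field; exact Hc.
Qed.

(** This is $(z-\tilde{\mathcal D})B(z)=e^z-\tilde S(1)$: applied to a solution of $(e^z-\tilde
    S(1))x=\tilde f$, it shows that $z-\tilde{\mathcal D}$ takes the value $\tilde f$. *)
Lemma D_tilde_transform z (a : Q) :
  D_tilde (transform Q tgroup z a)
    (minus (scal (z : C_AbsRing) (transform Q tgroup z a))
      (minus (scal (cexp z : C_AbsRing) a) (tgroup 1 a))).
Proof.
destruct (tilde_repr a) as [g ->]. rewrite transform_tilde.
set (u := integral z g).
set (v := minus (scal (z : C_AbsRing) (u : B)) (minus (scal (cexp z : C_AbsRing) (g : B)) (shiftR 1 g)) : B).
exists u, v. split; [|split; [easy|]].
- apply diff_has_derivative with (fun t => VInt X (fun s => scal (expker z s : C_AbsRing) (ext g (t + s))) 0 1).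
  + intros t. apply integral_eval.
  + intros t. replace ((v : BUC X) t) with
      (minus (scal (z : C_AbsRing) (VInt X (fun s => scal (expker z s : C_AbsRing) (ext g (t + s))) 0 1))
        (minus (scal (cexp z : C_AbsRing) (ext g t)) (ext g (t + 1)))).
    * apply integral_diff.
    * rewrite <- integral_eval. unfold ext. rewrite (npos_id t t) by easy.
      symmetry. exact (eq_trans (linear_minus _ _ _ (eval_linear t))
        (f_equal2 (fun a b => minus a b) eq_refl (linear_minus _ _ _ (eval_linear t)))).
- unfold v. rewrite tgroupE, !tilde_minus, !tilde_scal. reflexivity.
Qed.

(** The reversed product, $(e^z-\tilde S(1))x=B(z)(z-\tilde{\mathcal D})x$ on the domain, by
    integrating the derivative of $e^{z(1-s)}u(t+s)$ over $[0,1]$. *)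
Lemma D_tilde_resolvent z (x w : Q) (y : Q) :
  D_tilde x w -> minus (scal (z : C_AbsRing) x) w = y ->
  minus (scal (cexp z : C_AbsRing) x) (tgroup 1 x) = transform Q tgroup z y.
Proof.
intros (u & v & Huv & -> & ->) <-.
set (g := minus (scal (z : C_AbsRing) (u : B)) v : B).
replace (minus (scal (z : C_AbsRing) (tilde u : Q)) (tilde v)) with (tilde g : Q)
  by (unfold g; rewrite tilde_minus, tilde_scal; reflexivity).
rewrite transform_tilde, tgroupE, <- tilde_scal, <- tilde_minus.
(* Classes ignore bounded sets; taking $t\ge1$ keeps $t+s$ away from the endpoint, where
   [has_derivative_diff] does not apply. *)
apply tilde_eventually with 1. intros t Ht.
transitivity (minus (scal (cexp z : C_AbsRing) (u t)) (ext u (t + 1))).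
{ exact (linear_minus _ _ _ (eval_linear t)). }
rewrite integral_eval.
set (P := (fun s => scal (cexp (- z * RtoC (-1 + s)) : C_AbsRing) (ext u (s + t))) : R -> X).
assert (HP : forall s, 0 <= s <= 1 ->
  diff_at RtoC P s (opp (scal (expker z s : C_AbsRing) (ext g (t + s))))).
{ intros s Hs.
  assert (Hst : diff_at RtoC (ext u) (s + t) (ext v (s + t))).
  { assert (E : (npos (s + t) : R) = s + t) by (simpl; apply Rmax_right; lra).
    unfold ext at 2. rewrite <- E at 1. apply has_derivative_diff; [easy|]. rewrite E. lra. }
  assert (HD := diff_exp_scal (- z) (-1) (fun s => ext u (s + t)) s _ (diff_shift (ext u) s t _ Hst)).
  replace (opp (scal (expker z s : C_AbsRing) (ext g (t + s))))
    with (plus (scal (- z * cexp (- z * RtoC (-1 + s)) : C_AbsRing)%C (ext u (s + t)))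
      (scal (cexp (- z * RtoC (-1 + s)) : C_AbsRing) (ext v (s + t)))); [exact HD|].
  replace (cexp (- z * RtoC (-1 + s))) with (expker z s).
  2:{ unfold expker. f_equal. replace (1 - s) with (- (-1 + s)) by ring. rewrite RtoC_opp. ring. }
  rewrite (Rplus_comm t s).
  replace (ext g (s + t)) with (minus (scal (z : C_AbsRing) (ext u (s + t))) (ext v (s + t))).
  - vec X.
  - symmetry. exact (linear_minus _ _ _ (eval_linear (npos (s + t)))). }
assert (Hc : cont (fun s => scal (expker z s : C_AbsRing) (ext g (t + s)))).
{ apply cont_scal; [apply contC_expker|].
  apply (cont_comp_le X (ext g) (fun s => t + s) 1); [|apply cont_ext_fun].
  intros a b. replace (t + b - (t + a)) with (b - a) by ring. lra. }
assert (Ho : cont (fun s => opp (scal (expker z s : C_AbsRing) (ext g (t + s))))).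
{ intros s. apply cont_ext with
    (fun s => scal (opp one : C_AbsRing) (scal (expker z s : C_AbsRing) (ext g (t + s)))).
  - intros r. vec X.
  - revert s. apply cont_scal; [apply contC_const|exact Hc]. }
assert (E := VInt_ftc X P _ 0 1 Rle_0_1 HP Ho).
transitivity (opp (VInt X (fun s => opp (scal (expker z s : C_AbsRing) (ext g (t + s)))) 0 1)).
- rewrite E. unfold P.
  replace (- z * RtoC (-1 + 1))%C with (RtoC 0) by (replace (-1 + 1) with 0 by ring; ring).
  assert (Ez : (- z * RtoC (-1 + 0) = z)%C)
    by (replace (-1 + 0) with (- (1)) by ring; rewrite RtoC_opp; ring).
  rewrite Ez.
  rewrite cexp_0. rewrite (Rplus_comm 1 t), Rplus_0_l.
  assert (Et : ext u t = u t) by (unfold ext; now rewrite (npos_id t t)).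
  rewrite Et. vec X.
- transitivity (scal (opp one : C_AbsRing)
    (VInt X (fun s => opp (scal (expker z s : C_AbsRing) (ext g (t + s)))) 0 1)); [vec X|].
  rewrite <- (VInt_scal X _ _ 0 1 Ho). apply VInt_ext; [lra|]. intros s _. cbv beta. vec X.
Qed.

End Translations.

Section Spectra.

Variables (X : CompleteNormedModule C_AbsRing) (f : BUC X).

Notation Q := (Y_complete X).

Definition circular_resolvent (z : C) : Q :=
  resolvent (fun a b : Y X => b = shift_tilde (mknonnegreal 1 Rle_0_1) a) z (tilde f).

Lemma circular_resolvent_eq z : Cmod z <> 1 ->
  minus (scal (z : C_AbsRing) (circular_resolvent z)) (tgroup X 1 (circular_resolvent z)) = tilde f.
Proof.
intros Hz. unfold circular_resolvent, resolvent.
match goal with |- context [epsilon ?i ?P] => assert (H : P (epsilon i P)) end.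
{ apply epsilon_spec.
  destruct (group_resolvent_exists Q (tgroup X) (tgroup_isometric X) z (tilde f) Hz) as [x Hx].
  exists x, (tgroup X 1 x). split; [symmetry; apply shift_tilde_tgroup|exact Hx]. }
destruct H as (w & Hw & H). rewrite shift_tilde_tgroup in Hw. rewrite Hw in H. exact H.
Qed.

(** [hat f z] is a choice among the solutions of the defining equation. Existence comes from
    [D_tilde_transform], and [D_tilde_resolvent] yields this equation for whichever solution was
    chosen. *)
Lemma hat_eq z : fst z <> 0 ->
  minus (scal (cexp z : C_AbsRing) (hat f z : Q)) (tgroup X 1 (hat f z))
  = transform Q (tgroup X) z (tilde f).
Proof.
intros Hz. unfold hat, resolvent.
match goal with |- context [epsilon ?i ?P] => assert (H : P (epsilon i P)) end.
{ apply epsilon_spec.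
  destruct (group_resolvent_exists Q (tgroup X) (tgroup_isometric X) (cexp z) (tilde f)
    (Cmod_cexp_neq1 z Hz)) as [x Hx].
  exists (transform Q (tgroup X) z x). eexists. split; [apply D_tilde_transform|].
  rewrite Hx. vec (Y_complete X). }
destruct H as (w & Hw & H). exact (D_tilde_resolvent X z _ w _ Hw H).
Qed.

End Spectra.

Theorem corollary3p4 (X : CompleteNormedModule C_AbsRing) (f : BUC X) (z : C) :
  circular_spectrum f z <->
  closure (fun w : C => exists xi : R, sp f xi /\ w = cis xi) z.
Proof.
set (Q := Y_complete X).
assert (HS := tgroup_isometric X : isometric_group (V := Q) (tgroup X)).
assert (HF := hat_eq X f). assert (HG := circular_resolvent_eq X f).
split.
- intros [Hz Hext]. apply NNPP. intros Hcl.
  apply not_all_ex_not in Hcl. destruct Hcl as [eps Heps].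
  destruct (unit_cis z Hz) as [xi0 ->]. apply Hext.
  apply (transform_extends_resolvent Q (tgroup X) HS (tilde f) (hat f) (circular_resolvent X f) HF HG
    xi0 eps (cond_pos eps)).
  intros xi Hxi. apply NNPP. intros Hsp. apply Heps. exists (cis xi).
  split; [now apply ball_of_Cmod|]. now exists xi.
- intros Hcl.
  assert (Hap : forall e, 0 < e -> exists xi, sp f xi /\ Cmod (cis xi - z) < e).
  { intros e He. destruct (Hcl (mkposreal (e / 2) ltac:(lra))) as [y [Hy [xi [Hxi ->]]]].
    exists xi. split; [easy|]. apply Cmod_of_ball in Hy. simpl in Hy. lra. }
  split.
  (* The unit circle is closed, so a limit of points [cis xi] lies on it. *)
  + apply Rminus_diag_uniq. apply cond_eq. intros e He.
    destruct (Hap e He) as [xi [_ Hxi]]. rewrite Rminus_0_r.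
    apply Rle_lt_trans with (2 := Hxi). rewrite <- (Cmod_cis xi).
    apply Rabs_le. split.
    * assert (H := Cmod_triangle (cis xi - z) z). replace (cis xi - z + z)%C with (cis xi) in H by ring. lra.
    * assert (H := Cmod_triangle (z - cis xi) (cis xi)).
      replace (z - cis xi + cis xi)%C with z in H by ring. rewrite Cmod_minus_sym in H. lra.
  (* An extension around [z] is also one around any [cis xi] in the same disk, on the smaller radius
     left over; choosing [xi] in [sp f] contradicts the other extension lemma. *)
  + intros Hext. apply extends_disk in Hext. destruct Hext as (d & h & Hd & Hh).
    destruct (Hap d Hd) as [xi [Hxi Hd']]. apply Hxi.
    apply (resolvent_extends_transform Q (tgroup X) HS (tilde f) (hat f) (circular_resolvent X f) HF HG).
    apply extends_disk. exists (d - Cmod (cis xi - z)), h. split; [lra|]. intros w Hw.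
    apply Hh. eapply Rle_lt_trans; [apply (Cmod_minus_triangle w (cis xi))|]. lra.
Qed.
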